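(* A Turing degree $\mathbf d$ is high for isomorphism if and only if it is both high for descending sequences and Scott complete.
   Context: A degree $\mathbf d$ is high for isomorphism if for any two isomorphic computable structures $\mathcal M\cong\mathcal N$ there is a $\mathbf d$-computable isomorphism from $\mathcal M$ to $\mathcal N$. A degree $\mathbf d$ is high for descending sequences if every computable ill-founded linear order has a $\mathbf d$-computable infinite descending sequence. A Harrison order is a computable linear order of order type $\omega_1^{ck}(1+\mathbb Q)$. A degree $\mathbf d$ is Scott complete if there is an algorithm which, given indices for a computable structure $\mathcal A$ and a Harrison order $\mathcal H$, produces an index for a $\mathbf d$-computable function $\mathbf b:(\mathcal A^{<\omega})^2\times\mathcal H\to\{0,1\}$ such that, writing $\bar a\le_x\bar b$ for $\mathbf b(\bar a,\bar b,x)=1$: (1) if $\mathbf 1$ is the least element of $\mathcal H$, then $\bar a\le_{\mathbf 1}\bar b$ iff every finitary $\Sigma_1$ formula true of $\bar b$ in $\mathcal A$ is true of $\bar a$ in $\mathcal A$; (2) if $x\in\mathcal H$ is not the least element, then $\bar a\le_x\bar b$ iff for every finite tuple $\bar d\subseteq\mathcal A$ and every $y<_{\mathcal H}x$ there is a finite tuple $\bar c\subseteq\mathcal A$ with $\bar b\bar d\le_y\bar a\bar c$. *)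

(* Defs.v *)
From Stdlib Require Import Arith List Cantor QArith Qcanon.
Import ListNotations.
Local Open Scope nat_scope.

(** * Oracle computability *)

Definition npair (a b : nat) : nat := Cantor.to_nat (a, b).

(** Programs compute unary partial functions on [nat]; several arguments are
    passed as one number by Cantor pairing. [Orc] queries the oracle. *)
Inductive code : Type :=
| Zero | Succ | Fst | Snd | Orc
| Pair (c d : code)
| Comp (c d : code)
| Rec (c d : code)
| Min (c : code).

(** [Rec c d] maps [<a, 0>] to [c(a)] and [<a, k+1>] to [d(<a, <k, r>>)], where
    [r] is the value at [<a, k>]. *)
Fixpoint rec_graph (F G : nat -> nat -> Prop) (a k m : nat) : Prop :=
  match k with
  | 0 => F a m
  | S k' => exists r, rec_graph F G a k' r /\ G (npair a (npair k' r)) m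
  end.

(** [eval X c n m]: program [c] with oracle [X] halts on [n] with output [m].
    [Min c] maps [a] to the least [k] with [c(<a, k>) = 0], [c] being defined
    and nonzero at all [<a, j>] with [j < k]. *)
Fixpoint eval (X : nat -> bool) (c : code) (n m : nat) : Prop :=
  match c with
  | Zero => m = 0
  | Succ => m = S n
  | Fst => m = fst (Cantor.of_nat n)
  | Snd => m = snd (Cantor.of_nat n)
  | Orc => m = Nat.b2n (X n)
  | Pair c d => exists u v, eval X c n u /\ eval X d n v /\ m = npair u v
  | Comp c d => exists u, eval X d n u /\ eval X c u m
  | Rec c d =>
      rec_graph (eval X c) (eval X d)
        (fst (Cantor.of_nat n)) (snd (Cantor.of_nat n)) m
  | Min c =>
      eval X c (npair n m) 0 /\
      forall j, j < m -> exists v, eval X c (npair n j) (S v)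
  end.

(** A bijection between programs and numbers. *)
Fixpoint encode (c : code) : nat :=
  match c with
  | Zero => 0
  | Succ => 1
  | Fst => 2
  | Snd => 3
  | Orc => 4
  | Pair c d => 5 + 4 * npair (encode c) (encode d)
  | Comp c d => 6 + 4 * npair (encode c) (encode d)
  | Rec c d => 7 + 4 * npair (encode c) (encode d)
  | Min c => 8 + 4 * encode c
  end.

(** [phi X e n m]: the [e]-th partial [X]-computable function maps [n] to [m]. *)
Definition phi (X : nat -> bool) (e n m : nat) : Prop :=
  exists c, encode c = e /\ eval X c n m.

(** The empty oracle, for computability without oracle. *)
Definition no_oracle : nat -> bool := fun _ => false.

Definition decides (X : nat -> bool) (e n : nat) (P : Prop) : Prop :=
  (P -> phi X e n 1) /\ (~ P -> phi X e n 0).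

(** * Turing degrees *)

Definition turing_le (X Y : nat -> bool) : Prop :=
  exists e, forall n, phi Y e n (Nat.b2n (X n)).

Definition turing_equiv (X Y : nat -> bool) : Prop :=
  turing_le X Y /\ turing_le Y X.

Record turing_degree : Type := {
  in_degree : (nat -> bool) -> Prop;
  in_degreeP : exists X, forall Y, in_degree Y <-> turing_equiv X Y
}.

(** The function [f], considered on the set [D] only, is [d]-computable. *)
Definition degree_computable_on
    (d : turing_degree) (D : nat -> Prop) (f : nat -> nat) : Prop :=
  exists X e, in_degree d X /\ forall x, D x -> phi X e x (f x).

(** * Codes for tuples *)

Fixpoint tuple_code (l : list nat) : nat :=
  match l with
  | [] => 0
  | a :: l' => S (npair a (tuple_code l'))
  end.

Definition option_code (o : option nat) : nat :=
  match o with None => 0 | Some k => S k end.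

(** * Languages and structures *)

(** Relation and function symbols are named by numbers: [rel_ar i = Some k]
    means that the [i]-th relation symbol belongs to the language and has arity
    [k]; [None] means that it does not belong. Constants are function symbols
    of arity [0]. *)
Record language : Type := {
  rel_ar : nat -> option nat;
  fun_ar : nat -> option nat
}.

(** The universe is a subset of [nat]. Values of [srel] and [sfun] at symbols
    outside the language, at tuples of the wrong length or at tuples not in the
    universe are irrelevant. *)
Record structure (L : language) : Type := {
  dom : nat -> Prop;
  srel : nat -> list nat -> Prop;
  sfun : nat -> list nat -> nat;
  dom_nonempty : exists x, dom x;
  sfun_dom : forall i l,
    fun_ar L i = Some (length l) -> Forall dom l -> dom (sfun i l)
}.
Arguments dom {L}.
Arguments srel {L}.
Arguments sfun {L}.

Definition is_language_index (e : nat) (L : language) : Prop :=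
  exists r f, e = npair r f /\
    (forall i, phi no_oracle r i (option_code (rel_ar L i))) /\
    (forall i, phi no_oracle f i (option_code (fun_ar L i))).

(** An index for a structure includes an index for its language. *)
Definition is_structure_index (e : nat) (L : language) (A : structure L) : Prop :=
  exists eL u r f, e = npair eL (npair u (npair r f)) /\
    is_language_index eL L /\
    (forall x, decides no_oracle u x (dom A x)) /\
    (forall i l, rel_ar L i = Some (length l) -> Forall (dom A) l ->
       decides no_oracle r (npair i (tuple_code l)) (srel A i l)) /\
    (forall i l, fun_ar L i = Some (length l) -> Forall (dom A) l ->
       phi no_oracle f (npair i (tuple_code l)) (sfun A i l)).

Definition computable_structure (L : language) (A : structure L) : Prop :=
  exists e, is_structure_index e L A.

Definition is_isomorphism
    (L : language) (M N : structure L) (f : nat -> nat) : Prop :=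
  (forall x, dom M x -> dom N (f x)) /\
  (forall x y, dom M x -> dom M y -> f x = f y -> x = y) /\
  (forall y, dom N y -> exists x, dom M x /\ f x = y) /\
  (forall i l, rel_ar L i = Some (length l) -> Forall (dom M) l ->
     (srel M i l <-> srel N i (map f l))) /\
  (forall i l, fun_ar L i = Some (length l) -> Forall (dom M) l ->
     f (sfun M i l) = sfun N i (map f l)).

Definition isomorphic (L : language) (M N : structure L) : Prop :=
  exists f, is_isomorphism L M N f.

Definition high_for_isomorphism (d : turing_degree) : Prop :=
  forall (L : language) (M N : structure L),
    computable_structure L M -> computable_structure L N -> isomorphic L M N ->
    exists f, is_isomorphism L M N f /\ degree_computable_on d (dom M) f.

(** * Linear orders *)

Record order (T : Type) : Type := {
  odom : T -> Prop;
  olt : T -> T -> Prop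
}.
Arguments odom {T}.
Arguments olt {T}.

Definition linear {T : Type} (P : order T) : Prop :=
  (forall x, odom P x -> ~ olt P x x) /\
  (forall x y z, odom P x -> odom P y -> odom P z ->
     olt P x y -> olt P y z -> olt P x z) /\
  (forall x y, odom P x -> odom P y -> olt P x y \/ x = y \/ olt P y x).

Definition wf_order {T : Type} (P : order T) : Prop :=
  well_founded (fun x y => odom P x /\ odom P y /\ olt P x y).

Definition order_iso {T U : Type} (P : order T) (Q : order U) : Prop :=
  exists f : T -> U,
    (forall x, odom P x -> odom Q (f x)) /\
    (forall x y, odom P x -> odom P y -> f x = f y -> x = y) /\
    (forall y, odom Q y -> exists x, odom P x /\ f x = y) /\
    (forall x y, odom P x -> odom P y -> (olt P x y <-> olt Q (f x) (f y))).

Definition below {T : Type} (P : order T) (a : T) : order T :=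
  {| odom := fun x => odom P x /\ olt P x a; olt := olt P |}.

(** The order type product [P * Q]: [Q] many copies of [P]. *)
Definition order_prod {T U : Type} (P : order T) (Q : order U) : order (T * U) :=
  {| odom := fun x => odom P (fst x) /\ odom Q (snd x);
     olt := fun x y => olt Q (snd x) (snd y) \/
                       (snd x = snd y /\ olt P (fst x) (fst y)) |}.

(** [1 + Q], with [None] the least element. *)
Definition one_plus_Q : order (option Qc) :=
  {| odom := fun _ => True;
     olt := fun x y =>
       match x, y with
       | None, Some _ => True
       | Some p, Some q => Qclt p q
       | _, None => False
       end |}.

Definition is_order_index (e : nat) (P : order nat) : Prop :=
  exists u r, e = npair u r /\
    (forall x, decides no_oracle u x (odom P x)) /\
    (forall x y, odom P x -> odom P y ->
       decides no_oracle r (npair x y) (olt P x y)).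

Definition computable_linear_order (P : order nat) : Prop :=
  linear P /\ exists e, is_order_index e P.

Definition descending_sequence (P : order nat) (s : nat -> nat) : Prop :=
  forall n, odom P (s n) /\ olt P (s (S n)) (s n).

Definition high_for_descending_sequences (d : turing_degree) : Prop :=
  forall P : order nat,
    computable_linear_order P -> ~ wf_order P ->
    exists s, descending_sequence P s /\
              degree_computable_on d (fun _ => True) s.

(** [W] has order type the least ordinal without a computable copy. *)
Definition has_type_omega1ck (W : order nat) : Prop :=
  linear W /\ wf_order W /\
  (forall a, odom W a ->
     exists P, computable_linear_order P /\ order_iso P (below W a)) /\
  ~ (exists P, computable_linear_order P /\ order_iso P W).

Definition harrison_order (H : order nat) : Prop :=
  computable_linear_order H /\
  exists W, has_type_omega1ck W /\ order_iso H (order_prod W one_plus_Q).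

Definition is_least (H : order nat) (x : nat) : Prop :=
  odom H x /\ forall y, odom H y -> y = x \/ olt H x y.

(** * Finitary Sigma_1 formulas *)

Inductive term : Type :=
| Var (k : nat)
| App (f : nat) (ts : list term).

Inductive qf_formula : Type :=
| Bot
| Eq (s t : term)
| Rel (r : nat) (ts : list term)
| Not (p : qf_formula)
| And (p q : qf_formula)
| Or (p q : qf_formula).

(** [t] is a term of [L] with variables among the first [n]. *)
Fixpoint wf_term (L : language) (n : nat) (t : term) : Prop :=
  match t with
  | Var k => k < n
  | App f ts =>
      fun_ar L f = Some (length ts) /\
      fold_right and True (map (wf_term L n) ts)
  end.

Fixpoint wf_qf (L : language) (n : nat) (p : qf_formula) : Prop :=
  match p with
  | Bot => True
  | Eq s t => wf_term L n s /\ wf_term L n t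
  | Rel r ts => rel_ar L r = Some (length ts) /\ Forall (wf_term L n) ts
  | Not p => wf_qf L n p
  | And p q | Or p q => wf_qf L n p /\ wf_qf L n q
  end.

(** The variable [Var k] is interpreted by the [k]-th entry of [v]. *)
Fixpoint term_val {L : language} (A : structure L) (v : list nat) (t : term) : nat :=
  match t with
  | Var k => nth k v 0
  | App f ts => sfun A f (map (term_val A v) ts)
  end.

Fixpoint qf_sat {L : language} (A : structure L) (v : list nat) (p : qf_formula)
    : Prop :=
  match p with
  | Bot => False
  | Eq s t => term_val A v s = term_val A v t
  | Rel r ts => srel A r (map (term_val A v) ts)
  | Not p => ~ qf_sat A v p
  | And p q => qf_sat A v p /\ qf_sat A v q
  | Or p q => qf_sat A v p \/ qf_sat A v q
  end.

(** The formula [exists y_1 ... y_m, matrix (x_1, ..., x_n, y_1, ..., y_m)] with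
    [n = arity] free and [m = bound] quantified variables. *)
Record sigma1 : Type := {
  arity : nat;
  bound : nat;
  matrix : qf_formula
}.

Definition wf_sigma1 (L : language) (p : sigma1) : Prop :=
  wf_qf L (arity p + bound p) (matrix p).

(** A formula with [n] free variables is only true of tuples of length [n]. *)
Definition true_of {L : language} (A : structure L) (p : sigma1) (a : list nat)
    : Prop :=
  length a = arity p /\
  exists c, length c = bound p /\ Forall (dom A) c /\ qf_sat A (a ++ c) (matrix p).

(** * Scott completeness *)

(** Here [b a1 a2 x = true] reads [a1 <=_x a2]; values of [b] at tuples not in
    [A] or at points not in [H] are irrelevant. *)
Definition back_and_forth {L : language} (A : structure L) (H : order nat)
    (b : list nat -> list nat -> nat -> bool) : Prop :=
  (forall a1 a2 x, Forall (dom A) a1 -> Forall (dom A) a2 -> is_least H x ->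
     (b a1 a2 x = true <->
      forall p, wf_sigma1 L p -> true_of A p a2 -> true_of A p a1)) /\
  (forall a1 a2 x, Forall (dom A) a1 -> Forall (dom A) a2 ->
     odom H x -> ~ is_least H x ->
     (b a1 a2 x = true <->
      forall d y, Forall (dom A) d -> odom H y -> olt H y x ->
        exists c, Forall (dom A) c /\ b (a2 ++ d) (a1 ++ c) y = true)).

(** The algorithm [g] uses no oracle; its output is an index relative to a fixed
    representative [X] of [d]. The choice of [X] is immaterial, since indices
    can be translated computably between two representatives. *)
Definition scott_complete (d : turing_degree) : Prop :=
  exists X, in_degree d X /\
  exists g, forall (eA eH : nat) (L : language) (A : structure L) (H : order nat),
    is_structure_index eA L A -> harrison_order H -> is_order_index eH H ->
    exists e b,
      phi no_oracle g (npair eA eH) e /\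
      back_and_forth A H b /\
      forall a1 a2 x, Forall (dom A) a1 -> Forall (dom A) a2 -> odom H x ->
        phi X e (npair (tuple_code a1) (npair (tuple_code a2) x))
          (Nat.b2n (b a1 a2 x)).

(* Main.v *)
(** Both properties are equivalent to highness for paths: [d] computes an infinite run of
    every c.e. transition system that has one.

    An isomorphism, a descending sequence, and the bits of back-and-forth relations for all
    pairs of indices at once are solutions of [Pi_2] conditions, hence runs. For the last one
    no validity of the indices is needed, since the defining equations always have a
    solution: the true relations on the accessible part of the order, and the empty relation
    elsewhere.

    Conversely, to find a run of a system, let [G] consist of the finite sets of nodes of
    each level of its tree of finite runs, with the map sending a set to the parents of its
    nodes, counted modulo 2. Runs yield automorphisms of [G] sending the empty set of roots
    to the set of the root, and an isomorphism moving the one to the other yields odd sets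
    projecting onto each other, from which a run can be read off.

    In the remaining direction, each state [q] of the system is assigned a Harrison order
    with a point that is standard iff there is no run from [q]. The order is [2^L], where [L]
    is the Kleene-Brouwer order of a tree that, to the left of its leftmost infinite path,
    contains the descending sequences of all computable well-orders. If Scott completeness
    makes the empty set and the root back-and-forth related at this point for some [q] that
    has a run, then the point is above a descending sequence, along which a run can be
    computed. Otherwise [d] decides which states have runs, and a run is found greedily. *)
From Stdlib Require Import Arith Lia List Bool Cantor QArith Qcanon.
From Stdlib Require Import Classical ClassicalEpsilon FunctionalExtensionality.
Require Import Defs.
Import ListNotations.
Local Open Scope nat_scope.


(** Scott completeness promises something for genuine Harrison orders only, whereas having a run is
    a $\Sigma^1_1$ property of a state. So the order assigned to a state has to be a Harrison order
    in either case, and the state may only influence whether one fixed point is standard. For this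
    reason the tree always has an infinite path, along which no system is followed, and the system
    under test sits in the leftmost subtree. Passing to [2^L] removes the need to control the
    nonstandard part of [L]: as that part has no least element, it contributes [1 + Q] whatever it
    looks like, and the standard part only has to be too long for every computable well-order.
    Counting modulo 2 turns a set of nodes into a vector, the projection into a linear map and a
    path into a translation that commutes with it. Thus a single run already yields an automorphism.
    The final case distinction is not effective; this is harmless because highness for paths asks
    for no uniformity. *)

(** * Pairing, determinism of evaluation, numbering of programs *)

Definition pi1 (n : nat) : nat := fst (Cantor.of_nat n).
Definition pi2 (n : nat) : nat := snd (Cantor.of_nat n).

Lemma pi1_pair a b : pi1 (npair a b) = a.
Proof. unfold pi1, npair. now rewrite Cantor.cancel_of_to. Qed.
Lemma pi2_pair a b : pi2 (npair a b) = b.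
Proof. unfold pi2, npair. now rewrite Cantor.cancel_of_to. Qed.
Lemma pair_pi n : npair (pi1 n) (pi2 n) = n.
Proof.
  unfold pi1, pi2, npair. rewrite <- surjective_pairing. apply Cantor.cancel_to_of.
Qed.
Lemma npair_inj a b c d : npair a b = npair c d -> a = c /\ b = d.
Proof.
  intros H. split.
  - rewrite <- (pi1_pair a b), H. apply pi1_pair.
  - rewrite <- (pi2_pair a b), H. apply pi2_pair.
Qed.
Lemma npair_ge a b : a + b <= npair a b.
Proof. unfold npair. pose proof (Cantor.to_nat_non_decreasing a b). lia. Qed.
(** In the universal tree this puts an entry that follows a system to the left of the one that
    ignores it and is otherwise the same. *)
Lemma npair_0_lt a b : 0 < b -> npair a 0 < npair a b.
Proof.
  intros H. unfold npair. pose proof (Cantor.to_nat_spec a 0). pose proof (Cantor.to_nat_spec a b). nia.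
Qed.
Lemma pi1_le n : pi1 n <= n.
Proof. pose proof (npair_ge (pi1 n) (pi2 n)). rewrite pair_pi in H. lia. Qed.
Lemma pi2_le n : pi2 n <= n.
Proof. pose proof (npair_ge (pi1 n) (pi2 n)). rewrite pair_pi in H. lia. Qed.
Lemma npair_0 : npair 0 0 = 0.
Proof. reflexivity. Qed.
Lemma pi1_0 : pi1 0 = 0. Proof. reflexivity. Qed.
Lemma pi2_0 : pi2 0 = 0. Proof. reflexivity. Qed.

Global Opaque npair pi1 pi2.

Ltac pis := rewrite ?pi1_pair, ?pi2_pair, ?pi1_pair, ?pi2_pair, ?pi1_pair, ?pi2_pair.
Tactic Notation "pis" "in" hyp(H) :=
  rewrite ?pi1_pair, ?pi2_pair, ?pi1_pair, ?pi2_pair, ?pi1_pair, ?pi2_pair in H.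

Lemma rec_graph_functional (F G : nat -> nat -> Prop) :
  (forall n m m', F n m -> F n m' -> m = m') ->
  (forall n m m', G n m -> G n m' -> m = m') ->
  forall a k m m', rec_graph F G a k m -> rec_graph F G a k m' -> m = m'.
Proof.
  intros HF HG a k; induction k; simpl; intros m m'.
  - apply HF.
  - intros (r & Hr & H1) (r' & Hr' & H2). rewrite (IHk _ _ Hr Hr') in H1. eauto.
Qed.

Lemma eval_functional X c : forall n m m', eval X c n m -> eval X c n m' -> m = m'.
Proof.
  induction c; simpl; intros n m m' H H'; try congruence.
  - destruct H as (u & v & H1 & H2 & ->), H' as (u' & v' & H1' & H2' & ->).
    rewrite (IHc1 _ _ _ H1 H1'), (IHc2 _ _ _ H2 H2'). reflexivity.
  - destruct H as (u & H1 & H2), H' as (u' & H1' & H2').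
    rewrite (IHc2 _ _ _ H1 H1') in H2. eauto.
  - exact (rec_graph_functional _ _ IHc1 IHc2 _ _ _ _ H H').
  - destruct H as [H1 H2], H' as [H1' H2'].
    destruct (lt_eq_lt_dec m m') as [[L|E]|L]; [|exact E|].
    + destruct (H2' m L) as [v Hv]. specialize (IHc _ _ _ H1 Hv). discriminate.
    + destruct (H2 m' L) as [v Hv]. specialize (IHc _ _ _ H1' Hv). discriminate.
Qed.

Lemma encode_inj c : forall c', encode c = encode c' -> c = c'.
Proof.
  induction c; intros [] H; cbn [encode] in H; try discriminate; try reflexivity;
    try (exfalso; lia);
    try (assert (E : npair (encode c1) (encode c2) = npair (encode c) (encode d)) by lia;
         apply npair_inj in E; destruct E; f_equal; auto).
  f_equal. apply IHc. lia.
Qed.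

Lemma phi_encode X c n m : phi X (encode c) n m <-> eval X c n m.
Proof.
  split; [|exists c; auto]. intros (c' & H & E). now apply encode_inj in H; subst.
Qed.

Lemma phi_functional X e n m m' : phi X e n m -> phi X e n m' -> m = m'.
Proof.
  intros (c & <- & H) H'. rewrite phi_encode in H'. eapply eval_functional; eauto.
Qed.

(** * Computable functionals *)

(** [K] is the class of oracles for which the program has to work: all of them
    for functionals, a single one for relative computability. *)
Definition cf (K : (nat -> bool) -> Prop) (F : (nat -> bool) -> nat -> nat) : Prop :=
  exists c, forall X, K X -> forall n, eval X c n (F X n).

Definition cfb (K : (nat -> bool) -> Prop) (B : (nat -> bool) -> nat -> bool) : Prop :=
  cf K (fun X n => Nat.b2n (B X n)).

Fixpoint ball (k : nat) (f : nat -> bool) : bool :=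
  match k with 0 => true | S k' => f k' && ball k' f end.
Fixpoint bex (k : nat) (f : nat -> bool) : bool :=
  match k with 0 => false | S k' => f k' || bex k' f end.

Lemma ball_true k f : ball k f = true <-> forall i, i < k -> f i = true.
Proof.
  induction k; simpl; [intuition lia|].
  rewrite andb_true_iff, IHk. split.
  - intros [H1 H2] i Hi. destruct (Nat.eq_dec i k) as [->|]; auto. apply H2; lia.
  - intros H. split; [|intros]; apply H; lia.
Qed.
Lemma bex_true k f : bex k f = true <-> exists i, i < k /\ f i = true.
Proof.
  induction k; simpl; [split; [discriminate|intros (i & H & _); lia]|].
  rewrite orb_true_iff, IHk. split.
  - intros [H|(i & Hi & H)]; [exists k|exists i]; split; auto.
  - intros (i & Hi & H). destruct (Nat.eq_dec i k) as [->|]; auto.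
    right. exists i; split; auto; lia.
Qed.

Section Toolkit.
Variable K : (nat -> bool) -> Prop.

Lemma cf_ext F G : (forall X n, K X -> F X n = G X n) -> cf K F -> cf K G.
Proof. intros E [c H]. exists c. intros X HX n. rewrite <- E; auto. Qed.
Lemma cfb_ext F G : (forall X n, K X -> F X n = G X n) -> cfb K F -> cfb K G.
Proof. intros E. apply cf_ext. intros; now rewrite E. Qed.

Lemma cf_id : cf K (fun X n => n).
Proof.
  exists (Pair Fst Snd). intros X _ n. exists (pi1 n), (pi2 n). simpl.
  repeat split. symmetry. apply pair_pi.
Qed.
Lemma cf_const k : cf K (fun X n => k).
Proof.
  induction k as [|k [c IH]]; [exists Zero; simpl; auto|].
  exists (Comp Succ c). intros X HX n. exists k; split; simpl; auto.
Qed.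
Lemma cf_comp F G : cf K F -> cf K G -> cf K (fun X n => F X (G X n)).
Proof.
  intros [c Hc] [d Hd]. exists (Comp c d). intros X HX n. exists (G X n); auto.
Qed.
Lemma cfb_comp F G : cfb K F -> cf K G -> cfb K (fun X n => F X (G X n)).
Proof. intros. now apply (cf_comp (fun X n => Nat.b2n (F X n))). Qed.
Lemma cf_S F : cf K F -> cf K (fun X n => S (F X n)).
Proof.
  apply (cf_comp (fun X n => S n)). exists Succ. simpl; auto.
Qed.
Lemma cf_pi1 F : cf K F -> cf K (fun X n => pi1 (F X n)).
Proof. apply (cf_comp (fun X n => pi1 n)). exists Fst. simpl; auto. Qed.
Lemma cf_pi2 F : cf K F -> cf K (fun X n => pi2 (F X n)).
Proof. apply (cf_comp (fun X n => pi2 n)). exists Snd. simpl; auto. Qed.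
Lemma cf_pair F G : cf K F -> cf K G -> cf K (fun X n => npair (F X n) (G X n)).
Proof.
  intros [c Hc] [d Hd]. exists (Pair c d). intros X HX n.
  exists (F X n), (G X n); auto.
Qed.
Lemma cfb_orc F : cf K F -> cfb K (fun X n => X (F X n)).
Proof. apply (cfb_comp (fun X n => X n)). exists Orc. simpl; auto. Qed.
Lemma cf_b2n B : cfb K B -> cf K (fun X n => Nat.b2n (B X n)).
Proof. auto. Qed.

Lemma cf_rec (base : (nat -> bool) -> nat -> nat)
    (step : (nat -> bool) -> nat -> nat -> nat -> nat) (N : (nat -> bool) -> nat -> nat) :
  cf K base -> cf K (fun X z => step X (pi1 z) (pi1 (pi2 z)) (pi2 (pi2 z))) -> cf K N ->
  cf K (fun X n => nat_rect (fun _ => nat) (base X n) (fun k r => step X n k r) (N X n)).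
Proof.
  intros [cb Hb] [cs Hs] HN.
  eapply cf_ext; [|apply (cf_comp (fun X z => nat_rect (fun _ => nat) (base X (pi1 z))
     (fun k r => step X (pi1 z) k r) (pi2 z)) (fun X n => npair n (N X n)))].
  - intros X n HX. simpl. now rewrite pi1_pair, pi2_pair.
  - exists (Rec cb cs). intros X HX z. cbn [eval].
    change (fst (of_nat z)) with (pi1 z). change (snd (of_nat z)) with (pi2 z).
    induction (pi2 z) as [|k IH]; simpl; auto.
    eexists; split; [exact IH|]. specialize (Hs X HX (npair (pi1 z) (npair k
      (nat_rect (fun _ => nat) (base X (pi1 z)) (fun k r => step X (pi1 z) k r) k)))).
    now pis in Hs.
  - apply cf_pair; auto using cf_id.
Qed.

Lemma cf_pred F : cf K F -> cf K (fun X n => pred (F X n)).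
Proof.
  intros HF. eapply cf_ext; [|apply (cf_rec (fun _ _ => 0) (fun X n k r => k) F)]; auto.
  - intros X n _; cbn beta. destruct (F X n); reflexivity.
  - apply cf_const.
  - apply cf_pi1, cf_pi2, cf_id.
Qed.
Lemma cf_add F G : cf K F -> cf K G -> cf K (fun X n => F X n + G X n).
Proof.
  intros HF HG. eapply cf_ext; [|apply (cf_rec G (fun X n k r => S r) F)]; auto.
  - intros X n _; cbn beta. induction (F X n); simpl; auto.
  - apply cf_S, cf_pi2, cf_pi2, cf_id.
Qed.
Lemma cf_mul F G : cf K F -> cf K G -> cf K (fun X n => F X n * G X n).
Proof.
  intros HF HG. eapply cf_ext; [|apply (cf_rec (fun _ _ => 0) (fun X n k r => G X n + r) F)]; auto.
  - intros X n _; cbn beta. induction (F X n); simpl; auto.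
  - apply cf_const.
  - apply cf_add; [apply (cf_comp G); auto|]; repeat first [apply cf_pi1 | apply cf_pi2 | apply cf_id].
Qed.
Lemma cf_sub F G : cf K F -> cf K G -> cf K (fun X n => F X n - G X n).
Proof.
  intros HF HG. eapply cf_ext; [|apply (cf_rec F (fun X n k r => pred r) G)]; auto.
  - intros X n _; cbn beta. induction (G X n) as [|k IH]; simpl; [lia|]. rewrite IH. lia.
  - apply cf_pred, cf_pi2, cf_pi2, cf_id.
Qed.
Lemma cf_pow k F : cf K F -> cf K (fun X n => k ^ F X n).
Proof.
  intros HF. eapply cf_ext; [|apply (cf_rec (fun _ _ => 1) (fun X n i r => k * r) F)]; auto.
  - intros X n _; cbn beta. induction (F X n); simpl; auto.
  - apply cf_const.
  - apply cf_mul; [apply cf_const|]; apply cf_pi2, cf_pi2, cf_id.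
Qed.

Lemma cf_ifz F G H : cf K F -> cf K G -> cf K H ->
  cf K (fun X n => match F X n with 0 => G X n | S _ => H X n end).
Proof.
  intros HF HG HH. eapply cf_ext; [|apply (cf_rec G (fun X n k r => H X n) F)]; auto.
  - intros X n _; cbn beta. destruct (F X n); reflexivity.
  - apply (cf_comp H); auto. apply cf_pi1, cf_id.
Qed.
Lemma cf_if B F G : cfb K B -> cf K F -> cf K G ->
  cf K (fun X n => if B X n then F X n else G X n).
Proof.
  intros HB HF HG. eapply cf_ext; [|apply (cf_ifz (fun X n => Nat.b2n (B X n)) G F)]; auto.
  intros X n _; cbn beta. destruct (B X n); reflexivity.
Qed.
Lemma cfb_if B F G : cfb K B -> cfb K F -> cfb K G ->
  cfb K (fun X n => if B X n then F X n else G X n).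
Proof.
  intros HB HF HG. unfold cfb. eapply cf_ext; [|apply (cf_if B _ _ HB HF HG)].
  intros X n _; cbn beta. destruct (B X n); reflexivity.
Qed.
Lemma cfb_const b : cfb K (fun _ _ => b).
Proof. exact (cf_const (Nat.b2n b)). Qed.
Lemma cfb_neg B : cfb K B -> cfb K (fun X n => negb (B X n)).
Proof.
  intros HB. eapply cfb_ext; [|apply (cfb_if B (fun _ _ => false) (fun _ _ => true))];
    auto using cfb_const.
Qed.
Lemma cfb_and B C : cfb K B -> cfb K C -> cfb K (fun X n => B X n && C X n).
Proof.
  intros HB HC. eapply cfb_ext; [|apply (cfb_if B C (fun _ _ => false))];
    auto using cfb_const.
Qed.
Lemma cfb_or B C : cfb K B -> cfb K C -> cfb K (fun X n => B X n || C X n).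
Proof.
  intros HB HC. eapply cfb_ext; [|apply (cfb_if B (fun _ _ => true) C)];
    auto using cfb_const.
Qed.
Lemma cfb_leb F G : cf K F -> cf K G -> cfb K (fun X n => F X n <=? G X n).
Proof.
  intros HF HG. unfold cfb. eapply cf_ext; [|apply (cf_ifz (fun X n => F X n - G X n) (fun _ _ => 1) (fun _ _ => 0))];
    auto using cf_const, cf_sub.
  intros X n _; cbn beta. destruct (Nat.leb_spec (F X n) (G X n)).
  - now replace (F X n - G X n) with 0 by lia.
  - now destruct (F X n - G X n) eqn:E; [lia|].
Qed.
Lemma cfb_ltb F G : cf K F -> cf K G -> cfb K (fun X n => F X n <? G X n).
Proof. intros. unfold Nat.ltb. apply (cfb_leb (fun X n => S (F X n))); auto using cf_S. Qed.
Lemma cfb_eqb F G : cf K F -> cf K G -> cfb K (fun X n => F X n =? G X n).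
Proof.
  intros HF HG. eapply cfb_ext; [|apply (cfb_and _ _ (cfb_leb _ _ HF HG) (cfb_leb _ _ HG HF))].
  intros X n _; cbn beta. destruct (Nat.eqb_spec (F X n) (G X n)) as [E|E].
  - rewrite E, Nat.leb_refl. reflexivity.
  - destruct (Nat.leb_spec (F X n) (G X n)), (Nat.leb_spec (G X n) (F X n)); auto; lia.
Qed.
Lemma cfb_beqb B C : cfb K B -> cfb K C -> cfb K (fun X n => Bool.eqb (B X n) (C X n)).
Proof.
  intros HB HC. eapply cfb_ext; [|apply (cfb_if B C (fun X n => negb (C X n)))]; auto using cfb_neg.
  intros X n _; simpl. destruct (B X n), (C X n); reflexivity.
Qed.
Lemma cfb_ball N f : cf K N -> cfb K (fun X z => f X (pi1 z) (pi2 z)) ->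
  cfb K (fun X n => ball (N X n) (f X n)).
Proof.
  intros HN Hf. unfold cfb.
  eapply cf_ext; [|apply (cf_rec (fun _ _ => 1) (fun X n k r => if f X n k then r else 0) N)];
    auto using cf_const.
  - intros X n _; cbn beta. induction (N X n); simpl; auto. rewrite IHn0.
    destruct (f X n n0); reflexivity.
  - apply cf_if; auto using cf_const, cf_pi2, cf_id.
    eapply cfb_ext; [|apply (cfb_comp _ (fun X z => npair (pi1 z) (pi1 (pi2 z))) Hf)];
      auto using cf_pair, cf_pi1, cf_pi2, cf_id.
    intros X z _; simpl. now rewrite pi1_pair, pi2_pair.
Qed.
Lemma cfb_bex N f : cf K N -> cfb K (fun X z => f X (pi1 z) (pi2 z)) ->
  cfb K (fun X n => bex (N X n) (f X n)).
Proof.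
  intros HN Hf. unfold cfb.
  eapply cf_ext; [|apply (cf_rec (fun _ _ => 0) (fun X n k r => if f X n k then 1 else r) N)];
    auto using cf_const.
  - intros X n _; cbn beta. induction (N X n); simpl; auto. rewrite IHn0.
    destruct (f X n n0); reflexivity.
  - apply cf_if; auto using cf_const, cf_pi2, cf_id.
    eapply cfb_ext; [|apply (cfb_comp _ (fun X z => npair (pi1 z) (pi1 (pi2 z))) Hf)];
      auto using cf_pair, cf_pi1, cf_pi2, cf_id.
    intros X z _; simpl. now rewrite pi1_pair, pi2_pair.
Qed.

Lemma cf_min B F : cfb K (fun X z => B X (pi1 z) (pi2 z)) ->
  (forall X n, K X -> B X n (F X n) = true /\ forall j, j < F X n -> B X n j = false) ->
  cf K F.
Proof.
  intros HB HF. apply cfb_neg in HB. destruct HB as [c Hc].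
  exists (Min c). intros X HX n. destruct (HF X n HX) as [H1 H2]. split.
  - specialize (Hc X HX (npair n (F X n))). rewrite pi1_pair, pi2_pair, H1 in Hc. exact Hc.
  - intros j Hj. specialize (Hc X HX (npair n j)).
    rewrite pi1_pair, pi2_pair, (H2 j Hj) in Hc. exists 0; exact Hc.
Qed.

Lemma least_exists (P : nat -> bool) : (exists m, P m = true) ->
  exists m, P m = true /\ forall j, j < m -> P j = false.
Proof.
  intros [m Hm]. revert Hm. induction m as [m IH] using lt_wf_ind; intros Hm.
  destruct (bex m P) eqn:E.
  - apply bex_true in E. destruct E as (i & Hi & E). eauto.
  - exists m; split; auto. intros j Hj. destruct (P j) eqn:Ej; auto.
    assert (bex m P = true) by (apply bex_true; eauto). congruence.
Qed.

(** The program halts with the least witness as its output, not just with a signal. Later this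
    serves to read the value of a function off its graph. *)
Lemma semidec B : cfb K (fun X z => B X (pi1 z) (pi2 z)) ->
  exists c, forall X, K X -> forall n,
    (forall m, eval X c n m -> B X n m = true) /\
    ((exists k, B X n k = true) -> exists m, eval X c n m).
Proof.
  intros HB. apply cfb_neg in HB. destruct HB as [c Hc].
  exists (Min c). intros X HX n.
  assert (E : forall k, eval X c (npair n k) (Nat.b2n (negb (B X n k)))).
  { intros k. specialize (Hc X HX (npair n k)). now rewrite pi1_pair, pi2_pair in Hc. }
  split.
  - intros m [H _]. pose proof (eval_functional _ _ _ _ _ H (E m)) as H'.
    destruct (B X n m); simpl in H'; congruence.
  - intros Hk. destruct (least_exists (B X n) Hk) as (m & Hm & Hl). exists m. split.
    + specialize (E m). rewrite Hm in E; exact E.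
    + intros j Hj. specialize (E j). rewrite (Hl j Hj) in E. exists 0; exact E.
Qed.

End Toolkit.

Lemma cf_weaken (K K' : (nat -> bool) -> Prop) F :
  (forall X, K' X -> K X) -> cf K F -> cf K' F.
Proof. intros H [c Hc]. exists c; auto. Qed.

Ltac cstep_cf := lazymatch goal with
  | |- cf _ (fun X n => n) => apply cf_id
  | |- cf ?K (fun X n => pi1 (@?a X n)) => apply (cf_pi1 K a)
  | |- cf ?K (fun X n => pi2 (@?a X n)) => apply (cf_pi2 K a)
  | |- cf ?K (fun X n => npair (@?a X n) (@?b X n)) => apply (cf_pair K a b)
  | |- cf ?K (fun X n => Nat.b2n (@?a X n)) => apply (cf_b2n K a)
  | |- cf ?K (fun X n => S (@?a X n)) => apply (cf_S K a)
  | |- cf ?K (fun X n => pred (@?a X n)) => apply (cf_pred K a)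
  | |- cf ?K (fun X n => (@?a X n) + (@?b X n)) => apply (cf_add K a b)
  | |- cf ?K (fun X n => (@?a X n) * (@?b X n)) => apply (cf_mul K a b)
  | |- cf ?K (fun X n => (@?a X n) - (@?b X n)) => apply (cf_sub K a b)
  | |- cf ?K (fun X n => ?k ^ (@?a X n)) => apply (cf_pow K k a)
  | |- cf ?K (fun X n => if (@?a X n) then (@?b X n) else (@?c X n)) => apply (cf_if K a b c)
  end.
Ltac cstep_cfb := lazymatch goal with
  | |- cfb ?K (fun X n => X (@?a X n)) => apply (cfb_orc K a)
  | |- cfb ?K (fun X n => negb (@?a X n)) => apply (cfb_neg K a)
  | |- cfb ?K (fun X n => (@?a X n) && (@?b X n)) => apply (cfb_and K a b)
  | |- cfb ?K (fun X n => (@?a X n) || (@?b X n)) => apply (cfb_or K a b)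
  | |- cfb ?K (fun X n => (@?a X n) <=? (@?b X n)) => apply (cfb_leb K a b)
  | |- cfb ?K (fun X n => (@?a X n) <? (@?b X n)) => apply (cfb_ltb K a b)
  | |- cfb ?K (fun X n => (@?a X n) =? (@?b X n)) => apply (cfb_eqb K a b)
  | |- cfb ?K (fun X n => Bool.eqb (@?a X n) (@?b X n)) => apply (cfb_beqb K a b)
  | |- cfb ?K (fun X n => if (@?a X n) then (@?b X n) else (@?c X n)) => apply (cfb_if K a b c)
  | |- cfb ?K (fun X n => ball (@?a X n) (@?b X n)) => apply (cfb_ball K a b)
  | |- cfb ?K (fun X n => bex (@?a X n) (@?b X n)) => apply (cfb_bex K a b)
  end.
Ltac cext := fail.
Ltac cstep := first
  [ assumption
  | cext
  | cstep_cf
  | cstep_cfb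
  | lazymatch goal with |- cf _ _ => apply cf_const | |- cfb _ _ => apply cfb_const end
  | match goal with H : cf ?K ?F |- cf ?K (fun X n => ?F X _) => apply (cf_comp K F _ H) end
  | match goal with H : cfb ?K ?F |- cfb ?K (fun X n => ?F X _) => apply (cfb_comp K F _ H) end ].
Ltac csolve := cbn beta; repeat (cstep; cbn beta).

(** * Lists as numbers *)

Definition ccons (a x : nat) : nat := S (npair a x).
Definition chd (x : nat) : nat := pi1 (pred x).
Definition ctl (x : nat) : nat := pi2 (pred x).
Definition cdrop (i x : nat) : nat := nat_rect (fun _ => nat) x (fun _ r => ctl r) i.
Definition cnth (i x : nat) : nat := chd (cdrop i x).
(** A list is no longer than its code, so it suffices to count the nonempty ones among the first [x]
    tails. *)
Definition clen (x : nat) : nat :=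
  nat_rect (fun _ => nat) 0 (fun i r => r + if cdrop i x =? 0 then 0 else 1) x.
(** Primitive recursion builds the list from its end, hence the reversed index [n - S k]. *)
Definition cmk (n : nat) (f : nat -> nat) : nat :=
  nat_rect (fun _ => nat) 0 (fun k r => ccons (f (n - S k)) r) n.
Definition capp (x y : nat) : nat :=
  cmk (clen x + clen y)
    (fun i => if i <? clen x then cnth i x else cnth (i - clen x) y).

Lemma chd_cons a x : chd (ccons a x) = a.
Proof. apply pi1_pair. Qed.
Lemma ctl_cons a x : ctl (ccons a x) = x.
Proof. apply pi2_pair. Qed.
Lemma ctl_0 : ctl 0 = 0. Proof. apply pi2_0. Qed.
Lemma chd_0 : chd 0 = 0. Proof. apply pi1_0. Qed.
Lemma ccons_chd_ctl x : x <> 0 -> ccons (chd x) (ctl x) = x.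
Proof. destruct x; [easy|]. intros _. unfold ccons, chd, ctl. simpl. now rewrite pair_pi. Qed.
Lemma ctl_lt x : x <> 0 -> ctl x < x.
Proof. destruct x; [easy|]. intros _. unfold ctl. simpl. pose proof (pi2_le x). lia. Qed.

Lemma tuple_code_surj x : exists l, tuple_code l = x.
Proof.
  induction x as [x IH] using lt_wf_ind. destruct (Nat.eq_dec x 0) as [->|H].
  - exists []; reflexivity.
  - destruct (IH (ctl x) (ctl_lt x H)) as [l Hl]. exists (chd x :: l).
    simpl. rewrite Hl. now apply ccons_chd_ctl.
Qed.
Lemma tuple_code_inj l : forall l', tuple_code l = tuple_code l' -> l = l'.
Proof.
  induction l; intros [] H; try discriminate; auto. cbn in H. injection H as H.
  apply npair_inj in H as [-> H]. f_equal; auto.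
Qed.

Fixpoint list_of_fuel (k x : nat) : list nat :=
  match k with
  | 0 => []
  | S k => if x =? 0 then [] else chd x :: list_of_fuel k (ctl x)
  end.
Definition list_of (x : nat) : list nat := list_of_fuel x x.

Lemma tuple_code_list_of x : tuple_code (list_of x) = x.
Proof.
  assert (H : forall k y, y <= k -> tuple_code (list_of_fuel k y) = y).
  { induction k; intros y Hy; simpl; [lia|].
    destruct (Nat.eqb_spec y 0) as [->|E]; auto. simpl.
    rewrite IHk by (pose proof (ctl_lt y E); lia). now apply ccons_chd_ctl. }
  now apply H.
Qed.
Lemma list_of_tuple_code l : list_of (tuple_code l) = l.
Proof. apply tuple_code_inj, tuple_code_list_of. Qed.

Lemma cdrop_tl i x : cdrop i (ctl x) = ctl (cdrop i x).
Proof. induction i; auto. change (ctl (cdrop i (ctl x)) = ctl (ctl (cdrop i x))). now rewrite IHi. Qed.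
Lemma cdrop_S i x : cdrop (S i) x = cdrop i (ctl x).
Proof. symmetry. apply cdrop_tl. Qed.
Lemma cdrop_code l : forall i, cdrop i (tuple_code l) = tuple_code (skipn i l).
Proof.
  induction l; intros [|i]; try reflexivity.
  - cbn [skipn tuple_code]. induction i as [|i IHi]; auto. rewrite cdrop_S. exact IHi.
  - rewrite cdrop_S. change (tuple_code (a :: l)) with (ccons a (tuple_code l)).
    rewrite ctl_cons. apply IHl.
Qed.
Lemma cnth_code l : forall i, cnth i (tuple_code l) = nth i l 0.
Proof.
  intros i. unfold cnth. rewrite cdrop_code. revert i.
  induction l; intros [|i]; simpl; try apply chd_0.
  - apply chd_cons.
  - apply IHl.
Qed.
Lemma length_le_code l : length l <= tuple_code l.
Proof. induction l; simpl; auto. pose proof (npair_ge a (tuple_code l)). lia. Qed.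
Lemma clen_code l : clen (tuple_code l) = length l.
Proof.
  assert (H : forall k, nat_rect (fun _ => nat) 0 (fun i r => r + if cdrop i (tuple_code l) =? 0 then 0 else 1) k
     = Nat.min k (length l)).
  { induction k; auto. simpl nat_rect. rewrite IHk, cdrop_code.
    destruct (Nat.le_gt_cases (length l) k).
    - rewrite skipn_all2 by auto. simpl. destruct (length l); lia.
    - destruct (skipn k l) eqn:E.
      + apply (f_equal (@length nat)) in E. rewrite length_skipn in E. simpl in E. lia.
      + simpl Nat.eqb. cbn iota. lia. }
  unfold clen. rewrite H. pose proof (length_le_code l). lia.
Qed.
Lemma nth_le_code l : forall i, nth i l 0 <= tuple_code l.
Proof.
  induction l; intros [|i]; simpl; try lia; pose proof (npair_ge a (tuple_code l));
    [lia|]. specialize (IHl i). lia.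
Qed.
Lemma cnth_list_of i x : cnth i x = nth i (list_of x) 0.
Proof. rewrite <- cnth_code. now rewrite tuple_code_list_of. Qed.
Lemma clen_list_of x : clen x = length (list_of x).
Proof. rewrite <- clen_code. now rewrite tuple_code_list_of. Qed.
Lemma cmk_code n f : cmk n f = tuple_code (map f (seq 0 n)).
Proof.
  unfold cmk.
  assert (H : forall k, k <= n -> nat_rect (fun _ => nat) 0 (fun k r => ccons (f (n - S k)) r) k
     = tuple_code (map f (seq (n - k) k))).
  { induction k; auto. intros Hk. simpl nat_rect. rewrite IHk by lia. simpl.
    replace (S (n - S k)) with (n - k) by lia. reflexivity. }
  rewrite H by auto. now rewrite Nat.sub_diag.
Qed.
Lemma clen_cmk n f : clen (cmk n f) = n.
Proof. now rewrite cmk_code, clen_code, length_map, length_seq. Qed.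
Lemma capp_code l m : capp (tuple_code l) (tuple_code m) = tuple_code (l ++ m).
Proof.
  unfold capp. rewrite cmk_code. f_equal. rewrite !clen_code.
  apply nth_ext with (d := 0) (d' := 0).
  - now rewrite length_map, length_seq, length_app.
  - intros i Hi. rewrite length_map, length_seq in Hi.
    set (g := fun i => _).
    rewrite (nth_indep _ 0 (g 0)) by now rewrite length_map, length_seq.
    rewrite map_nth, seq_nth by auto. unfold g. simpl.
    destruct (Nat.ltb_spec i (length l)).
    + rewrite app_nth1 by auto. apply cnth_code.
    + rewrite app_nth2 by auto. apply cnth_code.
Qed.
Lemma tuple_code_one a : tuple_code [a] = ccons a 0.
Proof. reflexivity. Qed.
Lemma clen_ccons a x : clen (ccons a x) = S (clen x).
Proof.
  destruct (tuple_code_surj x) as [l <-].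
  change (clen (tuple_code (a :: l)) = S (clen (tuple_code l))). now rewrite !clen_code.
Qed.
Lemma nth_map_seq f n i : i < n -> nth i (map f (seq 0 n)) 0 = f i.
Proof.
  intros H. rewrite (nth_indep _ 0 (f 0)) by now rewrite length_map, length_seq.
  now rewrite map_nth, seq_nth.
Qed.

Section Lists.
Variable K : (nat -> bool) -> Prop.
Lemma cf_ccons F G : cf K F -> cf K G -> cf K (fun X n => ccons (F X n) (G X n)).
Proof. intros. unfold ccons. csolve. Qed.
Lemma cf_chd F : cf K F -> cf K (fun X n => chd (F X n)).
Proof. intros. unfold chd. csolve. Qed.
Lemma cf_ctl F : cf K F -> cf K (fun X n => ctl (F X n)).
Proof. intros. unfold ctl. csolve. Qed.
Lemma cf_cdrop I F : cf K I -> cf K F -> cf K (fun X n => cdrop (I X n) (F X n)).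
Proof.
  intros. unfold cdrop. apply (cf_rec K F (fun X n k r => ctl r) I); auto.
  apply cf_ctl. csolve.
Qed.
Lemma cf_cnth I F : cf K I -> cf K F -> cf K (fun X n => cnth (I X n) (F X n)).
Proof. intros. unfold cnth. now apply cf_chd, cf_cdrop. Qed.
Lemma cf_clen F : cf K F -> cf K (fun X n => clen (F X n)).
Proof.
  intros H. unfold clen.
  apply (cf_rec K (fun _ _ => 0) (fun X n i r => r + if cdrop i (F X n) =? 0 then 0 else 1) F); auto.
  - apply cf_const.
  - csolve. apply cf_cdrop; csolve.
Qed.
Lemma cf_cmk N f : cf K N -> cf K (fun X z => f X (pi1 z) (pi2 z)) ->
  cf K (fun X n => cmk (N X n) (f X n)).
Proof.
  intros HN Hf. unfold cmk.
  apply (cf_rec K (fun _ _ => 0) (fun X n k r => ccons (f X n (N X n - S k)) r) N); auto.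
  - apply cf_const.
  - apply cf_ccons; csolve.
    eapply cf_ext; [|apply (cf_comp K _ (fun X z => npair (pi1 z) (N X (pi1 z) - S (pi1 (pi2 z)))) Hf)].
    + intros X z _; cbn beta. now rewrite pi1_pair, pi2_pair.
    + csolve.
Qed.
End Lists.

Global Opaque ccons chd ctl cdrop cnth clen cmk.

Ltac cext_list := lazymatch goal with
  | |- cf ?K (fun X n => ccons (@?a X n) (@?b X n)) => apply (cf_ccons K a b)
  | |- cf ?K (fun X n => chd (@?a X n)) => apply (cf_chd K a)
  | |- cf ?K (fun X n => ctl (@?a X n)) => apply (cf_ctl K a)
  | |- cf ?K (fun X n => cnth (@?a X n) (@?b X n)) => apply (cf_cnth K a b)
  | |- cf ?K (fun X n => clen (@?a X n)) => apply (cf_clen K a)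
  | |- cf ?K (fun X n => cdrop (@?a X n) (@?b X n)) => apply (cf_cdrop K a b)
  | |- cf ?K (fun X n => cmk (@?a X n) (@?b X n)) => apply (cf_cmk K a b)
  end.
Ltac cext ::= cext_list.

Lemma cf_capp K F G : cf K F -> cf K G -> cf K (fun X n => capp (F X n) (G X n)).
Proof. intros HF HG. unfold capp. csolve. Qed.
Global Opaque capp.

(** * A universal machine *)

(** The fact [eval X c n m], coded by [npair (encode c) (npair n m)], is
    certified by a table of facts each of which follows in one step from facts
    in its tail. *)
Definition cmem (f t : nat) : bool := bex (clen t) (fun i => cnth i t =? f).
Definition cfact (e n m t : nat) : bool := cmem (npair e (npair n m)) t.
(** The constants are those of [encode]. All searches can be bounded: an index exceeds the number
    [z] of its immediate subprograms, and intermediate values occur in the table, so they are at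
    most its code [t]. *)
Definition just (X : nat -> bool) (e n m t : nat) : bool :=
  (e =? 0) && (m =? 0) || (e =? 1) && (m =? S n) || (e =? 2) && (m =? pi1 n) ||
  (e =? 3) && (m =? pi2 n) || (e =? 4) && (m =? Nat.b2n (X n)) ||
  bex e (fun z => (e =? 5 + 4 * z) &&
    (cfact (pi1 z) n (pi1 m) t && cfact (pi2 z) n (pi2 m) t)) ||
  bex e (fun z => (e =? 6 + 4 * z) &&
    bex (S t) (fun u => cfact (pi2 z) n u t && cfact (pi1 z) u m t)) ||
  bex e (fun z => (e =? 7 + 4 * z) &&
    if pi2 n =? 0 then cfact (pi1 z) (pi1 n) m t
    else bex (S t) (fun r => cfact e (npair (pi1 n) (pred (pi2 n))) r t &&
           cfact (pi2 z) (npair (pi1 n) (npair (pred (pi2 n)) r)) m t)) ||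
  bex e (fun z => (e =? 8 + 4 * z) &&
    (cfact z (npair n m) 0 t &&
     ball m (fun j => bex (S t) (fun v => cfact z (npair n j) (S v) t)))).
Definition valid (X : nat -> bool) (t : nat) : bool :=
  ball (clen t) (fun i => just X (pi1 (cnth i t)) (pi1 (pi2 (cnth i t)))
                               (pi2 (pi2 (cnth i t))) (cdrop (S i) t)).
Definition certo (X : nat -> bool) (e n m t : nat) : bool := valid X t && cfact e n m t.
Definition cert : nat -> nat -> nat -> nat -> bool := certo no_oracle.

Lemma cmem_code f l : cmem f (tuple_code l) = true <-> In f l.
Proof.
  unfold cmem. rewrite bex_true, clen_code. split.
  - intros (i & Hi & E). rewrite cnth_code in E. apply Nat.eqb_eq in E as <-.
    now apply nth_In.
  - intros H. destruct (In_nth l f 0 H) as (i & Hi & E). exists i; split; auto.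
    rewrite cnth_code. now apply Nat.eqb_eq.
Qed.

Definition infact (c : code) (n m : nat) (l : list nat) : Prop :=
  In (npair (encode c) (npair n m)) l.

Lemma infact_bound e n u l : cfact e n u (tuple_code l) = true -> u < S (tuple_code l).
Proof.
  intros H. apply cmem_code in H. destruct (In_nth l _ 0 H) as (i & Hi & E).
  pose proof (nth_le_code l i). rewrite E in H0.
  pose proof (npair_ge e (npair n u)). pose proof (npair_ge n u). lia.
Qed.
Lemma cfact_infact c n m l : cfact (encode c) n m (tuple_code l) = true <-> infact c n m l.
Proof. apply cmem_code. Qed.

Section Machine.
Variable X : nat -> bool.

Definition JustP (c : code) (n m : nat) (l : list nat) : Prop :=
  match c with
  | Zero => m = 0
  | Succ => m = S n
  | Fst => m = pi1 n
  | Snd => m = pi2 n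
  | Orc => m = Nat.b2n (X n)
  | Pair c d => infact c n (pi1 m) l /\ infact d n (pi2 m) l
  | Comp c d => exists u, infact d n u l /\ infact c u m l
  | Rec c d =>
      match pi2 n with
      | 0 => infact c (pi1 n) m l
      | S k => exists r, infact (Rec c d) (npair (pi1 n) k) r l /\
                 infact d (npair (pi1 n) (npair k r)) m l
      end
  | Min c => infact c (npair n m) 0 l /\
             forall j, j < m -> exists v, infact c (npair n j) (S v) l
  end.

Lemma just_spec c n m l : just X (encode c) n m (tuple_code l) = true <-> JustP c n m l.
Proof.
  (* The summand 5 to 8 fixes the index modulo 4, so at most one of the four searches can succeed,
     and only at the number [z0] of the subprograms. *)
  assert (B : forall a (k : nat) (f : nat -> bool) z0, encode c = a + 4 * z0 -> 0 < a ->
     (bex (encode c) (fun z => (encode c =? a + 4 * z) && f z) = true <-> f z0 = true)).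
  { intros a _ f z0 E Ha. rewrite bex_true. split.
    - intros (z & _ & H). apply andb_true_iff in H as [H1 H2]. apply Nat.eqb_eq in H1.
      replace z0 with z by lia. exact H2.
    - intros H. exists z0. split; [lia|]. rewrite H, andb_true_r. now apply Nat.eqb_eq. }
  assert (N : forall a (f : nat -> bool), (forall z, encode c <> a + 4 * z) ->
     bex (encode c) (fun z => (encode c =? a + 4 * z) && f z) = false).
  { intros a f H. apply not_true_is_false. rewrite bex_true.
    intros (z & _ & E). apply andb_true_iff in E as [E _]. apply Nat.eqb_eq in E.
    exact (H z E). }
  assert (Q : forall a, encode c <> a -> forall b, (encode c =? a) && b = false).
  { intros a H b. apply Nat.eqb_neq in H. now rewrite H. }
  unfold just.
  destruct c; cbn [JustP];
    try (cbn [encode]; simpl; rewrite ?orb_false_r; apply Nat.eqb_eq);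
    rewrite (Q 0), (Q 1), (Q 2), (Q 3), (Q 4) by (cbn [encode]; lia);
    rewrite ?orb_false_l.
  - rewrite (N 6), (N 7), (N 8), !orb_false_r by (cbn [encode]; lia).
    rewrite (B 5 0 _ (npair (encode c1) (encode c2))) by (cbn [encode]; lia).
    rewrite pi1_pair, pi2_pair, andb_true_iff. now rewrite !cfact_infact.
  - rewrite (N 5), (N 7), (N 8), ?orb_false_r by (cbn [encode]; lia). rewrite ?orb_false_l.
    rewrite (B 6 0 _ (npair (encode c1) (encode c2))) by (cbn [encode]; lia).
    rewrite pi1_pair, pi2_pair, bex_true. split.
    + intros (u & _ & H). exists u. rewrite andb_true_iff in H. now rewrite !cfact_infact in H.
    + intros (u & H). rewrite <- !cfact_infact in H. exists u.
      rewrite andb_true_iff. split; auto. eapply infact_bound, H.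
  - rewrite (N 5), (N 6), (N 8), ?orb_false_r by (cbn [encode]; lia). rewrite ?orb_false_l.
    rewrite (B 7 0 _ (npair (encode c1) (encode c2))) by (cbn [encode]; lia).
    rewrite pi1_pair, pi2_pair. destruct (pi2 n) as [|k]; cbn [Nat.eqb pred].
    + apply cfact_infact.
    + rewrite bex_true. split.
      * intros (u & _ & H). exists u. rewrite andb_true_iff in H. now rewrite !cfact_infact in H.
      * intros (u & H). rewrite <- !cfact_infact in H. exists u.
        rewrite andb_true_iff. split; auto. eapply infact_bound, H.
  - rewrite (N 5), (N 6), (N 7), ?orb_false_r by (cbn [encode]; lia). rewrite ?orb_false_l.
    rewrite (B 8 0 _ (encode c)) by (cbn [encode]; lia).
    rewrite andb_true_iff, ball_true, cfact_infact. split; intros [H1 H2]; split; auto;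
      intros j Hj; specialize (H2 j Hj).
    + apply bex_true in H2 as (v & _ & H2). exists v. now apply cfact_infact.
    + destruct H2 as [v H2]. apply cfact_infact in H2. apply bex_true. exists v. split; auto.
      apply infact_bound in H2. lia.
Qed.

Definition justf (f t : nat) : bool := just X (pi1 f) (pi1 (pi2 f)) (pi2 (pi2 f)) t.
Lemma justf_spec c n m l :
  justf (npair (encode c) (npair n m)) (tuple_code l) = true <-> JustP c n m l.
Proof. unfold justf. pis. apply just_spec. Qed.

Fixpoint validL (l : list nat) : Prop :=
  match l with
  | [] => True
  | f :: l' => justf f (tuple_code l') = true /\ validL l'
  end.
Lemma valid_code l : valid X (tuple_code l) = true <-> validL l.
Proof.
  unfold valid. rewrite ball_true, clen_code.
  transitivity (forall i, i < length l -> justf (nth i l 0) (tuple_code (skipn (S i) l)) = true).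
  { split; intros H i Hi; specialize (H i Hi); rewrite cnth_code, cdrop_code in *; exact H. }
  induction l as [|f l IH]; simpl; [intuition lia|].
  rewrite <- IH. split.
  - intros H. split; [apply (H 0); lia|]. intros i Hi. apply (H (S i)). lia.
  - intros [H1 H2] [|i] Hi; auto. apply H2. lia.
Qed.

Lemma validL_sound l : validL l -> forall c n m, infact c n m l -> eval X c n m.
Proof.
  induction l as [|f l IH]; intros V c n m; [intros []|].
  destruct V as [J V]. specialize (IH V). intros [->|H]; [|eauto].
  apply justf_spec in J. clear V. destruct c; cbn [JustP eval] in *; auto.
  - destruct J as [J1 J2]. exists (pi1 m), (pi2 m). rewrite pair_pi. auto.
  - destruct J as (u & J1 & J2). exists u; auto.
  - change (snd (of_nat n)) with (pi2 n). change (fst (of_nat n)) with (pi1 n).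
    destruct (pi2 n) as [|k]; simpl; auto.
    destruct J as (r & J1 & J2). exists r. split; auto.
    specialize (IH _ _ _ J1). cbn [eval] in IH.
    change (snd (of_nat ?z)) with (pi2 z) in IH. change (fst (of_nat ?z)) with (pi1 z) in IH.
    now rewrite pi1_pair, pi2_pair in IH.
  - destruct J as [J1 J2]. split; auto. intros j Hj. destruct (J2 j Hj) as [v J]. eauto.
Qed.

(** Asking for an extension of every valid table allows certificates to be stacked: the derivations
    needed for one step are added one after another to the same table. *)
Definition derivable (c : code) (n m : nat) : Prop :=
  forall l, validL l -> exists l', validL (l' ++ l) /\ infact c n m (l' ++ l).

Lemma derivable_step c n m :
  (forall l, validL l -> exists l', validL (l' ++ l) /\ JustP c n m (l' ++ l)) ->
  derivable c n m.
Proof.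
  intros H l V. destruct (H l V) as (l' & V' & J).
  exists (npair (encode c) (npair n m) :: l'). split; [|left; auto].
  split; auto. now apply justf_spec.
Qed.
Lemma infact_app c n m l l' : infact c n m l -> infact c n m (l' ++ l).
Proof. intros H. apply in_or_app. now right. Qed.

Lemma derivable_two c n m c' n' m' l : derivable c n m -> derivable c' n' m' -> validL l ->
  exists l', validL (l' ++ l) /\ infact c n m (l' ++ l) /\ infact c' n' m' (l' ++ l).
Proof.
  intros H H' V. destruct (H l V) as (l1 & V1 & J1). destruct (H' _ V1) as (l2 & V2 & J2).
  exists (l2 ++ l1). rewrite <- app_assoc. auto using infact_app.
Qed.

Lemma eval_derivable c : forall n m, eval X c n m -> derivable c n m.
Proof.
  induction c; intros n m H;
    try (apply derivable_step; intros l V; exists []; split; [exact V|exact H]).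
  - destruct H as (u & v & H1 & H2 & ->). apply derivable_step. intros l V.
    destruct (derivable_two _ _ _ _ _ _ _ (IHc1 _ _ H1) (IHc2 _ _ H2) V) as (l' & V' & J).
    exists l'. cbn [JustP]. rewrite pi1_pair, pi2_pair. auto.
  - destruct H as (u & H1 & H2). apply derivable_step. intros l V.
    destruct (derivable_two _ _ _ _ _ _ _ (IHc2 _ _ H1) (IHc1 _ _ H2) V) as (l' & V' & J).
    exists l'. cbn [JustP]. eauto.
  - cbn [eval] in H. change (snd (of_nat n)) with (pi2 n) in H.
    change (fst (of_nat n)) with (pi1 n) in H. rewrite <- (pair_pi n).
    revert m H. generalize (pi2 n) as k. generalize (pi1 n) as a. clear n.
    intros a k. induction k as [|k IH]; intros m H; simpl in H; apply derivable_step;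
      intros l V; cbn [JustP]; rewrite pi1_pair, pi2_pair.
    + apply (IHc1 _ _ H l V).
    + destruct H as (r & Hr & Hm).
      destruct (derivable_two _ _ _ _ _ _ _ (IH _ Hr) (IHc2 _ _ Hm) V) as (l' & V' & J).
      eauto.
  - destruct H as [H1 H2]. apply derivable_step. intros l V.
    assert (G : forall k, k <= m -> exists l', validL (l' ++ l) /\
      forall j, j < k -> exists v, infact c (npair n j) (S v) (l' ++ l)).
    { induction k as [|k IH]; intros Hk.
      - exists []; split; auto. intros; lia.
      - destruct IH as (l1 & V1 & J1); [lia|]. destruct (H2 k Hk) as [v Hv].
        destruct (IHc _ _ Hv _ V1) as (l2 & V2 & J2). exists (l2 ++ l1).
        rewrite <- app_assoc. split; auto. intros j Hj.
        destruct (Nat.eq_dec j k) as [->|]; eauto.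
        destruct (J1 j) as [w Hw]; [lia|]. exists w. now apply infact_app. }
    destruct (G m (le_n m)) as (l1 & V1 & J1).
    destruct (IHc _ _ H1 _ V1) as (l2 & V2 & J2). exists (l2 ++ l1).
    rewrite <- app_assoc. cbn [JustP]. split; auto. split; auto.
    intros j Hj. destruct (J1 j Hj) as [v Hv]. exists v. now apply infact_app.
Qed.

End Machine.

Lemma encode_surj e : exists c, encode c = e.
Proof.
  induction e as [e IH] using lt_wf_ind.
  destruct (le_lt_dec e 4) as [H|H].
  - destruct e as [|[|[|[|[|]]]]]; [exists Zero|exists Succ|exists Fst|exists Snd|exists Orc|lia]; auto.
  - pose proof (Nat.div_mod (e - 5) 4 ltac:(lia)) as D.
    pose proof (Nat.mod_upper_bound (e - 5) 4 ltac:(lia)) as U.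
    set (z := (e - 5) / 4) in *. set (r := (e - 5) mod 4) in *. clearbody z r.
    pose proof (pi1_le z). pose proof (pi2_le z).
    destruct (IH (pi1 z) ltac:(lia)) as [c1 E1]. destruct (IH (pi2 z) ltac:(lia)) as [c2 E2].
    destruct (IH z ltac:(lia)) as [c3 E3].
    destruct r as [|[|[|[|]]]]; [exists (Pair c1 c2)|exists (Comp c1 c2)|exists (Rec c1 c2)|exists (Min c3)|lia];
      cbn [encode]; rewrite ?E1, ?E2, ?E3, ?pair_pi; lia.
Qed.

Lemma certo_phi X e n m : phi X e n m <-> exists t, certo X e n m t = true.
Proof.
  destruct (encode_surj e) as [c <-]. rewrite phi_encode. unfold certo. split.
  - intros H. destruct (eval_derivable _ _ _ _ H [] I) as (l & V & J).
    exists (tuple_code (l ++ [])). rewrite andb_true_iff, valid_code, cfact_infact. auto.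
  - intros [t H]. rewrite <- (tuple_code_list_of t), andb_true_iff, valid_code, cfact_infact in H.
    destruct H as [V J]. exact (validL_sound _ _ V _ _ _ J).
Qed.
Lemma cert_phi e n m : phi no_oracle e n m <-> exists t, cert e n m t = true.
Proof. apply certo_phi. Qed.

Lemma cfb_certo K O E N M T : cfb K O -> cf K E -> cf K N -> cf K M -> cf K T ->
  cfb K (fun X z => certo (O X) (E X z) (N X z) (M X z) (T X z)).
Proof.
  intros. unfold certo, valid, just, cfact, cmem. csolve.
Qed.
Lemma cfb_cert K E N M T : cf K E -> cf K N -> cf K M -> cf K T ->
  cfb K (fun X z => cert (E X z) (N X z) (M X z) (T X z)).
Proof. intros. apply (cfb_certo K (fun _ => no_oracle)); auto. exact (cfb_const K false). Qed.
Global Opaque cert certo.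

Ltac cext_cert := first [ cext_list | lazymatch goal with
  | |- cf ?K (fun X n => capp (@?a X n) (@?b X n)) => apply (cf_capp K a b)
  | |- cfb ?K (fun X n => cert (@?a X n) (@?b X n) (@?c X n) (@?d X n)) => apply (cfb_cert K a b c d)
  end ].
Ltac cext ::= cext_cert.

(** * Indices, relative computability and degrees *)

Definition all_oracles : (nat -> bool) -> Prop := fun _ => True.

Fixpoint const_code (k : nat) : code :=
  match k with 0 => Zero | S k' => Comp Succ (const_code k') end.
Lemma eval_const X k n : eval X (const_code k) n k.
Proof. induction k; simpl; eauto. Qed.

Definition id_code : code := Pair Fst Snd.
Lemma eval_id X n : eval X id_code n n.
Proof. exists (pi1 n), (pi2 n). repeat split. now rewrite pair_pi. Qed.

Definition smn_code (c : code) (k : nat) : code := Comp c (Pair (const_code k) id_code).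
Lemma eval_comp_total X c d z y m : eval X d z y -> (eval X (Comp c d) z m <-> eval X c y m).
Proof.
  intros H. split; [|exists y; auto].
  intros (u & H1 & H2). now rewrite <- (eval_functional _ _ _ _ _ H1 H).
Qed.
Lemma eval_smn X c k n m : eval X (smn_code c k) n m <-> eval X c (npair k n) m.
Proof.
  apply eval_comp_total. exists k, n. auto using eval_const, eval_id.
Qed.

Lemma cf_encode_smn K c F : cf K F -> cf K (fun X n => encode (smn_code c (F X n))).
Proof.
  intros H.
  assert (H' : cf K (fun X n => encode (const_code (F X n)))).
  { eapply cf_ext; [|apply (cf_rec K (fun _ _ => 0)
      (fun X n k r => 6 + 4 * npair (encode Succ) r) F); auto; csolve].
    intros X n _; cbn beta. induction (F X n); auto. cbn [nat_rect]. rewrite IHn0. reflexivity. }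
  assert (Q : forall G a b, cf K G ->
    cf K (fun X n => 6 + 4 * npair a (5 + 4 * npair (G X n) b))) by (intros; csolve).
  exact (Q _ (encode c) (encode id_code) H').
Qed.

Lemma smn K F : cf K F -> exists g, cf all_oracles (fun _ => g) /\
  forall X, K X -> forall k n, phi X (g k) n (F X (npair k n)).
Proof.
  intros [c Hc]. exists (fun k => encode (smn_code c k)). split.
  - apply cf_encode_smn. csolve.
  - intros X HX k n. apply phi_encode, eval_smn. auto.
Qed.

Fixpoint osubst (o c : code) : code :=
  match c with
  | Orc => o
  | Pair c d => Pair (osubst o c) (osubst o d)
  | Comp c d => Comp (osubst o c) (osubst o d)
  | Rec c d => Rec (osubst o c) (osubst o d)
  | Min c => Min (osubst o c)
  | c => c
  end.
Lemma eval_osubst X Y o : (forall n, eval Y o n (Nat.b2n (X n))) ->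
  forall c n m, eval X c n m -> eval Y (osubst o c) n m.
Proof.
  intros Ho. induction c; intros n m H; cbn [osubst]; auto.
  - cbn in H. now subst.
  - destruct H as (u & v & H1 & H2 & ->). exists u, v; auto.
  - destruct H as (u & H1 & H2). exists u; auto.
  - cbn [eval] in *. revert m H. induction (snd (of_nat n)) as [|k IH]; simpl; auto.
    intros m (r & H1 & H2). exists r; auto.
  - destruct H as [H1 H2]. split; auto. intros j Hj. destruct (H2 j Hj) as [v Hv]. eauto.
Qed.

Lemma phi_turing X Y : turing_le X Y ->
  forall e, exists e', forall n m, phi X e n m -> phi Y e' n m.
Proof.
  intros [o Ho] e. destruct (encode_surj o) as [co <-]. destruct (encode_surj e) as [c <-].
  exists (encode (osubst co c)). intros n m. rewrite !phi_encode. apply eval_osubst.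
  intros k. specialize (Ho k). now rewrite phi_encode in Ho.
Qed.

Lemma turing_le_trans X Y Z : turing_le X Y -> turing_le Y Z -> turing_le X Z.
Proof.
  intros [e H] H'. destruct (phi_turing _ _ H' e) as [e' He]. exists e'. auto.
Qed.
Lemma degree_turing_le d X Y : in_degree d X -> in_degree d Y -> turing_le X Y.
Proof.
  destruct (in_degreeP d) as [Z HZ]. rewrite !HZ. intros [_ H] [H' _].
  eapply turing_le_trans; eauto.
Qed.
Lemma degree_nonempty d : exists X, in_degree d X.
Proof.
  destruct (in_degreeP d) as [Z HZ]. exists Z. apply HZ.
  assert (turing_le Z Z); [|split; auto].
  exists (encode Orc). intros n. apply phi_encode. reflexivity.
Qed.

Definition rc (Y : nat -> bool) (f : nat -> nat) : Prop := cf (eq Y) (fun _ => f).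
Definition rcb (Y : nat -> bool) (f : nat -> bool) : Prop := cfb (eq Y) (fun _ => f).

Ltac cext_rc := first [ cext_cert | match goal with
  | H : cf ?K (fun _ => ?f) |- cf ?K (fun X n => ?f (@?a X n)) => apply (cf_comp K (fun _ => f) a H)
  | H : cfb ?K (fun _ => ?f) |- cfb ?K (fun X n => ?f (@?a X n)) => apply (cfb_comp K (fun _ => f) a H)
  | H : rc ?Y ?f |- cf (eq ?Y) (fun X n => ?f (@?a X n)) => apply (cf_comp (eq Y) (fun _ => f) a H)
  | H : rcb ?Y ?f |- cfb (eq ?Y) (fun X n => ?f (@?a X n)) => apply (cfb_comp (eq Y) (fun _ => f) a H)
  end ].
Ltac cext ::= cext_rc.

Lemma rc_degree d Y f : in_degree d Y -> rc Y f -> degree_computable_on d (fun _ => True) f.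
Proof.
  intros HY [c Hc]. exists Y, (encode c). split; auto. intros x _. apply phi_encode. auto.
Qed.
Lemma degree_rc d Y f : in_degree d Y -> degree_computable_on d (fun _ => True) f -> rc Y f.
Proof.
  intros HY (X & e & HX & H).
  destruct (phi_turing X Y (degree_turing_le d X Y HX HY) e) as [e' He].
  destruct (encode_surj e') as [c <-]. exists c. intros Z <- n.
  specialize (He n (f n) (H n I)). now rewrite phi_encode in He.
Qed.

(** * Computably enumerable transition systems *)

Definition Edge (e q q' : nat) : Prop := exists m, phi no_oracle e (npair q q') m.
Definition irun (e q : nat) (f : nat -> nat) : Prop :=
  f 0 = q /\ forall n, Edge e (f n) (f (S n)).
Definition high_for_paths (d : turing_degree) : Prop :=
  forall e q, (exists f, irun e q f) ->
    exists f, irun e q f /\ degree_computable_on d (fun _ => True) f.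

Lemma edge_index (B : nat -> nat -> bool) :
  cfb all_oracles (fun X z => B (pi1 z) (pi2 z)) ->
  exists e, forall q q', Edge e q q' <-> exists k, B (npair q q') k = true.
Proof.
  intros H. destruct (semidec all_oracles (fun _ => B) H) as [c Hc].
  exists (encode c). intros q q'. unfold Edge.
  destruct (Hc no_oracle I (npair q q')) as [H1 H2]. split.
  - intros [m Hm]. rewrite phi_encode in Hm. eauto.
  - intros Hk. destruct (H2 Hk) as [m Hm]. exists m. now apply phi_encode.
Qed.

(** The witness packs an output of the enumerating program with a certificate, so that an edge is a
    decidable relation preceded by one existential number. *)
Definition edge_cert (e q q' t : nat) : bool := cert e (npair q q') (pi1 t) (pi2 t).
Lemma edge_cert_spec e q q' : Edge e q q' <-> exists t, edge_cert e q q' t = true.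
Proof.
  unfold Edge, edge_cert. split.
  - intros [m H]. apply cert_phi in H as [t H]. exists (npair m t).
    now rewrite pi1_pair, pi2_pair.
  - intros [t H]. exists (pi1 t). apply cert_phi. eauto.
Qed.

(** * Programs with a finite part of the oracle *)

Definition agrees (X : nat -> bool) (s : nat) : Prop :=
  forall i, i < clen s -> X i = (cnth i s =? 1).

(** Beyond the listed bits the look-up has to diverge rather than answer by default; otherwise a
    computation from a finite part would say nothing about the oracles that extend it. Pairing the
    bit with a search that halts only for [n < clen s] achieves this. *)
Lemma lookup_exists : exists o, forall s n m, eval no_oracle o (npair s n) m <->
  (n < clen s /\ m = Nat.b2n (cnth n s =? 1)).
Proof.
  assert (H1 : cfb all_oracles (fun X z => pi2 (pi1 z) <? clen (pi1 (pi1 z)))) by csolve.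
  destruct (semidec all_oracles (fun X z k => pi2 z <? clen (pi1 z)) H1) as [c Hc].
  assert (H2 : cfb all_oracles (fun X z => cnth (pi2 z) (pi1 z) =? 1)) by csolve.
  destruct H2 as [v Hv].
  exists (Comp Snd (Pair c v)). intros s n m.
  specialize (Hv no_oracle I (npair s n)). rewrite pi1_pair, pi2_pair in Hv.
  destruct (Hc no_oracle I (npair s n)) as [H2 H3]. rewrite pi1_pair, pi2_pair in H2, H3.
  split.
  - intros (u & (a & b & Ha & Hb & ->) & ->). split; [apply Nat.ltb_lt; eauto|].
    change (pi2 (npair a b) = Nat.b2n (cnth n s =? 1)).
    rewrite pi2_pair. eapply eval_functional; eauto.
  - intros [H ->]. apply Nat.ltb_lt in H. destruct H3 as [a Ha]; [exists 0; auto|].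
    exists (npair a (Nat.b2n (cnth n s =? 1))). split; [do 2 eexists; eauto|].
    change (Nat.b2n (cnth n s =? 1) = pi2 (npair a (Nat.b2n (cnth n s =? 1)))).
    now rewrite pi2_pair.
Qed.

(** [Rec] and [Min] append their own data behind the argument; these two programs move the finite
    part [s] between the inner pair and the outermost position. *)
Definition assoc_code : code := Pair (Comp Fst Fst) (Pair (Comp Snd Fst) Snd).
Definition unassoc_code : code := Pair (Pair Fst (Comp Fst Snd)) (Comp Snd Snd).
Lemma eval_assoc X s a w : eval X assoc_code (npair (npair s a) w) (npair s (npair a w)).
Proof.
  assert (H : eval X assoc_code (npair (npair s a) w)
    (npair (pi1 (pi1 (npair (npair s a) w)))
      (npair (pi2 (pi1 (npair (npair s a) w))) (pi2 (npair (npair s a) w))))).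
  { cbn [eval assoc_code]. repeat (eexists; repeat split). }
  now pis in H.
Qed.
Lemma eval_unassoc X s a w : eval X unassoc_code (npair s (npair a w)) (npair (npair s a) w).
Proof.
  assert (H : eval X unassoc_code (npair s (npair a w))
    (npair (npair (pi1 (npair s (npair a w))) (pi1 (pi2 (npair s (npair a w)))))
      (pi2 (pi2 (npair s (npair a w)))))).
  { cbn [eval unassoc_code]. repeat (eexists; repeat split). }
  now pis in H.
Qed.

(** [ptrans o c] computes on [<s, n>] what [c] computes on [n] if only the bits
    listed in [s] are available from the oracle, [o] being a look-up program. *)
Fixpoint ptrans (o c : code) : code :=
  match c with
  | Zero => Zero
  | Succ => Comp Succ Snd
  | Fst => Comp Fst Snd
  | Snd => Comp Snd Snd
  | Orc => o
  | Pair c d => Pair (ptrans o c) (ptrans o d)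
  | Comp c d => Comp (ptrans o c) (Pair Fst (ptrans o d))
  | Rec c d => Comp (Rec (ptrans o c) (Comp (ptrans o d) assoc_code)) unassoc_code
  | Min c => Min (Comp (ptrans o c) assoc_code)
  end.

Section Ptrans.
Variable o : code.
Hypothesis Ho : forall s n m, eval no_oracle o (npair s n) m <->
  (n < clen s /\ m = Nat.b2n (cnth n s =? 1)).

Lemma eval_snd X s n : eval X Snd (npair s n) n.
Proof. change (n = pi2 (npair s n)). now rewrite pi2_pair. Qed.

Lemma ptrans_rec s c d n m :
  eval no_oracle (ptrans o (Rec c d)) (npair s n) m <->
  rec_graph (fun a => eval no_oracle (ptrans o c) (npair s a))
    (fun a => eval no_oracle (ptrans o d) (npair s a)) (pi1 n) (pi2 n) m.
Proof.
  cbn [ptrans]. rewrite <- (pair_pi n) at 1.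
  rewrite (eval_comp_total _ _ _ _ _ _ (eval_unassoc no_oracle s (pi1 n) (pi2 n))).
  cbn [eval]. change (fst (of_nat ?z)) with (pi1 z). change (snd (of_nat ?z)) with (pi2 z).
  rewrite pi1_pair, pi2_pair. revert m. induction (pi2 n) as [|k IH]; intros m; cbn [rec_graph]; [easy|].
  split; intros (r & H1 & H2); exists r; (split; [now apply IH|]).
  - destruct H2 as (u & H2 & H3).
    rewrite (eval_functional _ _ _ _ _ H2 (eval_assoc no_oracle _ _ _)) in H3. exact H3.
  - eexists; split; [apply eval_assoc|exact H2].
Qed.

Lemma ptrans_sound c : forall s n m, eval no_oracle (ptrans o c) (npair s n) m ->
  forall X, agrees X s -> eval X c n m.
Proof.
  induction c; intros s n m H X HX.
  - exact H.
  - apply (eval_comp_total _ _ _ _ _ _ (eval_snd no_oracle s n)) in H. exact H.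
  - apply (eval_comp_total _ _ _ _ _ _ (eval_snd no_oracle s n)) in H. exact H.
  - apply (eval_comp_total _ _ _ _ _ _ (eval_snd no_oracle s n)) in H. exact H.
  - apply Ho in H as [H ->]. cbn. now rewrite HX.
  - destruct H as (u & v & H1 & H2 & ->). exists u, v. eauto.
  - destruct H as (w & (s' & u & H1 & H2 & ->) & H3).
    change (s' = pi1 (npair s n)) in H1. rewrite pi1_pair in H1. subst s'.
    exists u. eauto.
  - apply ptrans_rec in H. cbn [eval].
    change (fst (of_nat n)) with (pi1 n). change (snd (of_nat n)) with (pi2 n).
    revert m H. induction (pi2 n) as [|k IH]; simpl; intros m H; [eauto|].
    destruct H as (r & H1 & H2). exists r. eauto.
  - destruct H as [H1 H2]. split.
    + destruct H1 as (u & H1 & H3).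
      rewrite (eval_functional _ _ _ _ _ H1 (eval_assoc no_oracle _ _ _)) in H3. eauto.
    + intros j Hj. destruct (H2 j Hj) as (v & u & H3 & H4). exists v.
      rewrite (eval_functional _ _ _ _ _ H3 (eval_assoc no_oracle _ _ _)) in H4. eauto.
Qed.

Definition converges (X : nat -> bool) (c : code) (n m : nat) : Prop :=
  exists N, forall s, agrees X s -> N <= clen s -> eval no_oracle (ptrans o c) (npair s n) m.

Lemma ptrans_complete X c : forall n m, eval X c n m -> converges X c n m.
Proof.
  induction c; intros n m H.
  - exists 0. intros. exact H.
  - exists 0. intros s _ _. now apply (eval_comp_total _ _ _ _ _ _ (eval_snd no_oracle s n)).
  - exists 0. intros s _ _. now apply (eval_comp_total _ _ _ _ _ _ (eval_snd no_oracle s n)).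
  - exists 0. intros s _ _. now apply (eval_comp_total _ _ _ _ _ _ (eval_snd no_oracle s n)).
  - exists (S n). intros s A L. apply Ho. cbn in H. rewrite <- A by lia. auto.
  - destruct H as (u & v & H1 & H2 & ->).
    destruct (IHc1 _ _ H1) as [N1 F1]. destruct (IHc2 _ _ H2) as [N2 F2].
    exists (N1 + N2). intros s A L. exists u, v.
    repeat split; [apply F1|apply F2]; auto; lia.
  - destruct H as (u & H1 & H2).
    destruct (IHc2 _ _ H1) as [N1 F1]. destruct (IHc1 _ _ H2) as [N2 F2].
    exists (N1 + N2). intros s A L. exists (npair s u). split; [|apply F2; auto; lia].
    exists s, u. repeat split; [|apply F1; auto; lia].
    change (s = pi1 (npair s n)). now rewrite pi1_pair.
  - cbn [eval] in H. change (fst (of_nat n)) with (pi1 n) in H.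
    change (snd (of_nat n)) with (pi2 n) in H.
    cut (exists N, forall s, agrees X s -> N <= clen s ->
      rec_graph (fun a => eval no_oracle (ptrans o c1) (npair s a))
    (fun a => eval no_oracle (ptrans o c2) (npair s a)) (pi1 n) (pi2 n) m).
    { intros [N F]. exists N. intros. apply ptrans_rec. auto. }
    revert m H. induction (pi2 n) as [|k IH]; simpl; intros m H; [exact (IHc1 _ _ H)|].
    destruct H as (r & H1 & H2). destruct (IH _ H1) as [N1 F1].
    destruct (IHc2 _ _ H2) as [N2 F2]. exists (N1 + N2). intros s A L.
    exists r. split; [apply F1|apply F2]; auto; lia.
  - destruct H as [H1 H2]. destruct (IHc _ _ H1) as [N1 F1].
    assert (G : forall k, k <= m -> exists N, forall s, agrees X s -> N <= clen s ->
      forall j, j < k -> exists v, eval no_oracle (ptrans o c) (npair s (npair n j)) (S v)).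
    { induction k as [|k IH]; intros Hk; [exists 0; intros; lia|].
      destruct IH as [N2 F2]; [lia|]. destruct (H2 k Hk) as [v Hv].
      destruct (IHc _ _ Hv) as [N3 F3]. exists (N2 + N3). intros s A L j Hj.
      destruct (Nat.eq_dec j k) as [->|].
      - exists v. apply F3; auto; lia.
      - apply F2; auto; lia. }
    destruct (G m (le_n m)) as [N2 F2]. exists (N1 + N2). intros s A L. split.
    + exists (npair s (npair n m)). split; [apply eval_assoc|]. apply F1; auto; lia.
    + intros j Hj. destruct (F2 s A ltac:(lia) j Hj) as [v Hv]. exists v.
      exists (npair s (npair n j)). split; [apply eval_assoc|]. auto.
Qed.
End Ptrans.

(** * A basis theorem *)

Definition bits (X : nat -> bool) (n : nat) : nat := cmk n (fun i => Nat.b2n (X i)).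
Lemma clen_bits X n : clen (bits X n) = n.
Proof. unfold bits. now rewrite cmk_code, clen_code, length_map, length_seq. Qed.
Lemma cnth_cmk n f i : i < n -> cnth i (cmk n f) = f i.
Proof. intros H. now rewrite cmk_code, cnth_code, nth_map_seq. Qed.
Lemma agrees_bits X n : agrees X (bits X n).
Proof.
  intros i Hi. rewrite clen_bits in Hi. unfold bits. rewrite cnth_cmk by auto.
  destruct (X i); reflexivity.
Qed.

Lemma dependent_choice {A : Type} {R : nat -> A -> A -> Prop} (a : A) :
  (forall n x, exists y, R n x y) -> exists f, f 0 = a /\ forall n, R n (f n) (f (S n)).
Proof.
  intros H. set (g := fun n x => proj1_sig (constructive_indefinite_description _ (H n x))).
  exists (nat_rect (fun _ => A) a g). split; auto. intros n. simpl. unfold g at 1.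
  apply proj2_sig.
Qed.

(** A state is a number [n] with a finite part of [X]. A step lengthens the part until a computation
    querying listed bits only settles the requirement [n]. The union of the parts along a run is a
    solution. *)
Theorem pi2_basis d (D : (nat -> bool) -> nat -> nat -> bool) :
  high_for_paths d -> cfb all_oracles (fun X z => D X (pi1 z) (pi2 z)) ->
  (exists X, forall n, exists m, D X n m = true) ->
  forall Y, in_degree d Y ->
  exists X, rcb Y X /\ forall n, exists m, D X n m = true.
Proof.
  intros Hd HD [X0 HX0] Y HY. destruct lookup_exists as [o Ho].
  destruct (semidec _ _ HD) as [c Hc].
  (* The length condition [n < clen s'] keeps the parts growing, so that their union is total. *)
  set (B := fun z k => (pi1 (pi2 z) =? S (pi1 (pi1 z))) &&
    ((pi1 (pi1 z) <? clen (pi2 (pi2 z))) &&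
     ((clen (pi2 (pi1 z)) <=? clen (pi2 (pi2 z))) &&
      (ball (clen (pi2 (pi1 z))) (fun i => cnth i (pi2 (pi1 z)) =? cnth i (pi2 (pi2 z))) &&
     cert (encode (ptrans o c)) (npair (pi2 (pi2 z)) (pi1 (pi1 z))) (pi1 k) (pi2 k))))).
  destruct (edge_index B) as [e He]; [unfold B; csolve|].
  assert (E : forall n s n' s', Edge e (npair n s) (npair n' s') <->
    (n' = S n /\ n < clen s' /\ clen s <= clen s' /\
     (forall i, i < clen s -> cnth i s = cnth i s') /\
     exists m, eval no_oracle (ptrans o c) (npair s' n) m)).
  { intros n s n' s'. rewrite He. unfold B.
    pis. split.
    - intros [k H]. rewrite !andb_true_iff, ball_true in H.
      destruct H as (H1 & H2 & H3 & H4 & H5).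
      apply Nat.eqb_eq in H1. apply Nat.ltb_lt in H2. apply Nat.leb_le in H3.
      repeat split; auto.
      + intros i Hi. now apply Nat.eqb_eq, H4.
      + exists (pi1 k). apply phi_encode, cert_phi. eauto.
    - intros (H1 & H2 & H3 & H4 & m & H5). apply phi_encode, cert_phi in H5 as [t H5].
      exists (npair m t). rewrite pi1_pair, pi2_pair, !andb_true_iff, ball_true.
      apply Nat.eqb_eq in H1. apply Nat.ltb_lt in H2. apply Nat.leb_le in H3.
      repeat split; auto. intros i Hi. now apply Nat.eqb_eq, H4. }
  destruct (Hd e (npair 0 0)) as (f & [F0 F] & Hf).
  (* Prefixes of the given solution, each long enough for the bits used by the next computation,
     form a run. *)
  - assert (G : forall n N, exists N', Edge e (npair n (bits X0 N)) (npair (S n) (bits X0 N'))).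
    { intros n N. destruct (HX0 n) as [m Hm].
      destruct (Hc X0 I n) as [_ Hh]. destruct Hh as [m' Hm']; [eauto|].
      destruct (ptrans_complete o Ho _ _ _ _ Hm') as [N1 HN].
      exists (N1 + S n + N). apply E. rewrite !clen_bits. repeat split; try lia.
      + intros i Hi. unfold bits. now rewrite !cnth_cmk by lia.
      + exists m'. apply HN; [apply agrees_bits|]. rewrite clen_bits. lia. }
    destruct (dependent_choice 0 G) as (N & N0 & HN).
    exists (fun n => npair n (bits X0 (N n))). split; [now rewrite N0|exact HN].
  - apply (degree_rc d Y) in Hf; auto.
    assert (P : forall n, exists s, f n = npair n s).
    { induction n as [|n [s IH]]; [eauto|]. specialize (F n). rewrite IH in F.
      rewrite <- (pair_pi (f (S n))) in F. apply E in F as (F1 & _).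
      exists (pi2 (f (S n))). rewrite <- F1 at 2. now rewrite pair_pi. }
    set (s := fun n => pi2 (f n)).
    assert (Hs : forall n, f n = npair n (s n)).
    { intros n. destruct (P n) as [t Ht]. unfold s. rewrite Ht. now rewrite pi2_pair. }
    assert (F' : forall n, n < clen (s (S n)) /\ clen (s n) <= clen (s (S n)) /\
     (forall i, i < clen (s n) -> cnth i (s n) = cnth i (s (S n))) /\
     exists m, eval no_oracle (ptrans o c) (npair (s (S n)) n) m).
    { intros n. specialize (F n). rewrite !Hs in F. apply E in F as (_ & F). exact F. }
    assert (M : forall n k, n <= k -> clen (s n) <= clen (s k) /\
      forall i, i < clen (s n) -> cnth i (s n) = cnth i (s k)).
    { intros n k L. induction L as [|k L [IH1 IH2]]; auto.
      destruct (F' k) as (_ & L1 & L2 & _). split; [lia|].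
      intros i Hi. rewrite IH2 by auto. apply L2. lia. }
    (* The part reached after [S i] steps is longer than [i], and all later parts agree with it. *)
    exists (fun i => cnth i (s (S i)) =? 1). split.
    + unfold rcb, s. unfold rc in Hf. csolve.
    + intros n. destruct (F' n) as (_ & _ & _ & m & Hm).
      exists m. destruct (Hc (fun i => cnth i (s (S i)) =? 1) I n) as [Hh _].
      apply Hh. apply (ptrans_sound o Ho _ _ _ _ Hm).
      intros i Hi. f_equal.
      destruct (le_lt_dec i n).
      * apply (M (S i) (S n)); [lia|]. apply F'.
      * symmetry. apply (M (S n) (S i)); [lia|auto].
Qed.

(** * Consequences of highness for paths *)

Definition asbool (P : Prop) : bool :=
  if excluded_middle_informative P then true else false.
Lemma asbool_true P : asbool P = true <-> P.
Proof. unfold asbool. destruct excluded_middle_informative; split; auto; discriminate. Qed.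
Lemma asbool_false P : asbool P = false <-> ~ P.
Proof. unfold asbool. destruct excluded_middle_informative; split; auto; try discriminate; tauto. Qed.

Lemma decides_1 X e n P : decides X e n P -> (phi X e n 1 <-> P).
Proof.
  intros [H1 H0]. split; auto. intros H. apply NNPP. intros N.
  specialize (H0 N). pose proof (phi_functional _ _ _ _ _ H H0). discriminate.
Qed.
Lemma decides_0 X e n P : decides X e n P -> (phi X e n 0 <-> ~ P).
Proof.
  intros [H1 H0]. split; auto. intros H N. specialize (H1 N).
  pose proof (phi_functional _ _ _ _ _ H H1). discriminate.
Qed.

Lemma not_wf_sequence {T} (R : T -> T -> Prop) : ~ well_founded R ->
  exists s, forall n, R (s (S n)) (s n).
Proof.
  intros H. unfold well_founded in H. apply not_all_ex_not in H as [x0 H].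
  set (A := {x | ~ Acc R x}).
  assert (S : forall (n : nat) (x : A), exists y : A, R (proj1_sig y) (proj1_sig x)).
  { intros _ [x Hx]. apply NNPP. intros N. apply Hx. constructor. intros y Hy.
    apply NNPP. intros N'. apply N. now exists (exist _ y N'). }
  destruct (dependent_choice (exist _ x0 H : A) S) as (f & _ & Hf).
  exists (fun n => proj1_sig (f n)). exact Hf.
Qed.
Lemma acc_no_sequence {T} (R : T -> T -> Prop) x : Acc R x ->
  forall s : nat -> T, s 0 = x -> ~ forall n, R (s (S n)) (s n).
Proof.
  intros A. induction A as [x _ IH]. intros s E H.
  apply (IH (s 1)) with (s := fun n => s (S n)); auto. rewrite <- E. apply H.
Qed.

(** The state [0] precedes all choices and [S p] says that [p] has been chosen last. *)
Lemma order_edges P e : is_order_index e P -> exists e', forall q q',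
  Edge e' q q' <-> match q' with
                   | 0 => False
                   | S p' => odom P p' /\ match q with
                                          | 0 => True
                                          | S p => odom P p /\ olt P p' p
                                          end
                   end.
Proof.
  intros (u & r & _ & Hu & Hr).
  destruct (edge_index (fun z k => negb (pi2 z =? 0) && (cert u (pred (pi2 z)) 1 (pi1 k) &&
    ((pi1 z =? 0) || (cert u (pred (pi1 z)) 1 (pi1 (pi2 k)) &&
     cert r (npair (pred (pi2 z)) (pred (pi1 z))) 1 (pi2 (pi2 k))))))) as [e' He]; [csolve|].
  exists e'. intros q q'. rewrite He. pis.
  assert (E : forall x, odom P x <-> exists t, cert u x 1 t = true).
  { intros x. rewrite <- cert_phi. symmetry. apply decides_1. auto. }
  assert (E' : forall x y, odom P x -> odom P y -> (olt P x y <-> exists t, cert r (npair x y) 1 t = true)).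
  { intros x y Hx Hy. rewrite <- cert_phi. symmetry. apply decides_1. auto. }
  destruct q' as [|p']; [split; [intros [k H]; discriminate|easy]|]. cbn [Nat.eqb negb pred andb].
  split.
  - intros [k H]. apply andb_true_iff in H as [H1 H2]. assert (odom P p') by (apply E; eauto).
    split; auto. destruct q as [|p]; auto. cbn [Nat.eqb orb pred] in H2.
    apply andb_true_iff in H2 as [H2 H3]. assert (odom P p) by (apply E; eauto).
    split; auto. apply E'; eauto.
  - intros [H1 H2]. pose proof H1 as H1'. apply E in H1' as [t1 H1']. destruct q as [|p].
    + exists (npair t1 0). now rewrite pi1_pair, H1'.
    + destruct H2 as [H2 H3]. apply E' in H3 as [t3 H3]; auto. apply E in H2 as [t2 H2].
      exists (npair t1 (npair t2 t3)). pis.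
      cbn [Nat.eqb pred orb]. now rewrite H1', H2, H3.
Qed.

Theorem high_for_paths_descending d : high_for_paths d -> high_for_descending_sequences d.
Proof.
  intros Hd P [HP [e He]] HW. destruct (order_edges P e He) as [e' E].
  destruct (Hd e' 0) as (f & [F0 F] & Hf).
  - unfold wf_order in HW. apply not_wf_sequence in HW as [s Hs].
    exists (fun n => match n with 0 => 0 | S n => S (s n) end). split; auto.
    intros [|n]; apply E; [specialize (Hs 0)|specialize (Hs n)]; tauto.
  - destruct (degree_nonempty d) as [Y HY]. apply (degree_rc d Y) in Hf; auto.
    assert (G : forall n, exists p, f (S n) = S p).
    { intros n. specialize (F n). apply E in F. destruct (f (S n)); [easy|eauto]. }
    exists (fun n => pred (f (S n))). split.
    + intros n. specialize (F (S n)). apply E in F.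
      destruct (G n) as [p Hp], (G (S n)) as [p' Hp']. rewrite Hp, Hp' in *. cbn [pred]. tauto.
    + apply (rc_degree d Y); auto. unfold rc in *. csolve.
Qed.

(** The arity function is total, so a wrong arity is witnessed by the true value. Conditions on
    symbols of a given arity can thus be met by a witness when the arity is wrong. *)
Lemma arity_mismatch r ar : (forall i, phi no_oracle r i (option_code (ar i))) -> forall i n,
  (exists v t, cert r i v t && negb (v =? S n) = true) <-> ar i <> Some n.
Proof.
  intros Hr i n. split.
  - intros (v & t & H) E. apply andb_true_iff in H as [H1 H2].
    assert (P : phi no_oracle r i v) by (apply cert_phi; eauto).
    rewrite (phi_functional _ _ _ _ _ P (Hr i)), E in H2. simpl in H2.
    now rewrite Nat.eqb_refl in H2.
  - intros E. destruct (proj1 (cert_phi _ _ _) (Hr i)) as [t Ht].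
    exists (option_code (ar i)), t. rewrite Ht. simpl.
    apply negb_true_iff, Nat.eqb_neq. destruct (ar i); simpl; congruence.
Qed.

(** * Isomorphisms as solutions of a [Pi_2] condition *)

Definition related (X : nat -> bool) (l l' : nat) : bool :=
  (clen l =? clen l') && ball (clen l) (fun j => X (npair (cnth j l) (cnth j l'))).
Lemma related_code X l l' : related X (tuple_code l) (tuple_code l') = true <->
  Forall2 (fun x y => X (npair x y) = true) l l'.
Proof.
  unfold related. rewrite andb_true_iff, !clen_code, Nat.eqb_eq, ball_true.
  split.
  - intros [E H]. revert l' E H. induction l; intros [] E H; try discriminate; constructor.
    + specialize (H 0 ltac:(simpl; lia)). now rewrite !cnth_code in H.
    + apply IHl; [now injection E|]. intros i Hi. specialize (H (S i) ltac:(simpl; lia)).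
      rewrite !cnth_code in *. exact H.
  - intros H. split; [eapply Forall2_length; eauto|]. induction H; cbn [length]; [lia|].
    intros [|i] Hi; rewrite !cnth_code; auto.
    specialize (IHForall2 i ltac:(lia)). now rewrite !cnth_code in IHForall2.
Qed.

Theorem high_for_paths_isomorphism d : high_for_paths d -> high_for_isomorphism d.
Proof.
  intros Hd L M N (e1 & eL & u & r & f & -> & (rl & fl & -> & Hrl & Hfl) & Hu & Hr & Hf)
    (e2 & eL' & u' & r' & f' & -> & _ & Hu' & Hr' & Hf') [F HF].
  (* [X] is to be the graph of an isomorphism. By the tag [pi1 z]: 0 and 1 totality and
     surjectivity, 2 containment in the universes, 3 being functional and injective, 4 relations,
     the rest functions. The last two speak of pairs of tuples related by [X], since only the graph
     is available. *)
  set (D := fun (X : nat -> bool) z m => let a := pi2 z in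
    if pi1 z =? 0 then cert u a 0 m || X (npair a m) else
    if pi1 z =? 1 then cert u' a 0 m || X (npair m a) else
    if pi1 z =? 2 then negb (X a) || cert u (pi1 a) 1 (pi1 m) && cert u' (pi2 a) 1 (pi2 m) else
    if pi1 z =? 3 then negb (X (pi1 a)) || negb (X (pi2 a)) ||
       Bool.eqb (pi1 (pi1 a) =? pi1 (pi2 a)) (pi2 (pi1 a) =? pi2 (pi2 a)) else
    let i := pi1 a in let l := pi1 (pi2 a) in let l' := pi2 (pi2 a) in
    let v := pi1 m in let t := pi1 (pi2 m) in let t1 := pi1 (pi2 (pi2 m)) in
    let t2 := pi2 (pi2 (pi2 m)) in
    negb (related X l l') ||
    if pi1 z =? 4 then cert rl i v t && negb (v =? S (clen l)) ||
      cert r (npair i l) 1 t1 && cert r' (npair i l') 1 t2 ||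
      cert r (npair i l) 0 t1 && cert r' (npair i l') 0 t2
    else cert fl i v t && negb (v =? S (clen l)) ||
      cert f (npair i l) (pi1 v) t1 && cert f' (npair i l') (pi2 v) t2 && X v).
  destruct HF as (Fd & Fi & Fs & Fr & Ff).
  assert (HD : cfb all_oracles (fun X z => D X (pi1 z) (pi2 z))).
  { unfold D, related. cbv zeta. csolve. }
  destruct (degree_nonempty d) as [Y HY].
  assert (Du : forall x, phi no_oracle u x 1 <-> dom M x) by (intros; now apply decides_1).
  assert (Du' : forall x, phi no_oracle u' x 1 <-> dom N x) by (intros; now apply decides_1).
  assert (Du0 : forall x, phi no_oracle u x 0 <-> ~ dom M x) by (intros; now apply decides_0).
  assert (Du0' : forall x, phi no_oracle u' x 0 <-> ~ dom N x) by (intros; now apply decides_0).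
  assert (AR : forall i l, (exists v t, cert rl i v t && negb (v =? S (clen (tuple_code l))) = true) <->
     rel_ar L i <> Some (length l)).
  { intros i l. rewrite clen_code. now apply arity_mismatch. }
  assert (AF : forall i l, (exists v t, cert fl i v t && negb (v =? S (clen (tuple_code l))) = true) <->
     fun_ar L i <> Some (length l)).
  { intros i l. rewrite clen_code. now apply arity_mismatch. }
  destruct (pi2_basis d D Hd HD) with (Y := Y) as (X & HX & S); auto.
  - exists (fun p => asbool (dom M (pi1 p) /\ F (pi1 p) = pi2 p)).
    set (X := fun p => asbool (dom M (pi1 p) /\ F (pi1 p) = pi2 p)).
    assert (XT : forall x y, X (npair x y) = true <-> dom M x /\ F x = y).
    { intros. unfold X. now rewrite asbool_true, pi1_pair, pi2_pair. }
    assert (RT : forall l l', related X (tuple_code l) (tuple_code l') = true <->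
       Forall (dom M) l /\ map F l = l').
    { intros l l'. rewrite related_code. split.
      - intros H; induction H as [|x y l l' H H' IH]; [easy|].
        apply XT in H as [H <-]. destruct IH as [IH <-]. auto.
      - intros [H <-]. induction H; simpl; constructor; auto. now apply XT. }
    intros z. unfold D. cbv zeta. set (a := pi2 z). clearbody a. rewrite <- (pair_pi a).
    destruct (pi1 z) as [|[|[|[|n]]]]; cbn [Nat.eqb].
    + rewrite pair_pi. destruct (classic (dom M a)) as [H|H].
      * exists (F a). rewrite (proj2 (XT a (F a))); auto. apply orb_true_r.
      * apply Du0, cert_phi in H as [t H]. exists t. now rewrite H.
    + rewrite pair_pi. destruct (classic (dom N a)) as [H|H].
      * destruct (Fs a H) as [x Hx]. exists x. rewrite (proj2 (XT x a)); auto. apply orb_true_r.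
      * apply Du0', cert_phi in H as [t H]. exists t. now rewrite H.
    + destruct (X (npair (pi1 a) (pi2 a))) eqn:E; [|exists 0; reflexivity].
      apply XT in E as [E1 E2]. pose proof (Fd _ E1) as E3. rewrite E2 in E3.
      apply Du, cert_phi in E1 as [t1 H1]. apply Du', cert_phi in E3 as [t2 H2].
      exists (npair t1 t2). pis. rewrite H1, H2. reflexivity.
    + exists 0. pis.
      rewrite <- (pair_pi (pi1 a)) at 1. rewrite <- (pair_pi (pi2 a)) at 1.
      destruct (X (npair (pi1 (pi1 a)) _)) eqn:E1; [|reflexivity].
      destruct (X (npair (pi1 (pi2 a)) _)) eqn:E2; [|reflexivity].
      apply XT in E1 as [E1 E3], E2 as [E2 E4]. simpl. rewrite <- E3, <- E4.
      apply eqb_true_iff. apply eq_true_iff_eq. rewrite !Nat.eqb_eq.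
      split; [congruence|apply Fi; auto].
    + pis. rewrite <- (pair_pi (pi2 a)). pis.
      generalize (pi1 a) as i.
      destruct (tuple_code_surj (pi1 (pi2 a))) as [l <-].
      destruct (tuple_code_surj (pi2 (pi2 a))) as [l' <-]. intros i.
      destruct (related X _ _) eqn:E; [|exists 0; reflexivity]. cbn [negb orb].
      apply RT in E as [E <-].
      destruct n as [|n]; cbn [Nat.eqb].
      * destruct (classic (rel_ar L i <> Some (length l))) as [A|A].
        -- apply AR in A as (v & t & A). exists (npair v (npair t 0)).
           pis. rewrite A. reflexivity.
        -- apply NNPP in A. pose proof (Hr i l A E) as R1.
           assert (R2 : decides no_oracle r' (npair i (tuple_code (map F l))) (srel N i (map F l))).
           { apply Hr'; [now rewrite length_map|]. apply Forall_map.
             eapply Forall_impl; [|exact E]. exact Fd. }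
           specialize (Fr i l A E). destruct R1 as [R1 R1'], R2 as [R2 R2'].
           destruct (classic (srel M i l)) as [S|S].
           ++ pose proof (R1 S) as T1. apply Fr in S. apply R2, cert_phi in S as [t2 S].
              apply cert_phi in T1 as [t1 T1]. exists (npair 0 (npair 0 (npair t1 t2))).
              pis. rewrite T1, S.
              simpl. now rewrite !orb_true_r.
           ++ pose proof (R1' S) as T1. rewrite Fr in S. apply R2', cert_phi in S as [t2 S].
              apply cert_phi in T1 as [t1 T1]. exists (npair 0 (npair 0 (npair t1 t2))).
              pis. rewrite T1, S.
              simpl. now rewrite !orb_true_r.
      * destruct (classic (fun_ar L i <> Some (length l))) as [A|A].
        -- apply AF in A as (v & t & A). exists (npair v (npair t 0)).
           pis. rewrite A. reflexivity.
        -- apply NNPP in A. pose proof (Hf i l A E) as R1.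
           assert (R2 : phi no_oracle f' (npair i (tuple_code (map F l))) (sfun N i (map F l))).
           { apply Hf'; [now rewrite length_map|]. apply Forall_map.
             eapply Forall_impl; [|exact E]. exact Fd. }
           apply cert_phi in R1 as [t1 R1]. apply cert_phi in R2 as [t2 R2].
           exists (npair (npair (sfun M i l) (sfun N i (map F l))) (npair 0 (npair t1 t2))).
           pis.
           rewrite (proj2 (XT (sfun M i l) (sfun N i (map F l)))).
           { rewrite R1, R2. simpl. now rewrite !orb_true_r. }
           split; [now apply sfun_dom|]. now apply Ff.
  - assert (S0 : forall x, dom M x -> exists y, X (npair x y) = true).
    { intros x Hx. destruct (S (npair 0 x)) as [m H]. unfold D in H. cbv zeta in H.
      rewrite pi1_pair, pi2_pair in H. cbn [Nat.eqb] in H. apply orb_true_iff in H as [H|H]; [|eauto].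
      exfalso. apply (Du0 x); auto. apply cert_phi; eauto. }
    assert (S1 : forall y, dom N y -> exists x, X (npair x y) = true).
    { intros x Hx. destruct (S (npair 1 x)) as [m H]. unfold D in H. cbv zeta in H.
      rewrite pi1_pair, pi2_pair in H. cbn [Nat.eqb] in H. apply orb_true_iff in H as [H|H]; [|eauto].
      exfalso. apply (Du0' x); auto. apply cert_phi; eauto. }
    assert (S2 : forall x y, X (npair x y) = true -> dom M x /\ dom N y).
    { intros x y Hx. destruct (S (npair 2 (npair x y))) as [m H]. unfold D in H. cbv zeta in H.
      pis in H. cbn [Nat.eqb] in H.
      rewrite Hx in H. simpl in H. apply andb_true_iff in H as [H1 H2].
      rewrite <- Du, <- Du', !cert_phi. eauto. }
    assert (S3 : forall x y x' y', X (npair x y) = true -> X (npair x' y') = true -> (x = x' <-> y = y')).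
    { intros x y x' y' H1 H2. destruct (S (npair 3 (npair (npair x y) (npair x' y')))) as [m H].
      unfold D in H. cbv zeta in H.
      pis in H. cbn [Nat.eqb] in H.
      rewrite H1, H2 in H. cbn [negb orb] in H. apply eqb_prop in H.
      rewrite <- (Nat.eqb_eq x x'), <- (Nat.eqb_eq y y'), H. tauto. }
    (* The graph is decidable in [Y], so values are found by search. The search diverges outside the
       universe of [M], where [G] is 0 by default. *)
    assert (HX' : cfb (eq Y) (fun _ z => X (npair (pi1 z) (pi2 z)))) by csolve.
    destruct (semidec (eq Y) (fun _ x y => X (npair x y)) HX') as [c Hc]. specialize (Hc Y eq_refl).
    set (G := fun x => match excluded_middle_informative (exists y, eval Y c x y) with
              | left H => proj1_sig (constructive_indefinite_description _ H) | right _ => 0 end).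
    assert (HG : forall x, dom M x -> eval Y c x (G x)).
    { intros x Hx. unfold G. destruct excluded_middle_informative as [H|H].
      - apply proj2_sig.
      - exfalso. apply H. apply Hc. auto. }
    assert (XG : forall x, dom M x -> X (npair x (G x)) = true).
    { intros x Hx. apply Hc. auto. }
    assert (RG : forall l, Forall (dom M) l -> related X (tuple_code l) (tuple_code (map G l)) = true).
    { intros l H. apply related_code. induction H; simpl; constructor; auto. }
    assert (GD : forall x, dom M x -> dom N (G x)) by (intros x Hx; now apply (S2 x), XG).
    exists G. split; [|exists Y, (encode c); split; auto; intros x Hx; apply phi_encode; auto].
    split; [auto|]. split; [|split; [|split]].
    + intros x y Hx Hy E. apply (S3 x (G x) y (G y)); auto.
    + intros y Hy. destruct (S1 y Hy) as [x Hx]. exists x. pose proof (S2 _ _ Hx) as [Dx _].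
      split; auto. apply (S3 x (G x) x y); auto.
    + intros i l A E. destruct (S (npair 4 (npair i (npair (tuple_code l) (tuple_code (map G l)))))) as [m H].
      unfold D in H. cbv zeta in H.
      pis in H. cbn [Nat.eqb] in H.
      rewrite (RG l E) in H. cbn [negb orb] in H.
      assert (E' : Forall (dom N) (map G l)).
      { apply Forall_map. eapply Forall_impl; [|exact E]. exact GD. }
      pose proof (Hr i l A E) as R1.
      assert (A' : rel_ar L i = Some (length (map G l))) by now rewrite length_map.
      pose proof (Hr' i _ A' E') as R2.
      rewrite !orb_true_iff in H. destruct H as [[H|H]|H].
      * exfalso. apply (proj1 (AR i l)); auto. eauto.
      * apply andb_true_iff in H as [H1 H2].
        assert (phi no_oracle r (npair i (tuple_code l)) 1) by (apply cert_phi; eauto).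
        assert (phi no_oracle r' (npair i (tuple_code (map G l))) 1) by (apply cert_phi; eauto).
        rewrite (decides_1 _ _ _ _ R1) in *. rewrite (decides_1 _ _ _ _ R2) in *. tauto.
      * apply andb_true_iff in H as [H1 H2].
        assert (phi no_oracle r (npair i (tuple_code l)) 0) by (apply cert_phi; eauto).
        assert (phi no_oracle r' (npair i (tuple_code (map G l))) 0) by (apply cert_phi; eauto).
        rewrite (decides_0 _ _ _ _ R1) in *. rewrite (decides_0 _ _ _ _ R2) in *. tauto.
    + intros i l A E. destruct (S (npair 5 (npair i (npair (tuple_code l) (tuple_code (map G l)))))) as [m H].
      unfold D in H. cbv zeta in H.
      pis in H. cbn [Nat.eqb] in H.
      rewrite (RG l E) in H. cbn [negb orb] in H.
      assert (E' : Forall (dom N) (map G l)).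
      { apply Forall_map. eapply Forall_impl; [|exact E]. exact GD. }
      pose proof (Hf i l A E) as R1.
      assert (A' : fun_ar L i = Some (length (map G l))) by now rewrite length_map.
      pose proof (Hf' i _ A' E') as R2.
      apply orb_true_iff in H as [H|H].
      * exfalso. apply (proj1 (AF i l)); auto. eauto.
      * rewrite !andb_true_iff in H. destruct H as [[H1 H2] H3].
        assert (P1 : phi no_oracle f (npair i (tuple_code l)) (pi1 (pi1 m))) by (apply cert_phi; eauto).
        assert (P2 : phi no_oracle f' (npair i (tuple_code (map G l))) (pi2 (pi1 m))) by (apply cert_phi; eauto).
        rewrite <- (pair_pi (pi1 m)), (phi_functional _ _ _ _ _ P1 R1), (phi_functional _ _ _ _ _ P2 R2) in H3.
        assert (Dm : dom M (sfun M i l)) by now apply sfun_dom.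
        apply (S3 (sfun M i l) (G (sfun M i l)) (sfun M i l) (sfun N i (map G l))); auto.
Qed.

(** * Back-and-forth relations as fixed points *)

Section BackAndForthExists.
Variables (least : nat -> Prop) (lt : nat -> nat -> Prop).
Variables (base : nat -> nat -> Prop) (ok : nat -> Prop) (app : nat -> nat -> nat).
Hypothesis ok_exists : exists d, ok d.

(** A point that counts as least has no predecessors here, whatever [lt] says. The data come from
    arbitrary indices, and even then such a point must be accessible. *)
Let R (y p : nat) : Prop := ~ least p /\ lt y p.

Fixpoint bf_acc (p : nat) (acc : Acc R p) (a1 a2 : nat) : Prop :=
  (least p /\ base a1 a2) \/
  (~ least p /\ forall d y (h : R y p), ok d ->
     exists c, ok c /\ bf_acc y (Acc_inv acc h) (app a2 d) (app a1 c)).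

(** The relation is the intended one on the accessible part of the order and empty
    elsewhere: an inaccessible [p] has an inaccessible [y] below it. *)
Lemma bf_exists : exists BF : nat -> nat -> nat -> Prop, forall a1 a2 p,
  (least p -> (BF a1 a2 p <-> base a1 a2)) /\
  (~ least p -> (BF a1 a2 p <-> forall d y, ok d -> lt y p ->
     exists c, ok c /\ BF (app a2 d) (app a1 c) y)).
Proof.
  exists (fun a1 a2 p => exists acc : Acc R p, bf_acc p acc a1 a2).
  intros a1 a2 p. split; intros Hp.
  - split.
    + intros [acc H]. destruct acc; simpl in H. tauto.
    + intros H. assert (acc : Acc R p) by (constructor; intros y [Hy _]; tauto).
      exists acc. destruct acc; simpl. auto.
  - split.
    + intros [acc H] d y Hd Hy. assert (h : R y p) by (split; auto).
      destruct acc as [acc]; simpl in H. destruct H as [[H _]|[_ H]]; [tauto|].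
      destruct (H d y h Hd) as (c & Hc & Hb). eauto.
    (* A point satisfying clause (2) is accessible: the answer to an arbitrary [d] at [y] carries an
       accessibility proof of [y]. *)
    + intros H. assert (acc : Acc R p).
      { constructor. intros y [_ Hy]. destruct ok_exists as [d Hd].
        destruct (H d y Hd Hy) as (c & _ & acc & _). exact acc. }
      exists acc. destruct acc as [acc]; simpl. right. split; auto.
      intros d y h Hd. destruct (H d y Hd (proj2 h)) as (c & Hc & acc' & Hb).
      exists c. split; auto. now rewrite (proof_irrelevance _ (acc y h) acc').
Qed.
End BackAndForthExists.

(** Bits of a back-and-forth system on the structure and the order with indices
    [pi1 k] and [pi2 k], with the following tags; [x] is meant to satisfy
    [x z = true <-> exists n, bf_op k x z n = true].
    0: [a] is in the universe; 1, 2: arities; 3: relations; 4: graphs of functions;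
    5, 6: universe and relation of the order; 7: some tuple [n] makes [a1 ++ n] and
    [a2 ++ c2] agree on the first [q] atomic facts; 8: [a1 <=_1 a2] fails for tuples
    of equal length; 9: [a] is not least; 10: some [n] satisfies [b <=_y a1 ++ n];
    11: clause (2) fails for [a1 <=_p a2]. *)
Definition bf_sel (w l : nat) : nat := cmk (clen l) (fun a => cnth (cnth a l) w).
Definition bf_inb (w l : nat) : bool := ball (clen l) (fun a => cnth a l <? clen w).
(** The atomic fact number [q] about the entries of [w]: relation [i] at the positions [l], function
    [i] at the positions [l] with its value at position [j], or equality of two positions. Facts are
    unnested, and positions out of range make them false. *)
Definition bf_at (x : nat -> bool) (w q : nat) : bool :=
  let i := pi1 (pi2 q) in let l := pi1 (pi2 (pi2 q)) in let j := pi2 (pi2 (pi2 q)) in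
  if pi1 q =? 0 then
    bf_inb w l && (x (npair 1 (npair i (clen l))) && x (npair 3 (npair i (bf_sel w l))))
  else if pi1 q =? 1 then
    bf_inb w l && ((j <? clen w) && (x (npair 2 (npair i (clen l))) &&
      x (npair 4 (npair (npair i (bf_sel w l)) (cnth j w)))))
  else (i <? clen w) && ((j <? clen w) && (cnth i w =? cnth j w)).
Definition bf_agree (x : nat -> bool) (w1 w2 q : nat) : bool :=
  ball q (fun p => Bool.eqb (bf_at x w1 p) (bf_at x w2 p)).
Definition bf_dom (x : nat -> bool) (l : nat) : bool :=
  ball (clen l) (fun i => x (npair 0 (cnth i l))).
Definition bf_base (x : nat -> bool) (a1 a2 : nat) : bool :=
  (clen a1 =? clen a2) && negb (x (npair 8 (npair a1 a2))).
Definition bf_rel (x : nat -> bool) (a1 a2 p : nat) : bool :=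
  if x (npair 9 p) then negb (x (npair 11 (npair a1 (npair a2 p))))
  else bf_base x a1 a2.
Definition bf_op (k : nat) (x : nat -> bool) (z n : nat) : bool :=
  let a := pi2 z in let t := pi1 z in
  let eL := pi1 (pi1 k) in let rest := pi2 (pi1 k) in
  if t =? 0 then cert (pi1 rest) a 1 n else
  if t =? 1 then cert (pi1 eL) (pi1 a) (S (pi2 a)) n else
  if t =? 2 then cert (pi2 eL) (pi1 a) (S (pi2 a)) n else
  if t =? 3 then cert (pi1 (pi2 rest)) a 1 n else
  if t =? 4 then cert (pi2 (pi2 rest)) (pi1 a) (pi2 a) n else
  if t =? 5 then cert (pi1 (pi2 k)) a 1 n else
  if t =? 6 then cert (pi2 (pi2 k)) a 1 n else
  if t =? 7 then
    let c2 := pi1 (pi2 (pi2 a)) in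
    bf_dom x n && ((clen n =? clen c2) &&
      bf_agree x (capp (pi1 a) n) (capp (pi1 (pi2 a)) c2) (pi2 (pi2 (pi2 a))))
  else if t =? 8 then
    bf_dom x (pi1 n) &&
    negb (x (npair 7 (npair (pi1 a) (npair (pi2 a) (npair (pi1 n) (pi2 n))))))
  else if t =? 9 then
    x (npair 5 n) && negb ((n =? a) || x (npair 6 (npair a n)))
  else if t =? 10 then
    bf_dom x n && bf_rel x (pi1 a) (capp (pi1 (pi2 a)) n) (pi2 (pi2 a))
  else if t =? 11 then
    bf_dom x (pi1 n) && (x (npair 5 (pi2 n)) && (x (npair 6 (npair (pi2 n) (pi2 (pi2 a)))) &&
      negb (x (npair 10 (npair (capp (pi1 (pi2 a)) (pi1 n)) (npair (pi1 a) (pi2 n)))))))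
  else false.

Definition bf_fixed (k : nat) (x : nat -> bool) : Prop :=
  forall z, x z = true <-> exists n, bf_op k x z n = true.

Lemma ball_ext k f g : (forall i, f i = g i) -> ball k f = ball k g.
Proof. intros H. induction k; simpl; auto. now rewrite H, IHk. Qed.

(** Tags up to 9 are stratified, each referring to smaller ones only; 10 and 11 refer to each other
    and need a different argument. *)
Lemma bf_op_ext k x y z n : pi1 z <= 9 ->
  (forall t a, t < pi1 z -> x (npair t a) = y (npair t a)) -> bf_op k x z n = bf_op k y z n.
Proof.
  intros Hz H. unfold bf_op. cbv zeta.
  assert (Hd : 0 < pi1 z -> forall l, bf_dom x l = bf_dom y l).
  { intros. unfold bf_dom. apply ball_ext. intros. now apply H. }
  assert (Ha : 4 < pi1 z -> forall w1 w2 q, bf_agree x w1 w2 q = bf_agree y w1 w2 q).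
  { intros. unfold bf_agree, bf_at. apply ball_ext. intros. cbv zeta.
    rewrite !(H 1), !(H 2), !(H 3), !(H 4) by lia. reflexivity. }
  destruct (pi1 z) as [|[|[|[|[|[|[|[|[|[|]]]]]]]]]]; cbn [Nat.eqb]; auto.
  - now rewrite Hd, Ha by lia.
  - now rewrite Hd, H by lia.
  - now rewrite !H by lia.
  - lia.
Qed.

Lemma bf_fixed_exists k : exists x, bf_fixed k x.
Proof.
  (* Stage [i] has settled the tags below [i], so ten stages settle the tags 0 to 9. *)
  set (Y := nat_rect (fun _ => nat -> bool) (fun _ => false) (fun i y z =>
     if pi1 z =? i then asbool (exists n, bf_op k y z n = true) else y z)).
  assert (YS : forall i z, Y (S i) z = if pi1 z =? i then asbool (exists n, bf_op k (Y i) z n = true) else Y i z)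
    by reflexivity.
  assert (YM : forall i j, i <= j -> forall z, pi1 z < i -> Y i z = Y j z).
  { intros i j L z Hz. induction L; auto. rewrite YS.
    destruct (Nat.eqb_spec (pi1 z) m); [lia|auto]. }
  assert (YF : forall z, pi1 z <= 9 -> (Y 10 z = true <-> exists n, bf_op k (Y 10) z n = true)).
  { intros z Hz. rewrite <- (YM (S (pi1 z)) 10) by lia. rewrite YS, Nat.eqb_refl, asbool_true.
    split; intros [n Hn]; exists n; rewrite <- Hn; [symmetry|]; apply bf_op_ext; auto;
      intros t a Ht; apply YM; try lia; now rewrite pi1_pair. }
  set (y := Y 10) in *. clearbody y. clear YS YM Y.
  (* Tags 10 and 11 together unfold into clause (2), which recurs along what the index presents as
     an order. *)
  destruct (bf_exists (fun p => y (npair 9 p) = false)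
    (fun q p => y (npair 5 q) = true /\ y (npair 6 (npair q p)) = true)
    (fun a1 a2 => bf_base y a1 a2 = true) (fun d => bf_dom y d = true) capp) as [BF HBF].
  { exists 0. reflexivity. }
  set (x10 := fun a => exists n, bf_dom y n = true /\
     BF (pi1 a) (capp (pi1 (pi2 a)) n) (pi2 (pi2 a))).
  set (x11 := fun a => exists n, bf_dom y (pi1 n) = true /\ y (npair 5 (pi2 n)) = true /\
     y (npair 6 (npair (pi2 n) (pi2 (pi2 a)))) = true /\
     ~ x10 (npair (capp (pi1 (pi2 a)) (pi1 n)) (npair (pi1 a) (pi2 n)))).
  set (x := fun z => if pi1 z <=? 9 then y z else
     if pi1 z =? 10 then asbool (x10 (pi2 z)) else
     if pi1 z =? 11 then asbool (x11 (pi2 z)) else false).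
  exists x. assert (XY : forall t a, t <= 9 -> x (npair t a) = y (npair t a)).
  { intros t a Ht. unfold x. rewrite pi1_pair. apply Nat.leb_le in Ht. now rewrite Ht. }
  assert (X10 : forall a, x (npair 10 a) = asbool (x10 a)).
  { intros. unfold x. rewrite pi1_pair, pi2_pair. reflexivity. }
  assert (X11 : forall a, x (npair 11 a) = asbool (x11 a)).
  { intros. unfold x. rewrite pi1_pair, pi2_pair. reflexivity. }
  assert (XD : forall l, bf_dom x l = bf_dom y l).
  { intros. unfold bf_dom. apply ball_ext. intros. apply XY. lia. }
  assert (XB : forall a1 a2 p, bf_rel x a1 a2 p = true <-> BF a1 a2 p).
  { intros a1 a2 p. destruct (HBF a1 a2 p) as [H1 H2]. unfold bf_rel.
    rewrite XY by lia. destruct (y (npair 9 p)).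
    - rewrite H2 by discriminate. rewrite X11, negb_true_iff, asbool_false.
      unfold x11. pis. split.
      + intros N d q Hd [Hq Hl]. apply NNPP. intros N'. apply N. exists (npair d q).
        pis. repeat split; auto. unfold x10.
        pis. intros (c & Hc & Hb). eauto.
      + intros H (n & Hd & Hq & Hl & N). apply N.
        destruct (H (pi1 n) (pi2 n) Hd (conj Hq Hl)) as (c & Hc & Hb).
        exists c. pis. auto.
    - rewrite H1 by reflexivity. unfold bf_base. now rewrite XY by lia. }
  intros z. destruct (le_lt_dec (pi1 z) 9) as [Hz|Hz].
  - unfold x at 1. rewrite (proj2 (Nat.leb_le _ _) Hz). rewrite (YF z Hz).
    split; intros [n Hn]; exists n; rewrite <- Hn; [|symmetry]; apply bf_op_ext; auto;
      intros; apply XY; lia.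
  - unfold x at 1. rewrite (proj2 (Nat.leb_gt _ _) Hz). unfold bf_op. cbv zeta.
    destruct (Nat.eqb_spec (pi1 z) 10) as [->|E10]; [|destruct (Nat.eqb_spec (pi1 z) 11) as [->|E11]].
    + rewrite asbool_true. cbn [Nat.eqb]. unfold x10.
      split; intros [n Hn]; exists n; rewrite andb_true_iff, XD, XB in *; auto.
    + rewrite asbool_true. cbn [Nat.eqb]. unfold x11.
      split; intros [n Hn]; exists n; rewrite !andb_true_iff, XD, !XY, X10, negb_true_iff, asbool_false in * by lia; auto.
    + split; [discriminate|]. intros [n Hn].
      destruct (pi1 z) as [|[|[|[|[|[|[|[|[|[|[|[|]]]]]]]]]]]]; try lia. discriminate.
Qed.

(** * Finitary [Sigma_1] formulas and agreement on atomic facts *)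

Lemma term_nested_ind (P : term -> Prop) :
  (forall k, P (Var k)) -> (forall f ts, Forall P ts -> P (App f ts)) -> forall t, P t.
Proof.
  intros HV HA. fix IH 1. intros [k|f ts]; [apply HV|]. apply HA.
  induction ts as [|t ts IHts]; constructor; auto.
Qed.

Lemma wf_term_args L n ts :
  fold_right and True (map (wf_term L n) ts) <-> Forall (wf_term L n) ts.
Proof.
  induction ts; simpl; [split; auto|]. rewrite IHts. split; [intros []; auto|].
  intros H; inversion H; auto.
Qed.

Lemma eq_iff_true (a b : bool) : a = b -> (a = true <-> b = true).
Proof. now intros ->. Qed.

Section Atomic.
Context {L : language} (A : structure L).

Lemma term_val_app n t : wf_term L n t -> forall v e, n <= length v ->
  term_val A (v ++ e) t = term_val A v t.
Proof.
  intros W v e Hn. revert W. induction t as [k|f ts IH] using term_nested_ind; intros W; simpl in *.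
  - apply app_nth1. lia.
  - destruct W as [_ W]. apply wf_term_args in W. f_equal.
    apply map_ext_in. intros t Ht. rewrite Forall_forall in IH, W. auto.
Qed.
Lemma qf_sat_app n p : wf_qf L n p -> forall v e, n <= length v ->
  (qf_sat A (v ++ e) p <-> qf_sat A v p).
Proof.
  intros W v e Hn. induction p; simpl in *; try tauto.
  - destruct W. now rewrite !(term_val_app n) by auto.
  - destruct W as [_ W]. assert (E : map (term_val A (v ++ e)) ts = map (term_val A v) ts).
    { apply map_ext_in. intros t Ht. rewrite Forall_forall in W. apply (term_val_app n); auto. }
    now rewrite E.
Qed.
Lemma term_val_dom n t : wf_term L n t -> forall v, n <= length v -> Forall (dom A) v ->
  dom A (term_val A v t).
Proof.
  intros W v Hn Hv. revert W. induction t as [k|f ts IH] using term_nested_ind; intros W; simpl in *.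
  - rewrite Forall_forall in Hv. apply Hv, nth_In. lia.
  - destruct W as [E W]. apply wf_term_args in W. apply sfun_dom; [now rewrite length_map|].
    apply Forall_map. rewrite Forall_forall in *. auto.
Qed.

Variables (k : nat) (x : nat -> bool).
Hypothesis Hx : bf_fixed k x.
Hypothesis HA : is_structure_index (pi1 k) L A.

Lemma tag_dom a : x (npair 0 a) = true <-> dom A a.
Proof.
  destruct HA as (eL & u & r & f & Ek & HL & Hu & _).
  rewrite (Hx (npair 0 a)). unfold bf_op. cbv zeta. rewrite Ek.
  pis. cbn [Nat.eqb]. rewrite <- cert_phi.
  apply decides_1. auto.
Qed.
Lemma tag_rel_ar i v : x (npair 1 (npair i v)) = true <-> rel_ar L i = Some v.
Proof.
  destruct HA as (eL & u & r & f & Ek & (rl & fl & -> & Hr & Hf) & _).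
  rewrite (Hx (npair 1 _)). unfold bf_op. cbv zeta. rewrite Ek.
  pis. cbn [Nat.eqb]. rewrite <- cert_phi.
  split.
  - intros H. pose proof (phi_functional _ _ _ _ _ H (Hr i)) as E.
    destruct (rel_ar L i); simpl in E; congruence.
  - intros H. specialize (Hr i). now rewrite H in Hr.
Qed.
Lemma tag_fun_ar i v : x (npair 2 (npair i v)) = true <-> fun_ar L i = Some v.
Proof.
  destruct HA as (eL & u & r & f & Ek & (rl & fl & -> & Hr & Hf) & _).
  rewrite (Hx (npair 2 _)). unfold bf_op. cbv zeta. rewrite Ek.
  pis. cbn [Nat.eqb]. rewrite <- cert_phi.
  split.
  - intros H. pose proof (phi_functional _ _ _ _ _ H (Hf i)) as E.
    destruct (fun_ar L i); simpl in E; congruence.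
  - intros H. specialize (Hf i). now rewrite H in Hf.
Qed.
Lemma tag_srel i l : rel_ar L i = Some (length l) -> Forall (dom A) l ->
  (x (npair 3 (npair i (tuple_code l))) = true <-> srel A i l).
Proof.
  intros E Hl. destruct HA as (eL & u & r & f & Ek & _ & _ & Hr & _).
  rewrite (Hx (npair 3 _)). unfold bf_op. cbv zeta. rewrite Ek.
  pis. cbn [Nat.eqb]. rewrite <- cert_phi.
  apply decides_1. auto.
Qed.
Lemma tag_sfun i l z : fun_ar L i = Some (length l) -> Forall (dom A) l ->
  (x (npair 4 (npair (npair i (tuple_code l)) z)) = true <-> sfun A i l = z).
Proof.
  intros E Hl. destruct HA as (eL & u & r & f & Ek & _ & _ & _ & Hf).
  rewrite (Hx (npair 4 _)). unfold bf_op. cbv zeta. rewrite Ek.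
  pis. cbn [Nat.eqb]. rewrite <- cert_phi.
  specialize (Hf i l E Hl). split; [intros H; eapply phi_functional; eauto|now intros <-].
Qed.
Lemma bf_dom_code l : bf_dom x (tuple_code l) = true <-> Forall (dom A) l.
Proof.
  unfold bf_dom. rewrite ball_true, clen_code, Forall_nth. split.
  - intros H i d Hi. specialize (H i Hi). rewrite tag_dom, cnth_code in H.
    now rewrite (nth_indep _ d 0) by auto.
  - intros H i Hi. rewrite tag_dom, cnth_code. auto.
Qed.

Definition pick (w l : list nat) : list nat := map (fun a => nth a w 0) l.
Lemma bf_sel_code w l : bf_sel (tuple_code w) (tuple_code l) = tuple_code (pick w l).
Proof.
  unfold bf_sel, pick. rewrite cmk_code, clen_code. f_equal.
  apply nth_ext with (d := 0) (d' := 0); [now rewrite !length_map, length_seq|].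
  intros i Hi. rewrite length_map, length_seq in Hi. rewrite nth_map_seq by auto.
  rewrite !cnth_code. symmetry. rewrite (nth_indep _ 0 (nth 0 w 0)) by now rewrite length_map.
  now rewrite (map_nth (fun a => nth a w 0)).
Qed.
Lemma bf_inb_code w l : bf_inb (tuple_code w) (tuple_code l) = true <->
  Forall (fun a => a < length w) l.
Proof.
  unfold bf_inb. rewrite ball_true, !clen_code, Forall_nth. split.
  - intros H i d Hi. specialize (H i Hi). rewrite Nat.ltb_lt, cnth_code in H.
    now rewrite (nth_indep _ d 0) by auto.
  - intros H i Hi. rewrite Nat.ltb_lt, cnth_code. auto.
Qed.
Lemma pick_dom w l : Forall (dom A) w -> Forall (fun a => a < length w) l ->
  Forall (dom A) (pick w l).
Proof.
  intros Hw H. apply Forall_map. rewrite Forall_forall in *. intros a Ha. apply Hw, nth_In. auto.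
Qed.

Lemma bf_at_rel w i l : Forall (dom A) w ->
  (forall j, bf_at x (tuple_code w) (npair 0 (npair i (npair (tuple_code l) j))) = true <->
   Forall (fun a => a < length w) l /\ rel_ar L i = Some (length l) /\ srel A i (pick w l)).
Proof.
  intros Hw j. unfold bf_at. cbv zeta. pis.
  cbn [Nat.eqb]. rewrite !andb_true_iff, bf_inb_code, clen_code, tag_rel_ar, bf_sel_code.
  split; intros (H1 & H2 & H3); repeat split; auto;
    (apply tag_srel in H3 || apply tag_srel); auto using pick_dom; unfold pick; now rewrite length_map.
Qed.
Lemma bf_at_fun w i l j : Forall (dom A) w ->
  (bf_at x (tuple_code w) (npair 1 (npair i (npair (tuple_code l) j))) = true <->
   Forall (fun a => a < length w) l /\ j < length w /\ fun_ar L i = Some (length l) /\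
   sfun A i (pick w l) = nth j w 0).
Proof.
  intros Hw. unfold bf_at. cbv zeta. pis.
  cbn [Nat.eqb].
  rewrite !andb_true_iff, bf_inb_code, !clen_code, tag_fun_ar, bf_sel_code, cnth_code, Nat.ltb_lt.
  split; intros (H1 & H2 & H3 & H4); repeat split; auto;
    (apply tag_sfun in H4 || apply tag_sfun); auto using pick_dom; unfold pick; now rewrite length_map.
Qed.
Lemma bf_at_eq w t i l j : 2 <= t ->
  (bf_at x (tuple_code w) (npair t (npair i (npair l j))) = true <->
   i < length w /\ j < length w /\ nth i w 0 = nth j w 0).
Proof.
  intros Ht. unfold bf_at. cbv zeta. pis.
  destruct t as [|[|t]]; try lia. cbn [Nat.eqb].
  rewrite !andb_true_iff, !clen_code, !cnth_code, !Nat.ltb_lt, Nat.eqb_eq. tauto.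
Qed.

Lemma term_val_pick w l : map (term_val A w) (map Var l) = pick w l.
Proof. rewrite map_map. reflexivity. Qed.
Lemma wf_vars n l : Forall (fun a => a < n) l -> Forall (wf_term L n) (map Var l).
Proof. intros H. apply Forall_map. exact H. Qed.

(** Once the length of the tuple is fixed, an ill-formed fact, with a wrong arity or a position out
    of range, is false of every tuple and corresponds to [Bot]. *)
Lemma atomic_formula n q : exists p, wf_qf L n p /\ forall w, Forall (dom A) w -> length w = n ->
  (qf_sat A w p <-> bf_at x (tuple_code w) q = true).
Proof.
  rewrite <- (pair_pi q), <- (pair_pi (pi2 q)), <- (pair_pi (pi2 (pi2 q))).
  destruct (tuple_code_surj (pi1 (pi2 (pi2 q)))) as [l <-].
  generalize (pi2 (pi2 (pi2 q))) as j, (pi1 (pi2 q)) as i, (pi1 q) as t. intros j i t.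
  assert (Bad : (forall w, Forall (dom A) w -> length w = n -> bf_at x (tuple_code w)
    (npair t (npair i (npair (tuple_code l) j))) <> true) -> exists p, wf_qf L n p /\ forall w, Forall (dom A) w -> length w = n ->
    (qf_sat A w p <-> bf_at x (tuple_code w) (npair t (npair i (npair (tuple_code l) j))) = true)).
  { intros H. exists Bot. split; [exact I|]. intros w Hw Hn. specialize (H w Hw Hn). simpl. tauto. }
  destruct t as [|[|t]].
  - destruct (classic (Forall (fun a => a < n) l /\ rel_ar L i = Some (length l))) as [[H1 H2]|N].
    + exists (Rel i (map Var l)). split; [split; [now rewrite length_map|now apply wf_vars]|].
      intros w Hw Hn. rewrite bf_at_rel by auto. simpl. rewrite term_val_pick, Hn. tauto.
    + apply Bad. intros w Hw Hn. rewrite bf_at_rel by auto. rewrite Hn. tauto.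
  - destruct (classic (Forall (fun a => a < n) l /\ j < n /\ fun_ar L i = Some (length l))) as [(H1 & H2 & H3)|N].
    + exists (Eq (App i (map Var l)) (Var j)). split.
      { simpl. rewrite length_map, wf_term_args. auto using wf_vars. }
      intros w Hw Hn. rewrite bf_at_fun by auto. simpl. rewrite term_val_pick, Hn. tauto.
    + apply Bad. intros w Hw Hn. rewrite bf_at_fun by auto. rewrite Hn. tauto.
  - destruct (classic (i < n /\ j < n)) as [[H1 H2]|N].
    + exists (Eq (Var i) (Var j)). split; [split; auto|].
      intros w Hw Hn. rewrite bf_at_eq by lia. simpl. rewrite Hn. tauto.
    + apply Bad. intros w Hw Hn. rewrite bf_at_eq by lia. rewrite Hn. tauto.
Qed.

(** With [w2] fixed, agreement prescribes finitely many truth values, hence is a conjunction of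
    atomic formulas and negations of such. *)
Lemma agree_formula K n w2 : exists p, wf_qf L n p /\
  forall w1, Forall (dom A) w1 -> length w1 = n ->
  (qf_sat A w1 p <-> bf_agree x (tuple_code w1) w2 K = true).
Proof.
  unfold bf_agree. induction K as [|K (p & Wp & Hp)].
  - exists (Not Bot). split; [exact I|]. simpl. tauto.
  - destruct (atomic_formula n K) as (q & Wq & Hq).
    destruct (bf_at x w2 K) eqn:E.
    + exists (And q p). split; [split; auto|]. intros w1 H1 H2. simpl.
      rewrite andb_true_iff, Hp, Hq, E by auto. destruct (bf_at x (tuple_code w1) K); simpl; intuition congruence.
    + exists (And (Not q) p). split; [split; auto|]. intros w1 H1 H2. simpl.
      rewrite andb_true_iff, Hp, Hq, E by auto. destruct (bf_at x (tuple_code w1) K); simpl; intuition congruence.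
Qed.

(** For a formula [Phi], the list [e2] consists of the values of its subterms. *)
Definition tracks (v2 e2 : list nat) (K : nat) (Phi : list nat -> Prop) : Prop :=
  Forall (dom A) e2 /\
  forall w1 x1 x2, length w1 = length (v2 ++ e2) ->
    Forall (dom A) (w1 ++ x1) -> Forall (dom A) ((v2 ++ e2) ++ x2) ->
    bf_agree x (tuple_code (w1 ++ x1)) (tuple_code ((v2 ++ e2) ++ x2)) K = true -> Phi w1.

Lemma agree_mono w1 w2 K K' : K <= K' -> bf_agree x w1 w2 K' = true -> bf_agree x w1 w2 K = true.
Proof. unfold bf_agree. rewrite !ball_true. intros H H' i Hi. apply H'. lia. Qed.

(** Subterms are treated one after another, each lengthening the tuple; a property obtained earlier
    then speaks of an initial segment. *)
Lemma tracks_app v2 e e' K K' Phi Psi :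
  tracks v2 e K Phi -> tracks (v2 ++ e) e' K' Psi ->
  tracks v2 (e ++ e') (K + K') (fun w => Phi (firstn (length (v2 ++ e)) w) /\ Psi w).
Proof.
  intros [D1 T1] [D2 T2]. split; [now apply Forall_app|].
  intros w1 x1 x2 Hl H1 H2 H. rewrite app_assoc in *. split.
  - rewrite <- (firstn_skipn (length (v2 ++ e)) w1) in H1, H.
    rewrite <- app_assoc in H1, H. rewrite <- app_assoc in H2, H.
    eapply T1; [| exact H1 | exact H2 | eapply agree_mono; [|exact H]; lia].
    rewrite length_firstn. rewrite length_app in Hl. lia.
  - eapply T2; [exact Hl|exact H1|exact H2|eapply agree_mono; [|exact H]; lia].
Qed.
Lemma tracks_impl v e K (Phi Psi : list nat -> Prop) :
  (forall w, length w = length (v ++ e) -> Forall (dom A) w -> Phi w -> Psi w) ->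
  tracks v e K Phi -> tracks v e K Psi.
Proof.
  intros H [D T]. split; auto. intros w1 x1 x2 Hl H1 H2 H3. apply H; eauto.
  now apply Forall_app in H1.
Qed.

Lemma term_val_firstn n t m w : wf_term L n t -> n <= m -> m <= length w ->
  term_val A (firstn m w) t = term_val A w t.
Proof.
  intros W H1 H2. rewrite <- (firstn_skipn m w) at 2. symmetry. apply (term_val_app n); auto.
  rewrite length_firstn. lia.
Qed.
Lemma qf_sat_firstn n t m w : wf_qf L n t -> n <= m -> m <= length w ->
  (qf_sat A (firstn m w) t <-> qf_sat A w t).
Proof.
  intros W H1 H2. rewrite <- (firstn_skipn m w) at 2. symmetry. apply (qf_sat_app n); auto.
  rewrite length_firstn. lia.
Qed.
Lemma nth_firstn_lt m (w : list nat) j : j < m -> nth j (firstn m w) 0 = nth j w 0.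
Proof.
  intros H. destruct (le_lt_dec (length w) m).
  - now rewrite firstn_all2.
  - rewrite <- (firstn_skipn m w) at 2. rewrite app_nth1; auto. rewrite length_firstn. lia.
Qed.

(** Nested terms are flattened: the value of every subterm becomes an entry of the tuple, so that
    unnested atomic facts suffice. *)
Definition trackable (n : nat) (t : term) : Prop :=
  forall v2, Forall (dom A) v2 -> n <= length v2 ->
  exists e2 j K, j < length (v2 ++ e2) /\ nth j (v2 ++ e2) 0 = term_val A v2 t /\
    tracks v2 e2 K (fun w => nth j w 0 = term_val A w t).

Lemma terms_track n ts : Forall (trackable n) ts -> Forall (wf_term L n) ts ->
forall v2, Forall (dom A) v2 -> n <= length v2 ->
  exists e2 js K, Forall (fun j => j < length (v2 ++ e2)) js /\
    pick (v2 ++ e2) js = map (term_val A v2) ts /\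
    tracks v2 e2 K (fun w => pick w js = map (term_val A w) ts).
Proof.
  intros H. induction H as [|t ts H1 H2 IHts]; intros W v2 D Hn.
  - exists [], [], 0. repeat split; auto.
  - inversion W as [|? ? W1 W2]; subst. destruct (H1 v2 D Hn) as (e & j & K & Hj & Ej & T).
    destruct (IHts W2 (v2 ++ e)) as (e' & js & K' & Hjs & Ejs & T').
    { apply Forall_app; split; auto. apply T. }
    { rewrite length_app; lia. }
    exists (e ++ e'), (j :: js), (K + K'). rewrite app_assoc. split; [|split].
    + constructor; auto. rewrite length_app. lia.
    + cbn [pick map]. f_equal; [now rewrite app_nth1|]. unfold pick in Ejs. rewrite Ejs.
      apply map_ext_in. intros s Hs. apply (term_val_app n); auto.
      rewrite Forall_forall in W2; auto.
    + eapply tracks_impl; [|exact (tracks_app _ _ _ _ _ _ _ T T')]. cbn beta.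
      intros w Hw _ [P1 P2]. cbn [pick map]. f_equal; [|exact P2].
      rewrite length_app in Hj. rewrite !length_app in Hw.
      rewrite nth_firstn_lt in P1 by (rewrite length_app; lia). rewrite P1.
      apply (term_val_firstn n); auto; rewrite !length_app; lia.
Qed.
Lemma term_track n t : wf_term L n t -> trackable n t.
Proof.
  induction t as [i|f ts IH] using term_nested_ind; intros W v2 D Hn.
  - simpl in W. exists [], i, 0. rewrite app_nil_r. split; [lia|]. split; auto.
    split; auto.
  - simpl in W. destruct W as [E W]. apply wf_term_args in W.
    assert (IH' : Forall (trackable n) ts).
    { rewrite Forall_forall in *. intros t Ht. apply IH; auto. }
    destruct (terms_track n ts IH' W v2 D Hn) as (e & js & K & Hjs & Ejs & T).
    set (z := sfun A f (map (term_val A v2) ts)). set (j := length (v2 ++ e)).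
    (* The fact that [f] at the positions [js] has its value at the new position [j]. It is among
       the facts below [S q]. *)
    set (q := npair 1 (npair f (npair (tuple_code js) j))).
    assert (Dz : dom A z).
    { apply (term_val_dom n (App f ts)); auto. simpl. rewrite wf_term_args. auto. }
    assert (Ljs : length js = length ts).
    { apply (f_equal (@length nat)) in Ejs. unfold pick in Ejs. now rewrite !length_map in Ejs. }
    assert (PA : forall (w y : list nat), length (v2 ++ e) <= length w -> pick (w ++ y) js = pick w js).
    { intros w y Hw. unfold pick. apply map_ext_in. intros a Ha. apply app_nth1.
      rewrite Forall_forall in Hjs. specialize (Hjs a Ha). lia. }
    assert (T' : tracks (v2 ++ e) [z] (S q) (fun w => sfun A f (pick w js) = nth j w 0)).
    { split; auto. intros w1 x1 x2 Hl H1 H2 H. unfold bf_agree in H. rewrite ball_true in H.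
      specialize (H q ltac:(lia)). apply eqb_prop in H.
      assert (Q : bf_at x (tuple_code (((v2 ++ e) ++ [z]) ++ x2)) q = true).
      { apply bf_at_fun; auto. rewrite Ljs. repeat split; auto.
        - eapply Forall_impl; [|exact Hjs]. cbn beta. intros a Ha. rewrite !length_app in *. lia.
        - unfold j. rewrite !length_app. simpl. lia.
        - rewrite <- app_assoc, PA, Ejs by auto. fold z.
          rewrite app_nth2 by auto. unfold j. now rewrite Nat.sub_diag. }
      rewrite Q in H. apply bf_at_fun in H as (_ & _ & _ & H); auto.
      rewrite length_app in Hl. simpl in Hl. rewrite PA in H by lia.
      rewrite H. apply app_nth1. unfold j. lia. }
    exists (e ++ [z]), j, (K + S q). rewrite app_assoc. split; [|split].
    + unfold j. rewrite (length_app (v2 ++ e)). simpl. lia.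
    + rewrite app_nth2 by auto. unfold j. rewrite Nat.sub_diag. reflexivity.
    + eapply tracks_impl; [|exact (tracks_app _ _ _ _ _ _ _ T T')]. cbn beta.
      intros w Hw _ [P1 P2]. rewrite <- P2. cbn [term_val]. f_equal.
      rewrite app_assoc, (length_app (v2 ++ e)) in Hw. simpl in Hw.
      rewrite <- (firstn_skipn (length (v2 ++ e)) w), PA by (rewrite length_firstn; lia).
      rewrite P1. apply map_ext_in. intros s Hs. rewrite Forall_forall in W.
      symmetry. apply (term_val_app n); auto.
      rewrite length_firstn. rewrite length_app in *. lia.
Qed.

Lemma wf_terms_track n ts : Forall (wf_term L n) ts -> Forall (trackable n) ts.
Proof. apply Forall_impl. apply term_track. Qed.

Definition qf_trackable (n : nat) (p : qf_formula) : Prop :=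
  wf_qf L n p -> forall v2, Forall (dom A) v2 -> n <= length v2 ->
  exists e2 K, tracks v2 e2 K (fun w => qf_sat A w p <-> qf_sat A v2 p).

Lemma qf_track_two n p q v2 : wf_qf L n p /\ wf_qf L n q -> Forall (dom A) v2 ->
  n <= length v2 -> qf_trackable n p -> qf_trackable n q ->
  exists e2 K, tracks v2 e2 K (fun w =>
    (qf_sat A w p <-> qf_sat A v2 p) /\ (qf_sat A w q <-> qf_sat A v2 q)).
Proof.
  intros [W1 W2] D Hn IHp IHq.
  destruct (IHp W1 v2 D Hn) as (e & K & T). destruct (IHq W2 (v2 ++ e)) as (e' & K' & T').
  { apply Forall_app; split; auto. apply T. }
  { rewrite length_app; lia. }
  exists (e ++ e'), (K + K').
  eapply tracks_impl; [|exact (tracks_app _ _ _ _ _ _ _ T T')]. cbn beta.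
  intros w Hw _ [P1 P2]. rewrite app_assoc, length_app in Hw.
  rewrite (qf_sat_firstn n) in P1 by (auto; rewrite ?length_app in *; lia).
  rewrite (qf_sat_app n) in P2 by auto. tauto.
Qed.

Lemma qf_track n p : qf_trackable n p.
Proof.
  induction p as [|s t|r ts|p IH|p IHp q IHq|p IHp q IHq]; intros W v2 D Hn.
  - exists [], 0. split; auto. intros. simpl. tauto.
  - destruct W as [W1 W2].
    assert (W : Forall (wf_term L n) [s; t]) by auto.
    destruct (terms_track n _ (wf_terms_track n _ W) W v2 D Hn) as (e & js & K & Hjs & Ejs & T).
    set (q := fun i j => npair 2 (npair i (npair 0 j))).
    destruct js as [|i [|j [|]]]; try discriminate. injection Ejs as Ei Ej.
    inversion Hjs as [|? ? Hi Hjs']; subst. inversion Hjs' as [|? ? Hj _]; subst.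
    exists e, (K + S (q i j)). split; [apply T|].
    intros w1 x1 x2 Hl H1 H2 H.
    assert (P : pick w1 [i; j] = map (term_val A w1) [s; t]).
    { eapply T; [exact Hl|exact H1|exact H2|eapply agree_mono; [|exact H]; lia]. }
    injection P as Pi Pj. unfold bf_agree in H. rewrite ball_true in H.
    specialize (H (q i j) ltac:(lia)). apply eqb_prop, eq_iff_true in H.
    unfold q in H. rewrite !bf_at_eq in H by lia.
    rewrite !(length_app (v2 ++ e)), !(length_app w1), Hl, !(app_nth1 w1 x1), !(app_nth1 (v2 ++ e) x2) in H by lia.
    simpl. rewrite <- Pi, <- Pj, <- Ei, <- Ej.
    assert (B : forall m, i < length (v2 ++ e) + m /\ j < length (v2 ++ e) + m) by (intros; lia).
    pose proof (B (length x1)). pose proof (B (length x2)). tauto.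
  - destruct W as [E W].
    destruct (terms_track n _ (wf_terms_track n _ W) W v2 D Hn) as (e & js & K & Hjs & Ejs & T).
    set (q := npair 0 (npair r (npair (tuple_code js) 0))).
    assert (Ljs : length js = length ts).
    { apply (f_equal (@length nat)) in Ejs. unfold pick in Ejs. now rewrite !length_map in Ejs. }
    assert (PA : forall (w y : list nat), length (v2 ++ e) <= length w -> pick (w ++ y) js = pick w js).
    { intros w y Hw. unfold pick. apply map_ext_in. intros a Ha. apply app_nth1.
      rewrite Forall_forall in Hjs. specialize (Hjs a Ha). lia. }
    exists e, (K + S q). split; [apply T|].
    intros w1 x1 x2 Hl H1 H2 H.
    assert (P : pick w1 js = map (term_val A w1) ts).
    { eapply T; [exact Hl|exact H1|exact H2|eapply agree_mono; [|exact H]; lia]. }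
    unfold bf_agree in H. rewrite ball_true in H.
    specialize (H q ltac:(lia)). apply eqb_prop, eq_iff_true in H.
    unfold q in H. rewrite !bf_at_rel in H by auto. rewrite Ljs, !PA, Ejs, P in H by lia.
    assert (F : forall y z : list nat, length y = length (v2 ++ e) -> Forall (fun a => a < length (y ++ z)) js).
    { intros y z Hy. eapply Forall_impl; [|exact Hjs]. cbn beta. intros a Ha. rewrite length_app. lia. }
    pose proof (F w1 x1 Hl). pose proof (F (v2 ++ e) x2 eq_refl). simpl. tauto.
  - destruct (IH W v2 D Hn) as (e & K & T). exists e, K.
    eapply tracks_impl; [|exact T]. simpl. tauto.
  - destruct (qf_track_two n p q v2 W D Hn IHp IHq) as (e & K & T). exists e, K.
    eapply tracks_impl; [|exact T]. simpl. tauto.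
  - destruct (qf_track_two n p q v2 W D Hn IHp IHq) as (e & K & T). exists e, K.
    eapply tracks_impl; [|exact T]. simpl. tauto.
Qed.

(** From left to right, a true matrix is transferred by agreement on enough facts about the
    witnesses and the values of all subterms. From right to left, agreement on [K] facts is itself
    expressed by a quantifier-free formula. *)
Lemma bf_base_sigma1 a1 a2 : Forall (dom A) a1 -> Forall (dom A) a2 ->
  (bf_base x (tuple_code a1) (tuple_code a2) = true <->
   forall p, wf_sigma1 L p -> true_of A p a2 -> true_of A p a1).
Proof.
  intros D1 D2.
  assert (X7 : forall c2 K, x (npair 7 (npair (tuple_code a1) (npair (tuple_code a2)
      (npair (tuple_code c2) K)))) = true <->
    exists c1, Forall (dom A) c1 /\ length c1 = length c2 /\
      bf_agree x (tuple_code (a1 ++ c1)) (tuple_code (a2 ++ c2)) K = true).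
  { intros c2 K. rewrite (Hx (npair 7 _)). unfold bf_op. cbv zeta.
    pis.
    cbn [Nat.eqb]. split.
    - intros [n Hn]. destruct (tuple_code_surj n) as [c1 <-].
      rewrite !andb_true_iff, bf_dom_code, !clen_code, Nat.eqb_eq, !capp_code in Hn. eauto.
    - intros [c1 H]. exists (tuple_code c1).
      rewrite !andb_true_iff, bf_dom_code, !clen_code, Nat.eqb_eq, !capp_code. auto. }
  assert (X8 : x (npair 8 (npair (tuple_code a1) (tuple_code a2))) = false <->
    forall c2 K, Forall (dom A) c2 -> exists c1, Forall (dom A) c1 /\ length c1 = length c2 /\
      bf_agree x (tuple_code (a1 ++ c1)) (tuple_code (a2 ++ c2)) K = true).
  { rewrite <- not_true_iff_false, (Hx (npair 8 _)). unfold bf_op. cbv zeta.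
    pis. cbn [Nat.eqb]. split.
    - intros N c2 K Hc. apply X7. apply NNPP. intros N'. apply N.
      exists (npair (tuple_code c2) K). pis. rewrite andb_true_iff, bf_dom_code.
      split; auto. apply negb_true_iff. now apply not_true_iff_false.
    - intros H [n Hn]. destruct (tuple_code_surj (pi1 n)) as [c2 E]. rewrite <- E in Hn.
      rewrite andb_true_iff, bf_dom_code, negb_true_iff, <- not_true_iff_false, X7 in Hn.
      destruct Hn as [Hn N]. apply N. auto. }
  unfold bf_base. rewrite andb_true_iff, !clen_code, Nat.eqb_eq, negb_true_iff, X8. split.
  - intros [El H] [n m p] W (E2 & c2 & Ec & Dc & S). simpl in E2, Ec, S. unfold wf_sigma1 in W. simpl in W.
    destruct (qf_track _ _ W (a2 ++ c2)) as (e & K & [De T]).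
    { now apply Forall_app. }
    { rewrite length_app. lia. }
    (* The witnesses [c2] are lengthened by the values [e] of the subterms; of the answer [c1], only
       the first [length c2] entries serve as witnesses. *)
    destruct (H (c2 ++ e) K) as (c1 & Dc1 & Lc1 & G); [now apply Forall_app|].
    rewrite length_app in Lc1.
    assert (Q : qf_sat A (a1 ++ c1) p).
    { apply (T (a1 ++ c1) [] []).
      - rewrite !length_app. lia.
      - rewrite app_nil_r. now apply Forall_app.
      - rewrite app_nil_r, <- app_assoc. rewrite !Forall_app. auto.
      - now rewrite !app_nil_r, <- app_assoc.
      - exact S. }
    split; [simpl; lia|]. exists (firstn (length c2) c1). simpl. split; [|split].
    + rewrite length_firstn. lia.
    + rewrite <- (firstn_skipn (length c2) c1) in Dc1. now apply Forall_app in Dc1.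
    + rewrite <- (firstn_skipn (length c2) c1), app_assoc in Q.
      apply (qf_sat_app (n + m)) in Q; auto. rewrite length_app, length_firstn. lia.
  (* A formula that holds trivially forces equal lengths, since [true_of] compares the length of the
     tuple with the arity. *)
  - intros H. assert (El : length a1 = length a2).
    { destruct (H {| arity := length a2; bound := 0; matrix := Not Bot |}) as [E _]; [exact I| |exact E].
      split; [reflexivity|]. exists []. split; [reflexivity|split; [constructor|simpl; tauto]]. }
    split; auto. intros c2 K Dc.
    destruct (agree_formula K (length (a2 ++ c2)) (tuple_code (a2 ++ c2))) as (p & W & Hp).
    destruct (H {| arity := length a2; bound := length c2; matrix := p |}) as (_ & c1 & Lc & Dc1 & S).
    + unfold wf_sigma1. simpl. now rewrite <- length_app.
    + split; auto. exists c2. simpl. repeat split; auto. apply Hp; auto; [now apply Forall_app|].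
      unfold bf_agree. apply ball_true. intros. apply eqb_reflx.
    + simpl in Lc, S. exists c1. repeat split; auto. apply Hp; auto; [now apply Forall_app|].
      rewrite !length_app. lia.
Qed.

Variable H : order nat.
Hypothesis HH : is_order_index (pi2 k) H.

Lemma tag_odom a : x (npair 5 a) = true <-> odom H a.
Proof.
  destruct HH as (u & r & Ek & Hu & Hr).
  rewrite (Hx (npair 5 a)). unfold bf_op. cbv zeta. rewrite Ek.
  pis. cbn [Nat.eqb]. rewrite <- cert_phi.
  apply decides_1. auto.
Qed.
Lemma tag_olt a b : odom H a -> odom H b -> (x (npair 6 (npair a b)) = true <-> olt H a b).
Proof.
  intros Ha Hb. destruct HH as (u & r & Ek & Hu & Hr).
  rewrite (Hx (npair 6 _)). unfold bf_op. cbv zeta. rewrite Ek.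
  pis. cbn [Nat.eqb]. rewrite <- cert_phi.
  apply decides_1. auto.
Qed.
Lemma tag_least a : odom H a -> (x (npair 9 a) = false <-> is_least H a).
Proof.
  intros Ha. rewrite <- not_true_iff_false, (Hx (npair 9 a)). unfold bf_op. cbv zeta.
  pis. cbn [Nat.eqb]. split.
  - intros N. split; auto. intros y Hy. apply NNPP. intros N'. apply N. exists y.
    apply andb_true_iff. split; [now apply tag_odom|]. apply negb_true_iff, orb_false_iff.
    split; [apply Nat.eqb_neq; tauto|]. apply not_true_iff_false. rewrite tag_olt by auto. tauto.
  - intros [_ HL] [y Hy]. apply andb_true_iff in Hy as [Hy N]. apply tag_odom in Hy.
    apply negb_true_iff, orb_false_iff in N as [N1 N2]. apply Nat.eqb_neq in N1.
    apply not_true_iff_false in N2. rewrite tag_olt in N2 by auto. destruct (HL y Hy); auto.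
Qed.

Lemma bf_rel_back_and_forth :
  back_and_forth A H (fun a1 a2 p => bf_rel x (tuple_code a1) (tuple_code a2) p).
Proof.
  split; intros a1 a2 p D1 D2 Hp.
  - unfold bf_rel. rewrite (proj2 (tag_least p (proj1 Hp)) Hp). now apply bf_base_sigma1.
  - intros N. unfold bf_rel at 1. destruct (x (npair 9 p)) eqn:E; [|apply tag_least in E; tauto].
    assert (X10 : forall c1 c2 q, x (npair 10 (npair (tuple_code c1) (npair (tuple_code c2) q))) = true <->
      exists c, Forall (dom A) c /\ bf_rel x (tuple_code c1) (tuple_code (c2 ++ c)) q = true).
    { intros c1 c2 q. rewrite (Hx (npair 10 _)). unfold bf_op. cbv zeta.
      pis. cbn [Nat.eqb]. split.
      - intros [n Hn]. destruct (tuple_code_surj n) as [c <-].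
        rewrite andb_true_iff, bf_dom_code, capp_code in Hn. eauto.
      - intros [c Hc]. exists (tuple_code c). now rewrite andb_true_iff, bf_dom_code, capp_code. }
    rewrite negb_true_iff, <- not_true_iff_false, (Hx (npair 11 _)). unfold bf_op. cbv zeta.
    pis. cbn [Nat.eqb]. split.
    + intros N' d y Dd Hy Hl. apply X10. apply NNPP. intros N''. apply N'.
      exists (npair (tuple_code d) y). pis. rewrite !andb_true_iff, bf_dom_code, capp_code.
      rewrite tag_odom, tag_olt by auto. repeat split; auto. apply negb_true_iff.
      now apply not_true_iff_false.
    + intros G [n Hn]. destruct (tuple_code_surj (pi1 n)) as [d Ed]. rewrite <- Ed in Hn.
      rewrite !andb_true_iff, bf_dom_code, capp_code, tag_odom in Hn.
      destruct Hn as (Dd & Ho & Hl & Hn). apply tag_olt in Hl; auto.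
      apply negb_true_iff, not_true_iff_false in Hn. apply Hn, X10. auto.
Qed.
End Atomic.

Theorem high_for_paths_scott_complete d : high_for_paths d -> scott_complete d.
Proof.
  intros Hd. destruct (degree_nonempty d) as [Y HY].
  (* One oracle serves all index pairs [k]. For each [k], [z] and [n = pi2 p], a true bit [z] must
     have some witness [m], and for a false bit [n] must not be a witness; together this is
     [bf_fixed k]. *)
  set (D := fun (X : nat -> bool) p m => let k := pi1 (pi1 p) in let z := pi2 (pi1 p) in
    let x := fun z => X (npair k z) in
    (negb (x z) || bf_op k x z m) && (x z || negb (bf_op k x z (pi2 p)))).
  assert (HD : cfb all_oracles (fun X z => D X (pi1 z) (pi2 z))).
  { unfold D, bf_op, bf_agree, bf_at, bf_rel, bf_base, bf_dom, bf_inb, bf_sel. cbv zeta. csolve. }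
  destruct (pi2_basis d D Hd HD) with (Y := Y) as (X & HX & S); auto.
  - set (x := fun k => proj1_sig (constructive_indefinite_description _ (bf_fixed_exists k))).
    assert (Hx : forall k, bf_fixed k (x k)) by (intros k; unfold x; apply proj2_sig).
    exists (fun z => x (pi1 z) (pi2 z)). intros p. unfold D. cbv zeta.
    set (k := pi1 (pi1 p)). set (z := pi2 (pi1 p)).
    assert (E : forall n, bf_op k (fun z => x (pi1 (npair k z)) (pi2 (npair k z))) z n = bf_op k (x k) z n).
    { intros n. f_equal. apply functional_extensionality. intros y. now rewrite pi1_pair, pi2_pair. }
    rewrite pi1_pair, pi2_pair. specialize (Hx k z). destruct (x k z).
    + destruct (proj1 Hx eq_refl) as [n Hn]. exists n. rewrite E, Hn. reflexivity.
    + exists 0. rewrite !E. cbn [negb orb andb]. destruct (bf_op k (x k) z (pi2 p)) eqn:Q; [|reflexivity].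
      enough (false = true) by discriminate. apply Hx. exists (pi2 p). exact Q.
  - assert (Fx : forall k, bf_fixed k (fun z => X (npair k z))).
    { intros k z. split.
      - intros H. destruct (S (npair (npair k z) 0)) as [m Hm]. unfold D in Hm. cbv zeta in Hm.
        pis in Hm. rewrite H in Hm. simpl in Hm.
        rewrite andb_true_r in Hm. eauto.
      - intros [n Hn]. destruct (S (npair (npair k z) n)) as [m Hm]. unfold D in Hm. cbv zeta in Hm.
        pis in Hm. rewrite Hn in Hm. simpl in Hm.
        apply andb_true_iff in Hm as [_ Hm]. now rewrite orb_false_r in Hm. }
    assert (C : cf (eq Y) (fun _ z => Nat.b2n (bf_rel (fun y => X (npair (pi1 z) y))
       (pi1 (pi2 z)) (pi1 (pi2 (pi2 z))) (pi2 (pi2 (pi2 z)))))).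
    { unfold bf_rel, bf_base. csolve. }
    destruct (smn _ _ C) as (g & [cg Hg] & He). specialize (He Y eq_refl).
    exists Y. split; auto. exists (encode cg).
    intros eA eH L A H HA HH HeH. set (k := npair eA eH).
    exists (g k), (fun a1 a2 p => bf_rel (fun z => X (npair k z)) (tuple_code a1) (tuple_code a2) p).
    split; [apply phi_encode; now apply Hg|]. split.
    + apply (bf_rel_back_and_forth A k); auto; unfold k; pis; auto.
    + intros a1 a2 p _ _ _.
      specialize (He k (npair (tuple_code a1) (npair (tuple_code a2) p))).
      now pis in He.
Qed.

(** * The tree of runs and its even and odd vectors *)

(** [2 * h + 1] is the quotient of [v] by [2 ^ s], which is odd; the inequalities avoid division in
    the computability proof. *)
Lemma testbit_bex v s :
  Nat.testbit v s = bex (S v) (fun h => ((2 * h + 1) * 2 ^ s <=? v) && (v <? (2 * h + 2) * 2 ^ s)).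
Proof.
  apply eq_true_iff_eq. rewrite Nat.testbit_true, bex_true.
  assert (P : 2 ^ s <> 0) by (apply Nat.pow_nonzero; lia).
  pose proof (Nat.div_mod v (2 ^ s) P) as D.
  pose proof (Nat.mod_upper_bound v (2 ^ s) P) as U.
  set (q := v / 2 ^ s) in *. set (r := v mod 2 ^ s) in *. clearbody r.
  pose proof (Nat.div_mod q 2 ltac:(lia)) as D2. split.
  - intros H. exists (q / 2). rewrite H in D2. split; [nia|].
    rewrite andb_true_iff, Nat.leb_le, Nat.ltb_lt. nia.
  - intros (h & _ & H). rewrite andb_true_iff, Nat.leb_le, Nat.ltb_lt in H.
    assert (q = 2 * h + 1) by nia. rewrite H0, Nat.add_comm, Nat.mul_comm, Nat.Div0.mod_add. reflexivity.
Qed.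
Lemma cfb_testbit K V S : cf K V -> cf K S -> cfb K (fun X n => Nat.testbit (V X n) (S X n)).
Proof.
  intros HV HS. eapply cfb_ext; [intros; symmetry; apply testbit_bex|]. csolve.
Qed.
Ltac cext_testbit := first [ cext_rc | lazymatch goal with
  | |- cfb ?K (fun X n => Nat.testbit (@?a X n) (@?b X n)) => apply (cfb_testbit K a b) end ].
Ltac cext ::= cext_testbit.

Lemma pow2_gt s : s < 2 ^ s.
Proof. apply Nat.pow_gt_lin_r. lia. Qed.
Lemma testbit_lt v s : Nat.testbit v s = true -> s < v.
Proof.
  intros H. apply Nat.nle_gt. intros L. rewrite Nat.bits_above_log2 in H; [discriminate|].
  pose proof (pow2_gt s). destruct (Nat.eq_dec v 0) as [->|N].
  - rewrite Nat.bits_0 in H. discriminate.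
  - pose proof (Nat.log2_lt_lin v ltac:(lia)). lia.
Qed.
Lemma testbit_pow2 s t : Nat.testbit (2 ^ s) t = (s =? t).
Proof.
  destruct (Nat.eqb_spec s t) as [->|H]; [apply Nat.pow2_bits_true|now apply Nat.pow2_bits_false].
Qed.
(** Written with sum and difference, which are known to be computable; the algebra is done with
    [lxor]. *)
Definition flip (v s : nat) : nat := if Nat.testbit v s then v - 2 ^ s else v + 2 ^ s.
Lemma flip_lxor v s : flip v s = Nat.lxor v (2 ^ s).
Proof.
  assert (N : forall w, Nat.testbit w s = false -> w + 2 ^ s = Nat.lxor w (2 ^ s)).
  { intros w H. apply Nat.add_nocarry_lxor. apply Nat.bits_inj_0. intros t.
    rewrite Nat.land_spec, testbit_pow2. destruct (Nat.eqb_spec s t) as [->|]; [now rewrite H|].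
    apply andb_false_r. }
  unfold flip. destruct (Nat.testbit v s) eqn:E; [|auto].
  assert (F : Nat.testbit (Nat.lxor v (2 ^ s)) s = false).
  { rewrite Nat.lxor_spec, testbit_pow2, E, Nat.eqb_refl. reflexivity. }
  specialize (N _ F). rewrite Nat.lxor_assoc, Nat.lxor_nilpotent, Nat.lxor_0_r in N. lia.
Qed.

(** The image under [ctl], counted modulo 2, of the set of nodes with bit mask [v]. *)
Definition pushK (K v : nat) : nat :=
  nat_rect (fun _ => nat) 0 (fun s r => if Nat.testbit v s then flip r (ctl s) else r) K.
Definition push (v : nat) : nat := pushK v v.

Lemma pushK_S K v : pushK (S K) v =
  if Nat.testbit v K then Nat.lxor (pushK K v) (2 ^ ctl K) else pushK K v.
Proof. unfold pushK. simpl nat_rect. now rewrite flip_lxor. Qed.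
Lemma pushK_lxor K v w : pushK K (Nat.lxor v w) = Nat.lxor (pushK K v) (pushK K w).
Proof.
  induction K as [|K IH]; [reflexivity|]. rewrite !pushK_S, Nat.lxor_spec, IH.
  set (a := pushK K v). set (b := pushK K w). set (p := 2 ^ ctl K).
  destruct (Nat.testbit v K), (Nat.testbit w K); cbn [xorb]; auto.
  - rewrite <- Nat.lxor_assoc, (Nat.lxor_comm _ p), <- !Nat.lxor_assoc, (Nat.lxor_comm p a),
      (Nat.lxor_assoc a p p), Nat.lxor_nilpotent, Nat.lxor_0_r. reflexivity.
  - now rewrite !Nat.lxor_assoc, (Nat.lxor_comm b).
  - now rewrite !Nat.lxor_assoc.
Qed.
Lemma pushK_push K v : v <= K -> pushK K v = push v.
Proof.
  intros H. induction H; auto. rewrite pushK_S. destruct (Nat.testbit v m) eqn:E; auto.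
  apply testbit_lt in E. lia.
Qed.
Lemma push_lxor v w : push (Nat.lxor v w) = Nat.lxor (push v) (push w).
Proof.
  rewrite <- (pushK_push (v + w + Nat.lxor v w)), pushK_lxor by lia.
  now rewrite !pushK_push by lia.
Qed.
Lemma push_pow2 s : push (2 ^ s) = 2 ^ ctl s.
Proof.
  assert (H : forall K, pushK K (2 ^ s) = if s <? K then 2 ^ ctl s else 0).
  { induction K as [|K IH]; auto. rewrite pushK_S, testbit_pow2, IH.
    destruct (Nat.eqb_spec s K) as [->|N].
    - rewrite Nat.ltb_irrefl, Nat.lxor_0_l. replace (K <? S K) with true; auto.
      symmetry. apply Nat.ltb_lt. lia.
    - destruct (Nat.ltb_spec s K), (Nat.ltb_spec s (S K)); auto; lia. }
  unfold push. rewrite H. pose proof (pow2_gt s). apply Nat.ltb_lt in H0. now rewrite H0.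
Qed.
(** An odd number of preimages is at least one. This is how a node of the projection leads to a
    child in the set itself. *)
Lemma push_testbit v t : Nat.testbit (push v) t = true ->
  exists s, Nat.testbit v s = true /\ ctl s = t.
Proof.
  unfold push. generalize v at 1 as K. induction K as [|K IH]; intros H.
  - cbn in H. rewrite Nat.bits_0 in H. discriminate.
  - rewrite pushK_S in H. destruct (Nat.testbit v K) eqn:E; auto.
    rewrite Nat.lxor_spec, testbit_pow2 in H. destruct (Nat.eqb_spec (ctl K) t); [eauto|].
    rewrite xorb_false_r in H. auto.
Qed.
Lemma cf_push K V : cf K V -> cf K (fun X n => push (V X n)).
Proof.
  intros HV. unfold push, pushK.
  apply (cf_rec K (fun _ _ => 0) (fun X n s r => if Nat.testbit (V X n) s then flip r (ctl s) else r) V); auto.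
  - csolve.
  - unfold flip. csolve.
Qed.

Section Runs.
Variables e q0 : nat.

Definition top (s : nat) : nat := if s =? 0 then q0 else pi1 (chd s).
(** A node of length [n] lists, the last one first, the states after the first [n]
    steps of a run, each with a certificate. *)
Definition gnode (s : nat) : bool :=
  ball (clen s) (fun i => edge_cert e (top (cdrop (S i) s)) (pi1 (cnth i s)) (pi2 (cnth i s))).

Lemma gnode_ccons a s : gnode (ccons a s) = true <->
  edge_cert e (top s) (pi1 a) (pi2 a) = true /\ gnode s = true.
Proof.
  unfold gnode. rewrite !ball_true, clen_ccons.
  assert (S0 : cnth 0 (ccons a s) = a) by apply chd_cons.
  assert (SS : forall i, cdrop (S i) (ccons a s) = cdrop i s).
  { intros i. rewrite cdrop_S, ctl_cons. reflexivity. }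
  assert (SC : forall i, cnth (S i) (ccons a s) = cnth i s).
  { intros i. change (chd (cdrop (S i) (ccons a s)) = chd (cdrop i s)). now rewrite SS. }
  split.
  - intros H. split.
    + specialize (H 0 ltac:(lia)). now rewrite SS, S0 in H.
    + intros i Hi. specialize (H (S i) ltac:(lia)). now rewrite SS, SC in H.
  - intros [H1 H2] [|i] Hi.
    + now rewrite SS, S0.
    + rewrite SS, SC. apply H2. lia.
Qed.
Definition inL (n s : nat) : bool := (clen s =? n) && gnode s.
Lemma inL_ctl n s : inL n s = true -> inL (pred n) (ctl s) = true.
Proof.
  unfold inL. rewrite !andb_true_iff, !Nat.eqb_eq. intros [H1 H2].
  destruct (Nat.eq_dec s 0) as [->|N].
  - rewrite ctl_0. change (clen 0) with 0 in *. now subst.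
  - rewrite <- (ccons_chd_ctl s N) in H1, H2. rewrite clen_ccons in H1.
    apply gnode_ccons in H2 as [_ H2]. subst. auto.
Qed.

(** The element [npair n v] is the set of nodes of level [n] with bit mask [v]. *)
Definition gdom (x : nat) : bool :=
  ball (pi2 x) (fun s => negb (Nat.testbit (pi2 x) s) || inL (pi1 x) s).
Lemma gdom_spec n v : gdom (npair n v) = true <->
  forall s, Nat.testbit v s = true -> inL n s = true.
Proof.
  unfold gdom. rewrite ball_true, pi1_pair, pi2_pair. split; intros H s Hs.
  - specialize (H s (testbit_lt _ _ Hs)). now rewrite Hs in H.
  - destruct (Nat.testbit v s) eqn:E; auto. simpl. auto.
Qed.
(** At level 0 the map stays at level 0 and keeps the set of the root, as [pred 0 = 0] and
    [ctl 0 = 0]. *)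
Definition parent (x : nat) : nat := npair (pred (pi1 x)) (push (pi2 x)).
Lemma gdom_parent x : gdom x = true -> gdom (parent x) = true.
Proof.
  rewrite <- (pair_pi x). unfold parent. rewrite pi1_pair, pi2_pair, !gdom_spec.
  intros H t Ht. apply push_testbit in Ht as (s & Hs & <-). now apply inL_ctl, H.
Qed.
Lemma gdom_0 n : gdom (npair n 0) = true.
Proof. apply gdom_spec. intros s. rewrite Nat.bits_0. discriminate. Qed.

Definition GL : language := {| rel_ar := fun _ => Some 1; fun_ar := fun _ => Some 1 |}.

Lemma G_sfun_dom : forall i l, fun_ar GL i = Some (length l) ->
  Forall (fun x => gdom x = true) l -> gdom (parent (hd 0 l)) = true.
Proof.
  intros i [|x l] E H; [discriminate|]. apply gdom_parent. now inversion H.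
Qed.
(** The relations naming the levels keep an isomorphism from moving a set to another level. The mark
    distinguishes copies of the structure; a mark outside the universe leaves relation 0 empty. *)
Definition G (mark : nat) : structure GL := {|
  dom := fun x => gdom x = true;
  srel := fun i l => match i with 0 => hd 0 l = mark | S m => pi1 (hd 0 l) = m end;
  sfun := fun _ l => parent (hd 0 l);
  dom_nonempty := ex_intro _ (npair 0 0) (gdom_0 0);
  sfun_dom := G_sfun_dom |}.

Lemma cf_gdom K F : cf K F -> cfb K (fun X n => gdom (F X n)).
Proof. intros. unfold gdom, inL, gnode, top, edge_cert. csolve. Qed.

Lemma cnth_hd l : cnth 0 (tuple_code l) = hd 0 l.
Proof. rewrite cnth_code. now destruct l. Qed.

Lemma bool_decides (c : code) X n b P : eval X c n (Nat.b2n b) -> (b = true <-> P) ->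
  decides X (encode c) n P.
Proof.
  intros H E. split; intros HP; apply phi_encode.
  - apply E in HP. now rewrite HP in H.
  - rewrite <- E in HP. apply not_true_iff_false in HP. now rewrite HP in H.
Qed.

Lemma G_index mark : exists eA, is_structure_index eA GL (G mark).
Proof.
  assert (C2 : cf all_oracles (fun _ _ => 2)) by csolve. destruct C2 as [c2 H2].
  assert (Cu : cfb all_oracles (fun _ x => gdom x)) by (apply cf_gdom; csolve).
  destruct Cu as [cu Hu].
  assert (Cr : cfb all_oracles (fun _ z => if pi1 z =? 0 then cnth 0 (pi2 z) =? mark
     else pi1 (cnth 0 (pi2 z)) =? pred (pi1 z))) by csolve.
  destruct Cr as [cr Hr].
  assert (Cf : cf all_oracles (fun _ z => parent (cnth 0 (pi2 z)))).
  { unfold parent. apply cf_pair; [csolve|]. apply cf_push. csolve. }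
  destruct Cf as [cf' Hf].
  exists (npair (npair (encode c2) (encode c2)) (npair (encode cu) (npair (encode cr) (encode cf')))).
  exists (npair (encode c2) (encode c2)), (encode cu), (encode cr), (encode cf').
  split; auto. split; [|split; [|split]].
  - exists (encode c2), (encode c2). split; auto. split; intros i; apply phi_encode; now apply H2.
  - intros x. eapply bool_decides; [now apply Hu|]. reflexivity.
  - intros i l _ _. eapply bool_decides; [now apply Hr|]. rewrite pi1_pair, pi2_pair, cnth_hd.
    destruct i; cbn [Nat.eqb pred srel G]; apply Nat.eqb_eq.
  - intros i l _ _. apply phi_encode. specialize (Hf no_oracle I (npair i (tuple_code l))).
    now rewrite pi2_pair, cnth_hd in Hf.
Qed.

(** * Paths as translations, and runs from odd sets *)

Definition path (p : nat -> nat) : Prop :=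
  p 0 = 0 /\ forall n, inL n (p n) = true /\ ctl (p (S n)) = p n.
Lemma run_path f : irun e q0 f -> exists p, path p.
Proof.
  intros [F0 F].
  assert (H : forall n, exists t, edge_cert e (f n) (f (S n)) t = true)
    by (intros; now apply edge_cert_spec).
  apply choice in H as [t Ht].
  set (p := nat_rect (fun _ => nat) 0 (fun n s => ccons (npair (f (S n)) (t n)) s)).
  assert (P : forall n, inL n (p n) = true /\ top (p n) = f n).
  { induction n as [|n [IH1 IH2]]; [split; [reflexivity|now rewrite F0]|]. simpl p. unfold inL in *.
    rewrite andb_true_iff, Nat.eqb_eq in *. destruct IH1 as [L N]. split.
    - rewrite clen_ccons, gnode_ccons. fold (p n). rewrite IH2, pi1_pair, pi2_pair. auto.
    - unfold top.
      rewrite chd_cons, pi1_pair. reflexivity. }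
  exists p. split; auto. intros n. split; [apply P|]. apply ctl_cons.
Qed.

(** Addition modulo 2 of the node of the path at each level. Since [push] is additive and sends the
    path to itself, this translation commutes with [parent]. *)
Definition shift (p : nat -> nat) (x : nat) : nat :=
  npair (pi1 x) (Nat.lxor (pi2 x) (2 ^ p (pi1 x))).
Lemma shift_invol p x : shift p (shift p x) = x.
Proof.
  unfold shift. rewrite pi1_pair, pi2_pair, Nat.lxor_assoc, Nat.lxor_nilpotent, Nat.lxor_0_r.
  apply pair_pi.
Qed.
Lemma shift_dom p x : path p -> gdom x = true -> gdom (shift p x) = true.
Proof.
  intros [_ P]. rewrite <- (pair_pi x). unfold shift. rewrite pi1_pair, pi2_pair, !gdom_spec.
  intros H s. rewrite Nat.lxor_spec, testbit_pow2.
  destruct (Nat.eqb_spec (p (pi1 x)) s) as [<-|].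
  - intros _. apply P.
  - rewrite xorb_false_r. apply H.
Qed.
Lemma shift_parent p x : path p -> shift p (parent x) = parent (shift p x).
Proof.
  intros [P0 P]. unfold shift, parent. pis. rewrite push_lxor, push_pow2.
  assert (E : p (pred (pi1 x)) = ctl (p (pi1 x))).
  { destruct (pi1 x); [now rewrite P0, ctl_0|]. symmetry. apply P. }
  now rewrite E.
Qed.
Lemma shift_iso p mark : path p -> is_isomorphism GL (G mark) (G (shift p mark)) (shift p).
Proof.
  intros P. split; [|split; [|split; [|split]]].
  - intros x. now apply shift_dom.
  - intros x y _ _ H. now rewrite <- (shift_invol p x), H, shift_invol.
  - intros y Hy. exists (shift p y). split; [now apply shift_dom|apply shift_invol].
  - intros i [|x l] E _; [discriminate|]. destruct i; cbn; [|unfold shift; now rewrite pi1_pair].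
    split; [now intros ->|]. intros H. now rewrite <- (shift_invol p x), H, shift_invol.
  - intros i [|x l] E _; [discriminate|]. cbn. now apply shift_parent.
Qed.

Definition pick_below (K : nat) (P : nat -> bool) : nat :=
  nat_rect (fun _ => nat) 0 (fun i r => if P i then i else r) K.
Lemma pick_below_spec K P : (exists i, i < K /\ P i = true) -> P (pick_below K P) = true.
Proof.
  unfold pick_below. induction K as [|K IH]; intros (i & Hi & H); [lia|]. simpl.
  destruct (P K) eqn:E; auto. apply IH. exists i. split; auto.
  destruct (Nat.eq_dec i K) as [->|]; [congruence|lia].
Qed.

(** [o 0 = 1] is the set of the root alone. As [o n] is the projection of [o (S n)], each of its
    nodes has a child there, so choosing such children never gets stuck. *)
Lemma vectors_run Y o : rc Y o -> o 0 = 1 ->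
  (forall n, gdom (npair n (o n)) = true /\ push (o (S n)) = o n) ->
  exists f, irun e q0 f /\ rc Y f.
Proof.
  intros Ho O0 O.
  set (step := fun n s => pick_below (o (S n)) (fun i => Nat.testbit (o (S n)) i && (ctl i =? s))).
  set (p := fun n => nat_rect (fun _ => nat) 0 step n).
  assert (Q : forall n, Nat.testbit (o n) (p n) = true ->
    Nat.testbit (o (S n)) (p (S n)) = true /\ ctl (p (S n)) = p n).
  { intros n IH. destruct (O n) as [_ E]. rewrite <- E in IH.
    apply push_testbit in IH as (s & Hs & Es). rewrite <- Nat.eqb_eq, <- andb_true_iff.
    apply (pick_below_spec (o (S n)) (fun i => Nat.testbit (o (S n)) i && (ctl i =? p n))).
    exists s. split; [now apply testbit_lt|]. rewrite Hs. now apply Nat.eqb_eq. }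
  assert (P : forall n, Nat.testbit (o n) (p n) = true).
  { induction n as [|n IH]; [now rewrite O0|]. now apply Q. }
  assert (P' : forall n, ctl (p (S n)) = p n) by (intros n; now apply Q).
  assert (L : forall n, inL n (p n) = true).
  { intros n. destruct (O n) as [D _]. rewrite gdom_spec in D. auto. }
  exists (fun n => top (p n)). split.
  - split; [reflexivity|]. intros n. apply edge_cert_spec. pose proof (L (S n)) as H.
    unfold inL in H. apply andb_true_iff in H as [H1 H2]. apply Nat.eqb_eq in H1.
    assert (N : p (S n) <> 0) by (intros E; rewrite E in H1; discriminate).
    rewrite <- (ccons_chd_ctl _ N), P' in H2. apply gnode_ccons in H2 as [H2 _].
    unfold top at 2. apply Nat.eqb_neq in N. rewrite N. eauto.
  - assert (Hp : rc Y p).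
    { apply (cf_rec (eq Y) (fun _ _ => 0) (fun _ _ n s => step n s) (fun _ n => n)); [csolve| |csolve].
      unfold step, pick_below.
      apply (cf_rec (eq Y) (fun _ _ => 0) (fun _ z i r => if
         Nat.testbit (o (S (pi1 (pi2 z)))) i && (ctl i =? pi2 (pi2 z)) then i else r)
         (fun _ z => o (S (pi1 (pi2 z))))); csolve. }
    unfold rc, top in *. csolve.
Qed.
End Runs.

Theorem high_for_isomorphism_paths d : high_for_isomorphism d -> high_for_paths d.
Proof.
  intros Hd e q0 (f & Hf). destruct (run_path e q0 f Hf) as [p P].
  (* The marks are the empty set of roots and, with bit mask 1, the set of the root. *)
  destruct (Hd GL (G e q0 (npair 0 0)) (G e q0 (npair 0 1))) as (g & Hg & X & eg & HX & He).
  - destruct (G_index e q0 (npair 0 0)) as [eA HA]. now exists eA.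
  - destruct (G_index e q0 (npair 0 1)) as [eA HA]. now exists eA.
  - exists (shift p). pose proof (shift_iso e q0 p (npair 0 0) P) as H.
    replace (shift p (npair 0 0)) with (npair 0 1) in H; auto.
    unfold shift. rewrite pi1_pair, pi2_pair. destruct P as [-> _]. reflexivity.
  - destruct Hg as (Gd & _ & _ & Gr & Gf).
    assert (D0 : forall n, dom (G e q0 (npair 0 0)) (npair n 0)) by (intros; apply gdom_0).
    assert (Hlev : forall n, pi1 (g (npair n 0)) = n).
    { intros n. apply (Gr (S n) [npair n 0]); auto. cbn. apply pi1_pair. }
    (* The empty sets of all levels project onto one another. The isomorphism carries them to sets
       that still do, beginning with the set of the root. *)
    destruct (vectors_run e q0 X (fun n => pi2 (g (npair n 0)))) as (f' & Hf' & Cf').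
    + destruct (encode_surj eg) as [c <-].
      assert (Hg' : cf (eq X) (fun _ n => g (npair n 0))).
      { exists (Comp c (Pair id_code Zero)). intros Z <- n.
        exists (npair n 0). split; [exists n, 0; repeat split; apply eval_id|].
        now apply phi_encode, He. }
      unfold rc. apply cf_pi2. exact Hg'.
    + assert (E : g (npair 0 0) = npair 0 1).
      { apply (Gr 0 [npair 0 0]); auto. reflexivity. }
      rewrite E. apply pi2_pair.
    + intros n. split.
      * rewrite <- (Hlev n) at 1. rewrite pair_pi. now apply Gd.
      * specialize (Gf 0 [npair (S n) 0] eq_refl). cbn in Gf. unfold parent in Gf at 1.
        rewrite pi1_pair, pi2_pair in Gf. change (push 0) with 0 in Gf. cbn [pred] in Gf.
        rewrite Gf by (constructor; [apply gdom_0|constructor]). unfold parent. now rewrite pi2_pair.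
    + exists f'. split; auto. now apply (rc_degree d X).
Qed.

(** * Cantor's theorem on countable dense orders *)

Record dense_order {T : Type} (P : T -> Prop) (lt : T -> T -> Prop) : Prop := {
  do_irrefl : forall x, P x -> ~ lt x x;
  do_trans : forall x y z, P x -> P y -> P z -> lt x y -> lt y z -> lt x z;
  do_total : forall x y, P x -> P y -> lt x y \/ x = y \/ lt y x;
  do_dense : forall x y, P x -> P y -> lt x y -> exists z, P z /\ lt x z /\ lt z y;
  do_above : forall x, P x -> exists y, P y /\ lt x y;
  do_below : forall x, P x -> exists y, P y /\ lt y x;
  do_inhab : exists x, P x
}.

Section Extend.
Context {T : Type} (P : T -> Prop) (lt : T -> T -> Prop) (O : dense_order P lt).

Lemma list_min l : Forall P l -> l <> [] ->
  exists m, In m l /\ forall x y, In x l -> P y -> lt y m -> lt y x.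
Proof.
  induction 1 as [|a l Ha Hl IH]; [easy|]. intros _. destruct l as [|b l].
  - exists a. split; [now left|]. intros x y [->|[]]; auto.
  - destruct IH as (m & Im & IH); [discriminate|].
    assert (Hm : P m) by (rewrite Forall_forall in Hl; auto).
    assert (Px : forall x, In x (b :: l) -> P x) by now apply Forall_forall.
    destruct (do_total _ _ O a m Ha Hm) as [L|[->|L]].
    + exists a. split; [now left|]. intros x y [<-|Hx] Hy Hmy; auto.
      apply IH; auto. apply (do_trans _ _ O y a m); auto.
    + exists m. split; [now left|]. intros x y [<-|Hx] Hy Hmy; eauto.
    + exists m. split; [now right|]. intros x y [<-|Hx] Hy Hmy; auto.
      apply (do_trans _ _ O y m a); auto.
Qed.
End Extend.

Lemma dense_order_dual {T} (P : T -> Prop) lt :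
  dense_order P lt -> dense_order P (fun x y => lt y x).
Proof.
  intros []. constructor; auto; intros x y; [intros z ? ? ? ? ?; eauto| |].
  - intros Hx Hy. destruct (do_total0 x y Hx Hy) as [H|[H|H]]; auto.
  - intros Hx Hy L. destruct (do_dense0 y x Hy Hx L) as (z & H1 & H2 & H3). eauto.
Qed.
Lemma list_max {T} (P : T -> Prop) lt l : dense_order P lt -> Forall P l -> l <> [] ->
  exists m, In m l /\ forall x y, In x l -> P y -> lt m y -> lt x y.
Proof. intros O. apply (list_min P (fun x y => lt y x)). now apply dense_order_dual. Qed.

Lemma interpolate {T} (P : T -> Prop) lt lo hi : dense_order P lt -> Forall P lo -> Forall P hi ->
  (forall x y, In x lo -> In y hi -> lt x y) ->
  exists z, P z /\ (forall x, In x lo -> lt x z) /\ (forall y, In y hi -> lt z y).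
Proof.
  intros O Hlo Hhi H. pose proof (proj1 (Forall_forall _ _) Hlo) as Plo.
  pose proof (proj1 (Forall_forall _ _) Hhi) as Phi.
  destruct (classic (lo = [])) as [->|Nlo], (classic (hi = [])) as [->|Nhi].
  - destruct (do_inhab _ _ O) as [z Hz]. exists z. simpl. tauto.
  - destruct (list_min P lt O hi Hhi Nhi) as (m & Im & Hm). destruct (do_below _ _ O m) as (z & Hz & L); auto.
    exists z. split; [exact Hz|]. split; [easy|]. intros; eauto.
  - destruct (list_max P lt lo O Hlo Nlo) as (m & Im & Hm). destruct (do_above _ _ O m) as (z & Hz & L); auto.
    exists z. split; [exact Hz|]. split; [|easy]. intros; eauto.
  - destruct (list_max P lt lo O Hlo Nlo) as (m & Im & Hm). destruct (list_min P lt O hi Hhi Nhi) as (m' & Im' & Hm').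
    destruct (do_dense _ _ O m m') as (z & Hz & L & L'); auto.
    exists z. split; [exact Hz|]. split; intros; eauto.
Qed.

Lemma sublist {T} (P : T -> Prop) l : exists l', forall x, In x l' <-> In x l /\ P x.
Proof.
  induction l as [|a l [l' IH]]; [exists []; simpl; tauto|].
  destruct (classic (P a)); [exists (a :: l')|exists l']; intros x; simpl; rewrite IH;
    intuition congruence.
Qed.

Section Cantor.
Context {A B : Type} (PA : A -> Prop) (ltA : A -> A -> Prop) (OA : dense_order PA ltA)
  (PB : B -> Prop) (ltB : B -> B -> Prop) (OB : dense_order PB ltB).

Definition partial_iso (l : list (A * B)) : Prop :=
  (forall p, In p l -> PA (fst p) /\ PB (snd p)) /\
  (forall p q, In p l -> In q l -> (ltA (fst p) (fst q) <-> ltB (snd p) (snd q))).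

Lemma partial_iso_eq l p q : partial_iso l -> In p l -> In q l -> (fst p = fst q <-> snd p = snd q).
Proof.
  intros [H1 H2] Hp Hq. destruct (H1 p Hp) as [Ap Bp], (H1 q Hq) as [Aq Bq].
  pose proof (H2 p q Hp Hq). pose proof (H2 q p Hq Hp). split; intros E.
  - destruct (do_total _ _ OB (snd p) (snd q) Bp Bq) as [L|[L|L]]; auto; exfalso;
      apply (do_irrefl _ _ OA (fst q) Aq); rewrite E in *; tauto.
  - destruct (do_total _ _ OA (fst p) (fst q) Ap Aq) as [L|[L|L]]; auto; exfalso;
      apply (do_irrefl _ _ OB (snd q) Bq); rewrite E in *; tauto.
Qed.

(** The image has to lie above the images of the elements below [a] and below the images of those
    above [a]; density and the absence of endpoints provide it. *)
Lemma partial_iso_extend l a : partial_iso l -> PA a -> exists b, partial_iso ((a, b) :: l).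
Proof.
  intros I Ha. destruct (classic (exists p, In p l /\ fst p = a)) as [(p & Hp & E)|N].
  - exists (snd p). subst a. rewrite <- surjective_pairing. destruct I as [H1 H2].
    assert (S : forall q, In q (p :: l) -> In q l) by (intros q [<-|]; auto).
    split; auto.
  - destruct I as [H1 H2].
    assert (Sub : forall Q : A -> Prop, exists m, forall y, In y m <-> exists p, In p l /\ Q (fst p) /\ y = snd p).
    { intros Q. destruct (sublist (fun p => Q (fst p)) l) as [m Hm]. exists (map snd m).
      intros y. rewrite in_map_iff. setoid_rewrite Hm. firstorder. }
    destruct (Sub (fun x => ltA x a)) as [lo Ilo]. destruct (Sub (ltA a)) as [hi Ihi].
    destruct (interpolate PB ltB lo hi OB) as (b & Hb & L1 & L2).
    + apply Forall_forall. intros y Hy. apply Ilo in Hy as (p & Hp & _ & ->). now apply H1.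
    + apply Forall_forall. intros y Hy. apply Ihi in Hy as (p & Hp & _ & ->). now apply H1.
    + intros y y' Hy Hy'. apply Ilo in Hy as (p & Hp & L & ->). apply Ihi in Hy' as (q & Hq & L' & ->).
      apply H2; auto. apply (do_trans _ _ OA _ a); auto; now apply H1.
    + exists b. assert (F : forall p, In p l -> (ltA (fst p) a <-> ltB (snd p) b) /\ (ltA a (fst p) <-> ltB b (snd p))).
      { intros p Hp. destruct (H1 p Hp) as [Ap Bp].
        assert (N1 : ltB (snd p) b -> ~ ltB b (snd p)).
        { intros X Y. apply (do_irrefl _ _ OB b Hb). apply (do_trans _ _ OB b (snd p) b); auto. }
        assert (N2 : ltA (fst p) a -> ~ ltA a (fst p)).
        { intros X Y. apply (do_irrefl _ _ OA a Ha). apply (do_trans _ _ OA a (fst p) a); auto. }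
        assert (X1 : ltA (fst p) a -> ltB (snd p) b) by (intros; apply L1, Ilo; eauto).
        assert (X2 : ltA a (fst p) -> ltB b (snd p)) by (intros; apply L2, Ihi; eauto).
        destruct (do_total _ _ OA (fst p) a Ap Ha) as [L|[L|L]]; [|exfalso; eauto|]; tauto. }
      split.
      * intros p [<-|Hp]; auto.
      * intros p q [<-|Hp] [<-|Hq]; simpl; auto; try now apply F.
        split; intros L; exfalso; [apply (do_irrefl _ _ OA a)|apply (do_irrefl _ _ OB b)]; auto.
Qed.
End Cantor.

Definition swap {A B} (p : A * B) : B * A := (snd p, fst p).
Lemma partial_iso_swap {A B} (PA : A -> Prop) ltA (PB : B -> Prop) ltB l :
  partial_iso PA ltA PB ltB l -> partial_iso PB ltB PA ltA (map swap l).
Proof.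
  intros [H1 H2]. split.
  - intros p Hp. apply in_map_iff in Hp as (q & <- & Hq). simpl. now apply and_comm, H1.
  - intros p q Hp Hq. apply in_map_iff in Hp as (p' & <- & Hp'). apply in_map_iff in Hq as (q' & <- & Hq').
    simpl. symmetry. auto.
Qed.
Lemma swap_swap {A B} (l : list (A * B)) : map swap (map swap l) = l.
Proof. rewrite map_map. rewrite <- map_id. apply map_ext. intros []; reflexivity. Qed.

Theorem cantor_isomorphism {A B : Type} (PA : A -> Prop) (ltA : A -> A -> Prop) (ea : nat -> A)
    (PB : B -> Prop) (ltB : B -> B -> Prop) (eb : nat -> B) :
  dense_order PA ltA -> dense_order PB ltB ->
  (forall a, PA a -> exists n, ea n = a) -> (forall b, PB b -> exists n, eb n = b) ->
  order_iso {| odom := PA; olt := ltA |} {| odom := PB; olt := ltB |}.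
Proof.
  intros OA OB Ea Eb. set (I := partial_iso PA ltA PB ltB).
  (* The invariant is a premise because dependent choice requires a total relation. The enumerations
     may leave the orders, hence the conditions [PA] and [PB]. *)
  assert (step : forall n l, exists l', I l -> I l' /\ incl l l' /\
    (PA (ea n) -> exists b, In (ea n, b) l') /\ (PB (eb n) -> exists a, In (a, eb n) l')).
  { intros n l. destruct (classic (I l)) as [Hl|]; [|exists l; tauto].
    assert (H1 : exists l1, I l1 /\ incl l l1 /\ (PA (ea n) -> exists b, In (ea n, b) l1)).
    { destruct (classic (PA (ea n))) as [Ha|]; [|exists l; repeat split; auto; try apply incl_refl; try apply Hl; tauto].
      destruct (partial_iso_extend PA ltA OA PB ltB OB l (ea n) Hl Ha) as [b Hb].
      exists ((ea n, b) :: l). split; [exact Hb|]. split; [apply incl_tl, incl_refl|].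
      intros _. exists b. now left. }
    destruct H1 as (l1 & I1 & S1 & T1).
    destruct (classic (PB (eb n))) as [Hb|]; [|exists l1; tauto].
    destruct (partial_iso_extend PB ltB OB PA ltA OA _ (eb n) (partial_iso_swap _ _ _ _ _ I1) Hb) as [a Ha].
    exists ((a, eb n) :: l1). intros _. apply partial_iso_swap in Ha. cbn [map] in Ha.
    rewrite swap_swap in Ha. split; [exact Ha|]. split; [now apply incl_tl|]. split.
    - intros P. destruct (T1 P) as [b Hb']. exists b. now right.
    - intros _. exists a. now left. }
  destruct (dependent_choice [] step) as (l & L0 & L).
  assert (Il : forall n, I (l n)).
  { induction n as [|n IH]; [|now apply L]. rewrite L0. split; simpl; tauto. }
  assert (M : forall n m, n <= m -> incl (l n) (l m)).
  { intros n m H. induction H; [apply incl_refl|]. eapply incl_tran; [exact IHle|]. now apply L. }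
  assert (J : forall a b n a' b' m, In (a, b) (l n) -> In (a', b') (l m) ->
     PA a /\ PB b /\ (ltA a a' <-> ltB b b') /\ (a = a' <-> b = b')).
  { intros a b n a' b' m H H'. apply (M n (n + m)) in H; [|lia]. apply (M m (n + m)) in H'; [|lia].
    pose proof (Il (n + m)) as Hi. pose proof Hi as [H1 H2].
    pose proof (partial_iso_eq PA ltA OA PB ltB OB _ _ _ Hi H H') as E. specialize (H2 _ _ H H').
    specialize (H1 _ H). simpl in *. tauto. }
  assert (TA : forall a, PA a -> exists b n, In (a, b) (l n)).
  { intros a Ha. destruct (Ea a Ha) as [n <-]. destruct (L n) as (_ & _ & T & _); auto.
    destruct (T Ha) as [b Hb]. eauto. }
  destruct (do_inhab _ _ OB) as [b0 _].
  set (f := fun a => match excluded_middle_informative (exists b n, In (a, b) (l n)) with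
     | left H => proj1_sig (constructive_indefinite_description _ H) | right _ => b0 end).
  assert (F : forall a, PA a -> exists n, In (a, f a) (l n)).
  { intros a Ha. unfold f. destruct excluded_middle_informative as [H|H]; [apply proj2_sig|].
    exfalso. auto. }
  exists f. split; [|split; [|split]]; cbn [odom olt].
  - intros a Ha. destruct (F a Ha) as [n Hn]. now apply (J _ _ _ _ _ _ Hn Hn).
  - intros a a' Ha Ha' E. destruct (F a Ha) as [n Hn], (F a' Ha') as [m Hm].
    now apply (J _ _ _ _ _ _ Hn Hm).
  - intros b Hb. destruct (Eb b Hb) as [n <-]. destruct (L n) as (_ & _ & _ & T); auto.
    destruct (T Hb) as [a Hn]. exists a.
    assert (Ha : PA a) by apply (J _ _ _ _ _ _ Hn Hn). split; auto.
    destruct (F a Ha) as [m Hm]. now apply (J _ _ _ _ _ _ Hm Hn).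
  - intros a a' Ha Ha'. destruct (F a Ha) as [n Hn], (F a' Ha') as [m Hm].
    now apply (J _ _ _ _ _ _ Hn Hm).
Qed.

(** * The rationals as a countable dense order *)

Lemma Q2Qc_gt (x : Qc) q : (this x < q)%Q -> Qclt x (Q2Qc q).
Proof. unfold Qclt. change (this (Q2Qc q)) with (Qred q). now rewrite Qred_correct. Qed.
Lemma Q2Qc_lt (x : Qc) q : (q < this x)%Q -> Qclt (Q2Qc q) x.
Proof. unfold Qclt. change (this (Q2Qc q)) with (Qred q). now rewrite Qred_correct. Qed.

Lemma Qc_dense : dense_order (fun _ : Qc => True) Qclt.
Proof.
  constructor; auto.
  - intros x _ H. apply Qclt_not_eq in H. auto.
  - intros x y z _ _ _. apply Qclt_trans.
  - intros x y _ _. destruct (Qc_dec x y) as [[H|H]|H]; auto.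
  - intros x y _ _ H. exists (Q2Qc ((this x + this y) * (1 # 2))). split; auto.
    unfold Qclt in H. split; [apply Q2Qc_gt|apply Q2Qc_lt].
    + setoid_replace (this x) with ((this x + this x) * (1 # 2))%Q at 1 by ring.
      apply Qmult_lt_r; [reflexivity|]. now apply Qplus_lt_r.
    + setoid_replace (this y) with ((this y + this y) * (1 # 2))%Q at 2 by ring.
      apply Qmult_lt_r; [reflexivity|]. now apply Qplus_lt_l.
  - intros x _. exists (Q2Qc (this x + 1)). split; auto. apply Q2Qc_gt.
    rewrite <- (Qplus_0_r (this x)) at 1. apply Qplus_lt_r. reflexivity.
  - intros x _. exists (Q2Qc (this x + -1)). split; auto. apply Q2Qc_lt.
    rewrite <- (Qplus_0_r (this x)) at 2. apply Qplus_lt_r. reflexivity.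
  - now exists 0%Qc.
Qed.

Definition Qc_enum (n : nat) : Qc :=
  let (a, r) := Cantor.of_nat n in let (b, c) := Cantor.of_nat r in
  Q2Qc ((Z.of_nat a - Z.of_nat b) # Pos.of_nat c).
Lemma Qc_enum_surj x : exists n, Qc_enum n = x.
Proof.
  destruct (this x) as [z p] eqn:E.
  exists (Cantor.to_nat (Z.to_nat z, Cantor.to_nat (Z.to_nat (- z), Pos.to_nat p))).
  unfold Qc_enum. rewrite !Cantor.cancel_of_to, Pos2Nat.id.
  replace (Z.of_nat (Z.to_nat z) - Z.of_nat (Z.to_nat (- z)))%Z with z by lia.
  rewrite <- E. apply Qc_is_canon. simpl. apply Qred_correct.
Qed.

(** * Powers of two of linear orders *)

Inductive lexlt {T : Type} (R : T -> T -> Prop) : list T -> list T -> Prop :=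
| lex_nil x l : lexlt R [] (x :: l)
| lex_lt x y l m : R x y -> lexlt R (x :: l) (y :: m)
| lex_eq x l m : lexlt R l m -> lexlt R (x :: l) (x :: m).
Arguments lex_nil {T R}.
Arguments lex_lt {T R}.
Arguments lex_eq {T R}.

Lemma lexlt_irrefl {T} (R : T -> T -> Prop) l : Forall (fun x => ~ R x x) l -> ~ lexlt R l l.
Proof. induction 1; intros H'; inversion H'; subst; auto. Qed.
Lemma lexlt_trans {T} (R : T -> T -> Prop) (P : T -> Prop) :
  (forall x y z, P x -> P y -> P z -> R x y -> R y z -> R x z) ->
  forall l m n, Forall P l -> Forall P m -> Forall P n ->
  lexlt R l m -> lexlt R m n -> lexlt R l n.
Proof.
  intros Ht l m n Hl Hm Hn H. revert n Hl Hm Hn.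
  induction H as [y m|x y l m H|x l m H IH]; intros n Hl Hm Hn H'.
  - inversion H'; constructor.
  - inversion H' as [|? z ? p R1|? ? p R1]; subst; apply lex_lt; auto.
    inversion Hl; inversion Hm; inversion Hn; subst. apply (Ht x y z); auto.
  - inversion H' as [|? z ? p R1|? ? p R1]; subst; [now apply lex_lt|apply lex_eq].
    apply IH; auto; [now inversion Hl|now inversion Hm|now inversion Hn].
Qed.
Lemma lexlt_total {T} (R : T -> T -> Prop) (P : T -> Prop) :
  (forall x y, P x -> P y -> R x y \/ x = y \/ R y x) ->
  forall l m, Forall P l -> Forall P m -> lexlt R l m \/ l = m \/ lexlt R m l.
Proof.
  intros Ht l. induction l as [|x l IH]; intros [|y m] Hl Hm; auto using lex_nil.
  inversion Hl; inversion Hm; subst.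
  destruct (Ht x y) as [H|[->|H]]; auto using lex_lt.
  destruct (IH m) as [H|[->|H]]; auto using lex_eq.
Qed.
(** All quantifiers are bounded here, so decidability on coded lists can be read off. The case
    [i = length l] is that of a proper prefix. *)
Lemma lexlt_first_difference (R : nat -> nat -> Prop) l : forall m, lexlt R l m <->
  exists i, i <= length l /\ i < length m /\ (forall j, j < i -> nth j l 0 = nth j m 0) /\
    (i = length l \/ (i < length l /\ R (nth i l 0) (nth i m 0))).
Proof.
  induction l as [|x l IH]; intros m.
  - split.
    + intros H; inversion H; subst. exists 0. simpl. repeat split; auto; lia.
    + intros (i & H1 & H2 & _). simpl in H1. destruct m; simpl in H2; [lia|constructor].
  - destruct m as [|y m].
    + split; [intros H; inversion H|]. intros (i & _ & H & _). simpl in H. lia.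
    + split.
      * intros H. inversion H; subst.
        -- exists 0. simpl. repeat split; try lia. auto with arith.
        -- apply IH in H1 as (i & H1 & H2 & H3 & H4). exists (S i). simpl.
           split; [lia|]. split; [lia|]. split.
           ++ intros [|j] Hj; auto. apply H3. lia.
           ++ destruct H4 as [->|[H4 H5]]; [now left|right; split; auto; lia].
      * intros (i & H1 & H2 & H3 & H4). simpl in H1, H2. destruct i as [|i].
        -- destruct H4 as [H4|[_ H4]]; [discriminate|]. now constructor.
        -- specialize (H3 0 ltac:(lia)) as E. simpl in E. subst y. apply lex_eq.
           apply IH. exists i. repeat split; try lia.
           ++ intros j Hj. apply (H3 (S j)). lia.
           ++ simpl in H4. destruct H4 as [H4|[H4 H5]]; [left; lia|right; split; auto; lia].
Qed.

Section Pow2.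
Variable L : order nat.
Hypothesis HL : linear L.

Fixpoint desc (l : list nat) : Prop :=
  match l with
  | [] => True
  | x :: l' => odom L x /\ Forall (fun y => olt L y x) l' /\ desc l'
  end.
Lemma desc_odom l : desc l -> Forall (odom L) l.
Proof. induction l; simpl; auto. intros (H1 & H2 & H3). auto. Qed.

(** A descending list stands for the sum of the powers of 2 with these exponents, a Cantor normal
    form to the base 2. *)
Definition pow2 : order nat :=
  {| odom := fun h => desc (list_of h);
     olt := fun h h' => lexlt (olt L) (list_of h) (list_of h') |}.

Lemma list_of_inj a b : list_of a = list_of b -> a = b.
Proof. intros H. now rewrite <- (tuple_code_list_of a), H, tuple_code_list_of. Qed.

Lemma pow2_linear : linear pow2.
Proof.
  destruct HL as (H1 & H2 & H3). split; [|split]; cbn.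
  - intros x Hx. apply lexlt_irrefl. eapply Forall_impl; [|apply desc_odom, Hx]. auto.
  - intros x y z Hx Hy Hz. apply lexlt_trans with (P := odom L); auto using desc_odom.
  - intros x y Hx Hy.
    destruct (lexlt_total (olt L) (odom L) H3 (list_of x) (list_of y)) as [H|[H|H]];
      auto using desc_odom. right; left. now apply list_of_inj.
Qed.

Definition Lrel (x y : nat) : Prop := odom L x /\ odom L y /\ olt L x y.
Definition std (x : nat) : Prop := odom L x /\ Acc Lrel x.
Definition nonstd (x : nat) : Prop := odom L x /\ ~ Acc Lrel x.

Lemma std_below x y : std x -> odom L y -> olt L y x -> std y.
Proof. intros [H1 H2] H3 H4. split; auto. apply (Acc_inv H2). repeat split; auto. Qed.
Lemma std_lt_nonstd x y : std x -> nonstd y -> olt L x y.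
Proof.
  intros [H1 H2] [H3 H4]. destruct HL as (_ & _ & T).
  destruct (T x y H1 H3) as [H|[->|H]]; auto; exfalso; auto. apply H4.
  apply (Acc_inv H2). repeat split; auto.
Qed.
Lemma nonstd_below x : nonstd x -> exists y, nonstd y /\ olt L y x.
Proof.
  intros [H1 H2]. apply NNPP. intros N. apply H2. constructor. intros y (Hy & _ & Hl).
  apply NNPP. intros N'. apply N. exists y. repeat split; auto.
Qed.

Lemma desc_app l m : desc (l ++ m) <->
  desc l /\ desc m /\ forall x y, In x l -> In y m -> olt L y x.
Proof.
  induction l as [|a l IH]; simpl; [intuition easy|]. rewrite IH, Forall_app, !Forall_forall.
  split.
  - intros (H1 & [H2 H3] & H4 & H5 & H6). repeat split; auto. intros x y [<-|Hx] Hy; auto.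
  - intros ((H1 & H2 & H3) & H4 & H5). split; auto. split; [split; auto|]. auto.
Qed.

(** The standard part is closed downwards, so once a descending list has become standard it remains
    so. *)
Lemma desc_split l : desc l -> exists hi lo, l = hi ++ lo /\ Forall nonstd hi /\ Forall std lo.
Proof.
  induction l as [|x l IH]; intros H.
  - exists [], []. auto.
  - destruct H as (H1 & H2 & H3). destruct (classic (Acc Lrel x)) as [A|N].
    + exists [], (x :: l). split; auto. split; auto. constructor; [split; auto|].
      apply Forall_forall. intros y Hy. rewrite Forall_forall in H2.
      apply (std_below x); [split; auto| |auto].
      pose proof (desc_odom l H3) as D. rewrite Forall_forall in D. auto.
    + destruct (IH H3) as (hi & lo & -> & Hh & Hl). exists (x :: hi), lo.
      split; auto. split; auto. constructor; auto. split; auto.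
Qed.
(** Standard entries lie below nonstandard ones, so the nonstandard parts are compared first. This
    exhibits [2^L] as a sum of copies of its standard part, indexed by the nonstandard lists. *)
Lemma lexlt_split hi : forall lo hi' lo', Forall nonstd hi -> Forall nonstd hi' ->
  Forall std lo -> Forall std lo' ->
  (lexlt (olt L) (hi ++ lo) (hi' ++ lo') <->
   lexlt (olt L) hi hi' \/ (hi = hi' /\ lexlt (olt L) lo lo')).
Proof.
  pose proof HL as (I & T & _).
  induction hi as [|x hi IH]; intros lo [|y hi'] lo' H1 H2 H3 H4; simpl.
  - split; auto. intros [H|[_ H]]; auto. inversion H.
  - split; [intros _; left; constructor|]. intros _. destruct lo as [|x lo]; constructor.
    inversion H3; inversion H2; subst. now apply std_lt_nonstd.
  - split; [|intros [H|[H _]]; [inversion H|discriminate]].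
    intros H. exfalso. destruct lo' as [|y lo']; [inversion H|].
    assert (S1 : std y) by now inversion H4. assert (N1 : nonstd x) by now inversion H1.
    pose proof (std_lt_nonstd y x S1 N1) as Q. destruct S1 as [S1 S2], N1 as [N1 N2].
    inversion H; subst; auto. apply (I x); auto. apply (T x y x); auto.
  - assert (N1 : Forall nonstd hi) by now inversion H1.
    assert (N2 : Forall nonstd hi') by now inversion H2. split.
    + intros H. inversion H as [|? ? ? ? Q|? ? ? Q]; subst; [left; now apply lex_lt|].
      apply IH in Q; auto. destruct Q as [Q|[-> Q]]; [left; now apply lex_eq|auto].
    + intros [H|[H H']].
      * inversion H; subst; [now apply lex_lt|apply lex_eq, IH; auto].
      * injection H as -> ->. apply lex_eq, IH; auto.
Qed.

Lemma split_unique hi : forall lo hi' lo', Forall nonstd hi -> Forall nonstd hi' ->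
  Forall std lo -> Forall std lo' -> hi ++ lo = hi' ++ lo' -> hi' = hi /\ lo' = lo.
Proof.
  assert (N : forall x, nonstd x -> std x -> False) by (intros x [_ H] [_ H']; auto).
  induction hi as [|a hi IH]; intros lo [|b hi'] lo' H1 H2 H3 H4 E; simpl in E; auto.
  - exfalso. rewrite E in H3. apply (N b); [now inversion H2|now inversion H3].
  - exfalso. rewrite <- E in H4. apply (N a); [now inversion H1|now inversion H4].
  - injection E as -> E. destruct (IH lo hi' lo') as [-> ->]; auto; [now inversion H1|now inversion H2].
Qed.

Definition high (l : list nat) : Prop := desc l /\ Forall nonstd l.
Definition low (l : list nat) : Prop := desc l /\ Forall std l.

Lemma nonstd_lower_bound l : (exists r, nonstd r) -> Forall nonstd l ->
  exists r, nonstd r /\ Forall (fun x => olt L r x) l.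
Proof.
  intros [r0 Hr0]. induction 1 as [|x l Hx Hl IH]; [eauto|].
  destruct IH as (r & Hr & H). pose proof HL as (_ & T & To).
  assert (G : exists s, nonstd s /\ olt L s x /\ (s = r \/ olt L s r)).
  { destruct (To r x (proj1 Hr) (proj1 Hx)) as [Q|[->|Q]].
    - exists r; auto.
    - destruct (nonstd_below x Hx) as (s & Hs & Q). exists s; auto.
    - destruct (nonstd_below x Hx) as (s & Hs & Q'). exists s. split; auto. split; auto.
      right. apply (T s x r); auto; [apply Hs|apply Hx|apply Hr]. }
  destruct G as (s & Hs & Q & Q'). exists s. split; auto. constructor; auto.
  destruct Q' as [->|Q']; auto. rewrite Forall_forall in *. intros y Hy.
  apply (T s r y); auto; [apply Hs|apply Hr|apply Hl, Hy].
Qed.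

Lemma high_snoc l r : high l -> nonstd r -> Forall (fun x => olt L r x) l -> high (l ++ [r]).
Proof.
  intros [H1 H2] Hr H. rewrite Forall_forall in H.
  split; [|apply Forall_app; auto]. apply desc_app.
  split; [exact H1|]. split; [repeat split; auto; apply Hr|].
  intros x y Hx [<-|[]]. auto.
Qed.
Lemma lexlt_snoc l r : lexlt (olt L) l (l ++ [r]).
Proof. induction l; simpl; [apply lex_nil|now apply lex_eq]. Qed.

(** There is no least nonstandard element, so a list can be prolonged by an entry [r] below any
    given ones, which moves it upwards without passing a given larger list. One-entry lists with a
    small entry show that no nonempty list is least. *)
Lemma high_dense : (exists r, nonstd r) ->
  dense_order (fun l => high l /\ l <> []) (lexlt (olt L)).
Proof.
  intros Hex. pose proof HL as (I & T & To).
  assert (F : forall l, high l -> Forall (odom L) l) by (intros l [H _]; now apply desc_odom).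
  constructor.
  - intros x [Hx _]. apply lexlt_irrefl. eapply Forall_impl; [|apply F, Hx]. auto.
  - intros x y z [Hx _] [Hy _] [Hz _]. apply lexlt_trans with (P := odom L); auto.
  - intros x y [Hx _] [Hy _]. apply (lexlt_total _ (odom L)); auto.
  - intros x y [Hx Nx] [Hy _] H.
    destruct (nonstd_lower_bound (x ++ y) Hex) as (r & Hr & B).
    { apply Forall_app. split; [apply Hx|apply Hy]. }
    apply Forall_app in B as [Bx By]. exists (x ++ [r]). split; [split|split].
    + now apply high_snoc.
    + now destruct x.
    + apply lexlt_snoc.
    + clear - H By. induction H; simpl.
      * constructor. now inversion By.
      * now constructor.
      * apply lex_eq, IHlexlt. now inversion By.
  - intros x [Hx _]. destruct (nonstd_lower_bound x Hex) as (r & Hr & B); [apply Hx|].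
    exists (x ++ [r]). split; [split; [now apply high_snoc|now destruct x]|apply lexlt_snoc].
  - intros [|a x] [Hx Nx]; [easy|]. destruct (nonstd_below a) as (r & Hr & B).
    { destruct Hx as [_ Hx]. now inversion Hx. }
    exists [r]. split; [split; [split|discriminate]|now constructor]; auto.
    split; [apply Hr|simpl; auto].
  - destruct Hex as [r Hr]. exists [r]. split; [split|discriminate]; auto.
    split; [apply Hr|simpl; auto].
Qed.

(** The empty list is the least one and becomes the 1 of [1 + Q]. *)
Lemma high_iso : (exists r, nonstd r) -> exists g : list nat -> option Qc,
  (forall l m, high l -> high m -> g l = g m -> l = m) /\
  (forall q, exists l, high l /\ g l = q) /\
  (forall l m, high l -> high m -> (lexlt (olt L) l m <-> olt one_plus_Q (g l) (g m))).
Proof.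
  intros Hex.
  destruct (cantor_isomorphism (fun l => high l /\ l <> []) (lexlt (olt L)) list_of
     (fun _ : Qc => True) Qclt Qc_enum (high_dense Hex) Qc_dense) as (f & F1 & F2 & F3 & F4).
  { intros l _. exists (tuple_code l). apply list_of_tuple_code. }
  { intros q _. apply Qc_enum_surj. }
  cbn [odom olt] in *.
  exists (fun l => match l with [] => None | _ => Some (f l) end). split; [|split].
  - intros [|a l] [|b m] Hl Hm E; try discriminate; auto. injection E as E.
    apply F2; auto; split; auto; discriminate.
  - intros [q|].
    + destruct (F3 q Logic.I) as (l & [Hl Nl] & E). exists l. split; auto.
      destruct l; [easy|]. now rewrite E.
    + exists []. split; auto. split; simpl; auto.
  - intros [|a l] [|b m] Hl Hm; cbn.
    + split; [intros H; inversion H|easy].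
    + split; auto. intros; constructor.
    + split; [intros H; inversion H|easy].
    + apply F4; split; auto; discriminate.
Qed.

(** Induction on the first entry and, for a fixed first entry, on the rest of the list, which is
    accessible by the outer induction because its entries are smaller. *)
Lemma low_acc l : low l -> Acc (fun m m' => low m /\ low m' /\ lexlt (olt L) m m') l.
Proof.
  set (R := fun m m' => low m /\ low m' /\ lexlt (olt L) m m').
  assert (N : Acc R []) by (constructor; intros m (_ & _ & H); inversion H).
  assert (G : forall y, Acc Lrel y -> odom L y -> forall l, low (y :: l) -> Acc R (y :: l)).
  { induction 1 as [y Ay IH]. intros Oy.
    assert (B : forall l, low l -> Forall (fun z => olt L z y) l -> Acc R l).
    { clear l. intros [|z l] Hl Hz; auto. inversion Hz; subst.
      assert (Oz : odom L z) by apply Hl. apply IH; auto. repeat split; auto. }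
    clear l. intros l Hl. assert (Hl' : low l).
    { destruct Hl as [(_ & _ & D) S]. split; auto. now inversion S. }
    assert (Al : Acc R l) by (apply B; auto; apply Hl).
    revert Hl Hl'. induction Al as [l _ IHl]. intros Hl Hl'. constructor.
    intros m (Hm & _ & H). inversion H; subst; auto.
    - apply IH; auto; [|apply Hm]. repeat split; auto. apply Hm.
    - assert (Hl0 : low l0).
      { destruct Hm as [(_ & _ & D) S]. split; auto. now inversion S. }
      apply IHl; auto. split; auto. }
  intros Hl. destruct l as [|y l]; auto. apply G; auto.
  - destruct Hl as [_ S]. inversion S; subst. apply H1.
  - apply Hl.
Qed.

Definition low_order : order nat :=
  {| odom := fun h => low (list_of h); olt := olt pow2 |}.

Lemma low_order_wf : wf_order low_order.
Proof.
  intros h. cbn. constructor. intros g (Hg & _ & _).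
  pose proof (low_acc _ Hg) as A. remember (list_of g) as l eqn:E. revert g E Hg.
  induction A as [l _ IH]. intros g -> Hg. constructor. intros f (Hf & _ & H).
  eapply IH; eauto.
Qed.

Lemma low_below h g : low (list_of h) -> odom pow2 g -> olt pow2 g h -> low (list_of g).
Proof.
  cbn. intros [D S] Dg H. split; auto. revert Dg S D. induction H; intros Dg S D; auto.
  - inversion S; subst. destruct Dg as (D1 & D2 & D3).
    assert (Sx : std x) by (apply (std_below y); auto). constructor; auto.
    apply Forall_forall. intros z Hz. rewrite Forall_forall in D2.
    pose proof (desc_odom l D3) as Dl. rewrite Forall_forall in Dl.
    apply (std_below x); auto.
  - inversion S; subst. constructor; auto. apply IHlexlt; auto; [apply Dg|apply D].
Qed.

(** The standard part of [2^L] is well-founded, and its proper initial segments are initial segments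
    of a computable order. A computable copy of it would receive the standard part of [L] through
    one-entry lists, contrary to the last premise. *)
Theorem pow2_harrison eH : is_order_index eH pow2 ->
  (forall a, exists e, is_order_index e (below pow2 a)) ->
  (exists r, nonstd r) ->
  (forall P, computable_linear_order P -> wf_order P -> ~ exists h : nat -> nat,
     (forall x, std x -> odom P (h x)) /\
     (forall x y, std x -> std y -> olt L y x -> olt P (h y) (h x))) ->
  harrison_order pow2.
Proof.
  intros He Hb Hex Hno. pose proof pow2_linear as HP. split; [split; eauto|].
  exists low_order. split.
  - split; [|split; [|split]].
    + destruct HP as (P1 & P2 & P3). split; [|split]; cbn.
      * intros x [Hx _]. now apply P1.
      * intros x y z [Hx _] [Hy _] [Hz _]. now apply P2.
      * intros x y [Hx _] [Hy _]. now apply P3.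
    + exact low_order_wf.
    + intros a Ha. exists (below pow2 a). split.
      * split; [|apply Hb]. destruct HP as (P1 & P2 & P3). split; [|split]; cbn.
        -- intros x [Hx _]. now apply P1.
        -- intros x y z [Hx _] [Hy _] [Hz _]. now apply P2.
        -- intros x y [Hx _] [Hy _]. now apply P3.
      * exists (fun x => x). split; [|split; [|split]].
        -- intros x [Hx Hl]. split; auto. now apply (low_below a).
        -- auto.
        -- intros y [Hy Hl]. exists y. split; auto. split; auto. apply Hy.
        -- cbn. tauto.
    + intros (P & CP & f & F1 & F2 & F3 & F4). pose proof (proj1 CP) as LP.
      apply (Hno P CP).
      * intros x. cbn. constructor. intros y (Hy & _ & _). pose proof (low_order_wf (f y)) as A.
        remember (f y) as z eqn:E. revert y E Hy. induction A as [z _ IH].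
        intros y -> Hy. constructor. intros w (Hw & _ & H). eapply IH; [|reflexivity|auto].
        split; [now apply F1|]. split; [now apply F1|]. now apply F4.
      * assert (G : forall x, exists y, std x -> odom P y /\ f y = tuple_code [x]).
        { intros x. destruct (classic (std x)) as [Hx|]; [|exists 0; tauto].
          destruct (F3 (tuple_code [x])) as (y & Hy); [|eauto]. cbn [odom low_order].
          rewrite list_of_tuple_code. split; auto. split; [apply Hx|simpl; auto]. }
        apply choice in G as [h Hh]. exists h. split; [intros x Hx; now apply Hh|].
        intros x y Hx Hy H. destruct (Hh x Hx) as [X1 X2], (Hh y Hy) as [Y1 Y2].
        apply F4; auto. rewrite X2, Y2. cbn [olt low_order pow2].
        rewrite !list_of_tuple_code. now constructor.
  - destruct (high_iso Hex) as (g & G1 & G2 & G3).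
    assert (Sp : forall h, exists p : list nat * list nat, desc (list_of h) ->
       list_of h = fst p ++ snd p /\ Forall nonstd (fst p) /\ Forall std (snd p)).
    { intros h. destruct (classic (desc (list_of h))) as [H|]; [|exists ([], []); tauto].
      destruct (desc_split _ H) as (hi & lo & H'). exists (hi, lo). auto. }
    apply choice in Sp as [s Hs].
    assert (Hs' : forall h, desc (list_of h) -> list_of h = fst (s h) ++ snd (s h) /\
      high (fst (s h)) /\ low (snd (s h))).
    { intros h Hh. destruct (Hs h Hh) as (E & N & S). split; auto. rewrite E in Hh.
      apply desc_app in Hh as (D1 & D2 & _). split; split; auto. }
    (* The nonstandard part of a list selects the copy, the standard part the place in it. *)
    exists (fun h => (tuple_code (snd (s h)), g (fst (s h)))). split; [|split; [|split]].
    + intros h Hh. destruct (Hs' h Hh) as (_ & _ & Hl). split; cbn [fst snd odom low_order one_plus_Q]; auto.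
      now rewrite list_of_tuple_code.
    + intros x y Hx Hy E. destruct (Hs' x Hx) as (Ex & Hhx & Hlx), (Hs' y Hy) as (Ey & Hhy & Hly).
      injection E as E1 E2. apply list_of_inj. rewrite Ex, Ey.
      apply tuple_code_inj in E1. rewrite E1. f_equal. now apply G1.
    + intros [w q] [Hw _]. cbn [fst snd odom low_order] in Hw. destruct (G2 q) as (hi & Hhi & <-).
      set (h := tuple_code (hi ++ list_of w)).
      assert (Dh : desc (list_of h)).
      { unfold h. rewrite list_of_tuple_code. apply desc_app. split; [apply Hhi|]. split; [apply Hw|].
        intros x y Hx Hy. apply std_lt_nonstd.
        - destruct Hw as [_ Hw]. rewrite Forall_forall in Hw. auto.
        - destruct Hhi as [_ Hhi]. rewrite Forall_forall in Hhi. auto. }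
      exists h. split; [exact Dh|]. destruct (Hs' h Dh) as (E & Hh & Hl).
      assert (U : fst (s h) = hi /\ snd (s h) = list_of w).
      { unfold h in E at 1. rewrite list_of_tuple_code in E. destruct Hh as [_ Hh], Hl as [_ Hl].
        destruct Hhi as [_ Hhi], Hw as [_ Hw]. apply split_unique; auto. }
      destruct U as [-> ->]. now rewrite tuple_code_list_of.
    + intros x y Hx Hy. destruct (Hs' x Hx) as (Ex & Hhx & Hlx), (Hs' y Hy) as (Ey & Hhy & Hly).
      cbn [olt pow2 order_prod fst snd low_order]. rewrite !list_of_tuple_code, Ex, Ey.
      rewrite lexlt_split; [|apply Hhx|apply Hhy|apply Hlx|apply Hly].
      rewrite <- G3 by auto. split; intros [H|[H1 H2]]; auto.
      * right. split; auto. now rewrite H1.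
Qed.
End Pow2.

(** * The Kleene-Brouwer order of a universal tree *)

(** A node is a list of entries, the entry at level [i] being [npair y b]. If [b = 0],
    then from the next level on the node has to follow the [i]-th transition system,
    and [cnth j y] is the next state, with a certificate, in the [j]-th system. The
    systems are that with index [pi1 k] and initial state [pi2 k], followed by all. *)
Definition sys (k j : nat) : nat := if j =? 0 then pi1 k else pi1 (pred j).
Definition sys_init (k j : nat) : nat := if j =? 0 then pi2 k else pi2 (pred j).
Definition choice_at (j v : nat) : nat := cnth j (pi1 v).
(** Entry [j] decides whether the system [j] is followed, so its first move is recorded at level
    [S j] and leaves from the initial state. Later moves leave from the state chosen one level
    before. *)
Definition state_at (k x i j : nat) : nat :=
  if i =? S j then sys_init k j else pi1 (choice_at j (cnth (pred i) x)).
Definition trb (k x : nat) : bool :=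
  ball (clen x) (fun i => ball i (fun j => negb (pi2 (cnth j x) =? 0) ||
    edge_cert (sys k j) (state_at k x i j)
      (pi1 (choice_at j (cnth i x))) (pi2 (choice_at j (cnth i x))))).

Section Tree.
Variable k : nat.

Definition tr (x : list nat) : Prop := trb k (tuple_code x) = true.
Definition state (x : list nat) (j : nat) : nat :=
  if length x =? S j then sys_init k j else pi1 (choice_at j (nth (pred (length x)) x 0)).
Definition ok (x : list nat) (v : nat) : Prop := forall j, j < length x ->
  pi2 (nth j x 0) <> 0 \/
  edge_cert (sys k j) (state x j) (pi1 (choice_at j v)) (pi2 (choice_at j v)) = true.

Lemma nth_snoc (x : list nat) v : nth (length x) (x ++ [v]) 0 = v.
Proof. rewrite app_nth2 by auto. now rewrite Nat.sub_diag. Qed.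
Lemma tr_nil : tr [].
Proof. reflexivity. Qed.
Lemma tr_snoc x v : tr (x ++ [v]) <-> tr x /\ ok x v.
Proof.
  unfold tr, trb, ok. rewrite !ball_true, !clen_code, length_app, Nat.add_1_r.
  assert (E : forall i, i < length x -> nth i (x ++ [v]) 0 = nth i x 0) by (intros; now apply app_nth1).
  assert (Q : forall i (b c : bool), (negb (i =? 0) || b = true) <-> (i <> 0 \/ b = true)).
  { intros i b _. rewrite orb_true_iff, negb_true_iff, Nat.eqb_neq. tauto. }
  split.
  - intros H. split.
    + intros i Hi. specialize (H i ltac:(lia)). rewrite ball_true in H |- *.
      intros j Hj. specialize (H j Hj). unfold state_at in *.
      rewrite !cnth_code, !E in * by lia. exact H.
    + intros j Hj. specialize (H (length x) ltac:(lia)). rewrite ball_true in H.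
      specialize (H j Hj). apply Q in H; [|exact true]. unfold state_at in H. unfold state.
      rewrite !cnth_code, nth_snoc, !E in H by lia. exact H.
  - intros [H1 H2] i Hi. apply ball_true. intros j Hj. destruct (Nat.eq_dec i (length x)) as [->|N].
    + specialize (H2 j Hj). apply Q; [exact true|]. unfold state_at. unfold state in H2.
      rewrite !cnth_code, nth_snoc, !E by lia. exact H2.
    + specialize (H1 i ltac:(lia)). rewrite ball_true in H1. specialize (H1 j Hj). unfold state_at in *.
      rewrite !cnth_code, !E in * by lia. exact H1.
Qed.
Lemma tr_prefix y : forall x, tr (x ++ y) -> tr x.
Proof.
  induction y as [|v y IH] using rev_ind; intros x H; [now rewrite app_nil_r in H|].
  rewrite app_assoc in H. apply tr_snoc in H as [H _]. auto.
Qed.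

Definition child (y x : list nat) : Prop := tr y /\ exists v, y = x ++ [v].
(** Comparing by [gt] and exchanging the arguments puts extensions below their prefixes, while nodes
    further to the left remain below those to the right. *)
Definition kb (y x : list nat) : Prop := lexlt gt x y.
Definition kbrel (y x : list nat) : Prop := tr y /\ tr x /\ kb y x.
Definition left (y x : list nat) : Prop :=
  exists p a b l m, a < b /\ y = p ++ a :: l /\ x = p ++ b :: m.

Lemma kb_extend x v l : kb (x ++ v :: l) x.
Proof. unfold kb. induction x; simpl; [apply lex_nil|now apply lex_eq]. Qed.
Lemma kb_cases y x : kb y x -> left y x \/ exists v l, y = x ++ v :: l.
Proof.
  unfold kb. induction 1 as [v l|b a m l H|c m l H IH].
  - right. now exists v, l.
  - left. exists [], a, b, l, m. auto.
  - destruct IH as [(p & a & b & l' & m' & H' & -> & ->)|(v & l' & ->)].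
    + left. exists (c :: p), a, b, l', m'. auto.
    + right. now exists v, l'.
Qed.
Lemma left_snoc y x v : left y (x ++ [v]) -> left y x \/ exists a l, a < v /\ y = x ++ a :: l.
Proof.
  intros (p & a & b & l & m & H & -> & E).
  destruct m as [|c m _] using rev_ind.
  - apply app_inj_tail in E as [-> ->]. right. eauto.
  - left. change (b :: m ++ [c]) with ((b :: m) ++ [c]) in E. rewrite app_assoc in E.
    apply app_inj_tail in E as [-> _]. exists p, a, b, l, m. auto.
Qed.
Lemma acc_extend x v l : tr (x ++ v :: l) -> Acc kbrel (x ++ [v]) -> Acc kbrel (x ++ v :: l).
Proof.
  intros H A. destruct l as [|w l]; auto.
  assert (E : x ++ v :: w :: l = (x ++ [v]) ++ w :: l) by now rewrite <- app_assoc.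
  rewrite E in *. apply (Acc_inv A). split; auto. split; [eapply tr_prefix; eauto|apply kb_extend].
Qed.

Definition left_acc (x : list nat) : Prop := forall y, tr y -> left y x -> Acc kbrel y.

(** Children are treated from left to right: once the earlier ones and their extensions are
    accessible, so is everything to the left of the next child. *)
Lemma children_acc x N : left_acc x ->
  (forall a, a < N -> tr (x ++ [a]) -> left_acc (x ++ [a]) -> Acc kbrel (x ++ [a])) ->
  forall a, a < N -> forall l, tr (x ++ a :: l) -> Acc kbrel (x ++ a :: l).
Proof.
  intros Hx H a. induction a as [a IH] using lt_wf_ind. intros Ha l T.
  apply acc_extend; auto. assert (T' : tr (x ++ [a])).
  { apply (tr_prefix l). now rewrite <- app_assoc. }
  apply H; auto. intros y Ty L. apply left_snoc in L as [L|(b & m & L & ->)]; auto.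
  apply IH; auto. lia.
Qed.

(** Induction on the well-founded subtree at [x]: what is below [x] lies to its left or passes
    through a child. *)
Lemma child_acc_kb_acc x : Acc child x -> tr x -> left_acc x -> Acc kbrel x.
Proof.
  induction 1 as [x _ IH]. intros T Hx. constructor. intros y (Ty & _ & H).
  apply kb_cases in H as [H|(v & l & ->)]; auto.
  apply (children_acc x (S v)); auto. intros a _ Ta. apply IH; auto. split; eauto.
Qed.

Lemma root_not_acc : ~ Acc child [].
Proof.
  (* Entries with second component 1 follow no system, so they can be repeated forever. *)
  intros A. apply (acc_no_sequence _ _ A (fun n => repeat (npair 0 1) n)); auto.
  intros n. assert (T : forall n, tr (repeat (npair 0 1) n)).
  { clear. induction n as [|n IH]; [apply tr_nil|]. cbn [repeat]. rewrite repeat_cons, tr_snoc. split; auto.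
    intros j Hj. left. rewrite repeat_length in Hj. rewrite nth_repeat_lt by auto.
    rewrite pi2_pair. discriminate. }
  split; auto. exists (npair 0 1). apply repeat_cons.
Qed.

Lemma least_nat (P : nat -> Prop) n : P n -> exists m, P m /\ forall j, j < m -> ~ P j.
Proof.
  induction n as [n IH] using lt_wf_ind. intros H.
  destruct (classic (exists j, j < n /\ P j)) as [(j & Hj & Pj)|N]; [eauto|].
  exists n. split; auto. intros j Hj Pj. apply N. eauto.
Qed.

(** The nodes of the leftmost infinite path are built level by level. *)
Lemma leftmost_step x : tr x -> left_acc x -> ~ Acc child x ->
  exists v, tr (x ++ [v]) /\ left_acc (x ++ [v]) /\ ~ Acc child (x ++ [v]) /\
    forall a l, a < v -> tr (x ++ a :: l) -> Acc kbrel (x ++ a :: l).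
Proof.
  intros T Hx NA.
  assert (E : exists v, tr (x ++ [v]) /\ ~ Acc child (x ++ [v])).
  { apply NNPP. intros N. apply NA. constructor. intros y [Ty [v ->]]. apply NNPP. intros N'.
    apply N. eauto. }
  destruct E as [v0 Hv0].
  destruct (least_nat (fun v => tr (x ++ [v]) /\ ~ Acc child (x ++ [v])) v0 Hv0) as (v & [Tv Nv] & M).
  assert (C : forall a l, a < v -> tr (x ++ a :: l) -> Acc kbrel (x ++ a :: l)).
  { intros a l Ha. apply (children_acc x v); auto. intros b Hb Tb Lb.
    apply child_acc_kb_acc; auto. apply NNPP. intros N. apply (M b Hb). auto. }
  exists v. split; [exact Tv|]. split; [|split; auto]. intros y Ty L. apply left_snoc in L as [L|(a & l & Ha & ->)]; auto.
Qed.
Lemma leftmost n : exists x, length x = n /\ tr x /\ left_acc x /\ ~ Acc child x.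
Proof.
  induction n as [|n (x & E & T & Hx & N)].
  - exists []. split; auto. split; [apply tr_nil|]. split; [|apply root_not_acc].
    intros y _ (p & a & b & l & m & _ & _ & H). destruct p; discriminate.
  - destruct (leftmost_step x T Hx N) as (v & Tv & Lv & Nv & _).
    exists (x ++ [v]). rewrite length_app, E, Nat.add_1_r. auto.
Qed.

Lemma not_acc_path x : ~ Acc child x -> tr x -> exists z : nat -> list nat, exists v : nat -> nat,
  z 0 = x /\ (forall n, z (S n) = z n ++ [v n]) /\ forall n, tr (z n).
Proof.
  intros N T. set (A := {y | ~ Acc child y /\ tr y}).
  assert (S : forall (n : nat) (y : A), exists y' : A, exists v, proj1_sig y' = proj1_sig y ++ [v]).
  { intros _ [y [Ny Ty]]. apply NNPP. intros N'. apply Ny. constructor. intros y' [Ty' [v ->]].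
    apply NNPP. intros N''. apply N'. now exists (exist _ (y ++ [v]) (conj N'' Ty')), v. }
  destruct (dependent_choice (exist _ x (conj N T) : A) S) as (f & F0 & F).
  apply choice in F as [v F]. exists (fun n => proj1_sig (f n)), v.
  split; [now rewrite F0|]. split; auto. intros n. exact (proj2 (proj2_sig (f n))).
Qed.

Lemma path_length (z : nat -> list nat) v n : (forall n, z (S n) = z n ++ [v n]) ->
  length (z n) = length (z 0) + n.
Proof.
  intros H. induction n; [lia|]. rewrite H, length_app, IHn. simpl. lia.
Qed.
Lemma path_nth (z : nat -> list nat) v n i : (forall n, z (S n) = z n ++ [v n]) ->
  i < length (z 0) -> nth i (z n) 0 = nth i (z 0) 0.
Proof.
  intros H Hi. induction n; auto. rewrite H, app_nth1; auto.
  rewrite (path_length z v) by auto. lia.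
Qed.

Lemma path_run (z : nat -> list nat) v j : length (z 0) = S j -> pi2 (nth j (z 0) 0) = 0 ->
  (forall n, z (S n) = z n ++ [v n]) -> (forall n, tr (z n)) ->
  exists f, irun (sys k j) (sys_init k j) f.
Proof.
  intros L B Z T.
  exists (fun n => match n with 0 => sys_init k j | S m => pi1 (choice_at j (v m)) end).
  split; auto. intros n. apply edge_cert_spec. exists (pi2 (choice_at j (v n))).
  specialize (T (S n)). rewrite Z in T. apply tr_snoc in T as [_ T].
  pose proof (path_length z v n Z) as Ln. destruct (T j) as [H|H]; [lia| |].
  - exfalso. apply H. rewrite (path_nth z v); auto. lia.
  - rewrite <- H. f_equal. unfold state. rewrite Ln, L. destruct n as [|n].
    + rewrite Nat.add_0_r, Nat.eqb_refl. reflexivity.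
    + replace (S j + S n =? S j) with false by (symmetry; apply Nat.eqb_neq; lia).
      rewrite Z. replace (pred (S j + S n)) with (length (z n)) by (rewrite (path_length z v), L by auto; lia).
      now rewrite nth_snoc.
Qed.

(** * The subtree of the system under test, and the length of the standard part *)

Lemma ok_head x v v' : pi1 v = pi1 v' -> ok x v -> ok x v'.
Proof. unfold ok, choice_at. now intros <-. Qed.

(** As [npair 0 0 = 0], this is the leftmost child of the root, and it commits to the system number
    0. With nothing to its left, it is accessible iff its subtree has no infinite path. *)
Definition head_node : list nat := [npair 0 0].
Lemma head_tr : tr head_node.
Proof. apply (tr_snoc []). split; [apply tr_nil|]. intros j Hj. simpl in Hj. lia. Qed.
Lemma head_left_acc : left_acc head_node.
Proof.
  intros y _ (p & a & b & l & m & H & _ & E). destruct p as [|? [|]]; try discriminate.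
  injection E as E _. rewrite npair_0 in E. lia.
Qed.
Lemma head_acc : (~ exists f, irun (pi1 k) (pi2 k) f) -> Acc kbrel head_node.
Proof.
  intros N. apply child_acc_kb_acc; auto using head_tr, head_left_acc. apply NNPP. intros NA.
  destruct (not_acc_path _ NA head_tr) as (z & v & Z0 & Z & T). apply N.
  apply (path_run z v 0); auto; now rewrite Z0.
Qed.
Lemma head_not_acc : (exists f, irun (pi1 k) (pi2 k) f) -> ~ Acc kbrel head_node.
Proof.
  intros (f & F0 & F) A.
  assert (H : forall n, exists t, edge_cert (pi1 k) (f n) (f (S n)) t = true)
    by (intros; now apply edge_cert_spec).
  apply choice in H as [t Ht].
  (* The second component 1 means that no further system is followed. *)
  set (v := fun n => npair (ccons (npair (f (S n)) (t n)) 0) 1).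
  set (z := nat_rect (fun _ => list nat) head_node (fun n x => x ++ [v n])).
  assert (Z : forall n, z (S n) = z n ++ [v n]) by reflexivity.
  assert (CV : forall n, choice_at 0 (v n) = npair (f (S n)) (t n)).
  { intros n. unfold choice_at, v. rewrite pi1_pair. apply chd_cons. }
  assert (T : forall n, tr (z n)).
  { induction n as [|n IH]; [apply head_tr|]. rewrite Z, tr_snoc. split; auto.
    intros [|j] Hj.
    - right. rewrite CV, pi1_pair, pi2_pair. rewrite <- (Ht n). cbn [sys Nat.eqb]. f_equal.
      unfold state. rewrite (path_length z v) by auto. change (length (z 0)) with 1.
      destruct n as [|n]; cbn [Nat.add Nat.eqb]; [exact (eq_sym F0)|]. cbn [pred].
      pose proof (nth_snoc (z n) (v n)) as Q. rewrite (path_length z v) in Q by auto.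
      change (length (z 0) + n) with (S n) in Q. rewrite Z, Q, CV. apply pi1_pair.
    - left. clear IH. assert (E : nth (S j) (z n) 0 = v j).
      { induction n as [|n IH]; [simpl in Hj; lia|]. rewrite Z in *.
        rewrite length_app, Nat.add_1_r in Hj. destruct (Nat.eq_dec (S j) (length (z n))) as [E|N].
        - rewrite E, nth_snoc. rewrite (path_length z v) in E by auto. change (length (z 0)) with 1 in E.
          f_equal. lia.
        - rewrite app_nth1 by lia. apply IH. lia. }
      rewrite E. unfold v. rewrite pi2_pair. discriminate. }
  apply (acc_no_sequence _ _ A z); auto. intros n. split; [apply T|]. split; [apply T|]. rewrite Z. apply kb_extend.
Qed.

Lemma update_cnth y j c : exists y', cnth j y' = c /\ forall i, i <> j -> cnth i y' = cnth i y.
Proof.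
  exists (cmk (S j + clen y) (fun i => if i =? j then c else cnth i y)). split.
  - rewrite cnth_cmk by lia. now rewrite Nat.eqb_refl.
  - intros i Hi. destruct (le_lt_dec (S j + clen y) i) as [L|L].
    + rewrite !cnth_list_of, !nth_overflow; auto; rewrite <- clen_list_of; [lia|].
      now rewrite clen_cmk.
    + rewrite cnth_cmk by lia. apply Nat.eqb_neq in Hi. now rewrite Hi.
Qed.

(** Along the leftmost path the descending sequences of [P] are offered to the left.
    Feeding the values of [h] on the nodes visited so far back into the tree gives an
    infinite descending sequence. *)
Lemma no_embedding P : computable_linear_order P -> wf_order P ->
  ~ exists h : list nat -> nat,
     (forall x, tr x -> Acc kbrel x -> odom P (h x)) /\
     (forall x y, tr x -> Acc kbrel x -> tr y -> Acc kbrel y -> kb y x -> olt P (h y) (h x)).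
Proof.
  intros [HP [eP He]] WP (h & Hd & Hh).
  (* [j] is the number of the system [e'] with initial state 0, whose infinite runs are the
     descending sequences of [P]. *)
  destruct (order_edges P eP He) as [e' E]. set (j := S (npair e' 0)).
  assert (Sj : sys k j = e') by apply pi1_pair. assert (Ij : sys_init k j = 0) by apply pi2_pair.
  destruct (leftmost j) as (s & Ls & Ts & As & Ns).
  destruct (leftmost_step s Ts As Ns) as (v & Tv & Av & Nv & C).
  destruct (not_acc_path _ Nv Tv) as (z & u & Z0 & Z & T).
  assert (Lz : length (z 0) = S j) by (rewrite Z0, length_app, Ls; simpl; lia).
  (* An infinite path cannot follow a system without runs, and this one has none because [P] is
     well-founded. *)
  assert (B : pi2 v <> 0).
  { intros B. destruct (path_run z u j) as (f & F0 & F); auto.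
    - now rewrite Z0, <- Ls, nth_snoc.
    - rewrite Sj, Ij in *. assert (G : forall n, exists p, f (S n) = S p).
      { intros n. specialize (F n). apply E in F. destruct (f (S n)); [easy|eauto]. }
      apply choice in G as [p Hp].
      apply (acc_no_sequence _ _ (WP (p 0)) p); auto. intros n.
      specialize (F (S n)). apply E in F. rewrite !Hp in F. tauto. }
  (* The same node with the opposite decision about [P]. It lies to the left of the leftmost path,
     hence it is accessible and [h] applies to it. *)
  set (w := s ++ [npair (pi1 v) 0]).
  assert (Tw : tr w).
  { apply tr_snoc. split; auto. apply tr_snoc in Tv as [_ Tv].
    apply (ok_head s v); auto. now rewrite pi1_pair. }
  assert (Aw : Acc kbrel w).
  { apply C; auto. rewrite <- (pair_pi v) at 2. apply npair_0_lt. lia. }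
  (* [x] copies the infinite path [z] except for the decision about the system [j] and the moves in
     it, so the conditions of all other systems are inherited. *)
  set (sim := fun (x : list nat) n => length x = S j + n /\ pi2 (nth j x 0) = 0 /\
    forall m, m < length x -> (m <> j -> pi2 (nth m x 0) = pi2 (nth m (z n) 0)) /\
      forall i, i <> j -> choice_at i (nth m x 0) = choice_at i (nth m (z n) 0)).
  (* The next move in the system [j] goes to [S p], where [p] is the value of [h] at the current
     node. The new node is lower in the tree order, so its value under [h] is below [p] and can be
     the move after that. *)
  assert (Main : forall p, Acc (fun x y => odom P x /\ odom P y /\ olt P x y) p ->
    forall x n, sim x n -> tr x -> Acc kbrel x -> h x = p -> Edge e' (state x j) (S p) -> False).
  { induction 1 as [p _ IH]. intros x n (Lx & Bx & Sx) Tx Ax Hp Ed.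
    apply edge_cert_spec in Ed as [t Ht].
    destruct (update_cnth (pi1 (u n)) j (npair (S p) t)) as (y & Yj & Yi).
    set (v' := npair y (pi2 (u n))). set (x' := x ++ [v']).
    pose proof (path_length z u n Z) as Ln. rewrite Lz in Ln.
    assert (Cj : choice_at j v' = npair (S p) t) by (unfold choice_at, v'; now rewrite pi1_pair).
    assert (Ci : forall i, i <> j -> choice_at i v' = choice_at i (u n)).
    { intros i Hi. unfold choice_at, v'. rewrite pi1_pair. auto. }
    assert (Tx' : tr x').
    { apply tr_snoc. split; auto. intros m Hm. destruct (Nat.eq_dec m j) as [->|Nm].
      - right. rewrite Sj, Cj, pi1_pair, pi2_pair. exact Ht.
      - specialize (T (S n)). rewrite Z in T. apply tr_snoc in T as [_ T].
        destruct (T m ltac:(lia)) as [Q|Q].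
        + left. destruct (Sx m Hm) as [Q1 _]. rewrite Q1; auto.
        + right. rewrite Ci by auto. rewrite <- Q. f_equal. unfold state. rewrite Lx, Ln.
          destruct (S j + n =? S m); auto. f_equal. apply Sx; auto. lia. }
    assert (Kx' : kb x' x) by apply kb_extend.
    assert (Ax' : Acc kbrel x') by (apply (Acc_inv Ax); split; [exact Tx'|split; [exact Tx|exact Kx']]).
    assert (Lh : olt P (h x') p) by (subst p; apply Hh; auto).
    assert (Oh : odom P (h x')) by now apply Hd.
    assert (Op : odom P p) by (subst p; now apply Hd).
    apply (IH (h x')) with (x := x') (n := S n); auto.
    - split; [unfold x'; rewrite length_app; simpl; lia|]. split.
      + unfold x'. rewrite app_nth1; auto. lia.
      + intros m Hm. unfold x' in *. rewrite length_app in Hm. simpl in Hm. rewrite Z.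
        destruct (Nat.eq_dec m (length x)) as [->|Nm].
        * rewrite nth_snoc. rewrite Lx, <- Ln, nth_snoc. split; auto. intros _. apply pi2_pair.
        * rewrite !app_nth1 by lia. apply Sx. lia.
    - apply E. split; auto. unfold state. unfold x' at 1. rewrite length_app, Nat.add_1_r, Lx.
      replace (S (S j + n) =? S j) with false by (symmetry; apply Nat.eqb_neq; lia).
      replace (pred (length x')) with (length x) by (unfold x'; rewrite length_app, Nat.add_1_r; reflexivity).
      unfold x'. rewrite nth_snoc, Cj, pi1_pair. auto. }
  apply (Main (h w) (WP (h w)) w 0); auto.
  - split; [unfold w; rewrite length_app; simpl; lia|]. unfold w. rewrite <- Ls at 1. rewrite nth_snoc.
    split; [apply pi2_pair|]. rewrite Z0. intros m Hm. rewrite length_app in Hm. simpl in Hm.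
    destruct (Nat.eq_dec m (length s)) as [->|Nm].
    + rewrite !nth_snoc. split; [intros; lia|]. intros i _. unfold choice_at. now rewrite pi1_pair.
    + rewrite !app_nth1 by lia. auto.
  - apply E. unfold state, w. rewrite length_app, Ls, Nat.add_1_r, Nat.eqb_refl, Ij. split; auto.
Qed.
End Tree.

(** * Harrison orders, uniformly in a transition system *)

Definition kb_order (k : nat) : order nat :=
  {| odom := fun x => tr k (list_of x); olt := fun x y => kb (list_of x) (list_of y) |}.
Definition harrison (k : nat) : order nat := pow2 (kb_order k).

Lemma kb_order_linear k : linear (kb_order k).
Proof.
  split; [|split]; cbn; unfold kb.
  - intros x _. apply lexlt_irrefl. apply Forall_forall. intros y _. lia.
  - intros x y z _ _ _ H1 H2. apply (lexlt_trans gt (fun _ => True)) with (m := list_of y); auto;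
      try (apply Forall_forall; auto). intros; lia.
  - intros x y _ _.
    destruct (lexlt_total gt (fun _ => True)) with (l := list_of y) (m := list_of x) as [H|[H|H]]; auto;
      try (apply Forall_forall; auto). intros; lia. right; left. symmetry. now apply list_of_inj.
Qed.

Lemma kb_acc k x : Acc (Lrel (kb_order k)) x <-> Acc (kbrel k) (list_of x).
Proof.
  split.
  - induction 1 as [x _ IH]. constructor. intros y (Ty & Tx & H).
    rewrite <- (list_of_tuple_code y) in *. apply IH. repeat split; cbn; auto.
  - intros A. remember (list_of x) as l eqn:E. revert x E. induction A as [l _ IH].
    intros x ->. constructor. intros y (Ty & Tx & H). apply (IH (list_of y)); auto.
    split; auto.
Qed.

Lemma kb_nonstd k : exists r, nonstd (kb_order k) r.
Proof.
  exists 0. split; [reflexivity|]. rewrite kb_acc. change (list_of 0) with (@nil nat).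
  intros A. apply (root_not_acc k). assert (T : tr k []) by reflexivity.
  revert T. induction A as [x _ IH]. intros T. constructor. intros y [Ty [v ->]].
  apply IH; auto. split; auto. split; auto. apply kb_extend.
Qed.

Definition fdb (lt : nat -> nat -> bool) (l m : nat) : bool :=
  bex (clen m) (fun i => (i <=? clen l) && (ball i (fun j => cnth j l =? cnth j m) &&
    ((i =? clen l) || lt (cnth i l) (cnth i m)))).
Lemma fdb_spec lt R l m : (forall a b, lt a b = true <-> R a b) ->
  (fdb lt l m = true <-> lexlt R (list_of l) (list_of m)).
Proof.
  intros H. unfold fdb. rewrite bex_true, lexlt_first_difference, !clen_list_of. split.
  - intros (i & Hi & E). rewrite !andb_true_iff, ball_true, Nat.leb_le in E. destruct E as (E1 & E2 & E3).
    exists i. split; auto. split; auto. split.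
    + intros j Hj. specialize (E2 j Hj). rewrite !cnth_list_of in E2. now apply Nat.eqb_eq.
    + apply orb_true_iff in E3. rewrite Nat.eqb_eq, H, !cnth_list_of in E3.
      destruct (Nat.eq_dec i (length (list_of l))); auto. right. split; [lia|tauto].
  - intros (i & E1 & Hi & E2 & E3). exists i. split; auto.
    rewrite !andb_true_iff, ball_true, Nat.leb_le. split; auto. split.
    + intros j Hj. rewrite !cnth_list_of. apply Nat.eqb_eq. auto.
    + apply orb_true_iff. rewrite Nat.eqb_eq, H, !cnth_list_of. tauto.
Qed.

Definition kbb (x y : nat) : bool := fdb (fun a b => b <? a) y x.
Lemma kbb_spec x y : kbb x y = true <-> kb (list_of x) (list_of y).
Proof. apply fdb_spec. intros a b. apply Nat.ltb_lt. Qed.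

Definition descb (k h : nat) : bool :=
  ball (clen h) (fun i => trb k (cnth i h) && ball i (fun j => kbb (cnth i h) (cnth j h))).
Lemma desc_nth L l : desc L l <->
  forall i, i < length l -> odom L (nth i l 0) /\ forall j, j < i -> olt L (nth i l 0) (nth j l 0).
Proof.
  induction l as [|x l IH]; simpl; [intuition lia|]. rewrite IH, Forall_forall. split.
  - intros (H1 & H2 & H3) [|i] Hi; [split; auto; intros; lia|]. destruct (H3 i ltac:(lia)) as [H4 H5].
    split; auto. intros [|j] Hj; [apply H2, nth_In; lia|apply H5; lia].
  - intros H. split; [apply (H 0); lia|]. split.
    + intros y Hy. destruct (In_nth l y 0 Hy) as (i & Hi & <-). destruct (H (S i) ltac:(lia)) as [_ G]. apply (G 0). lia.
    + intros i Hi. destruct (H (S i) ltac:(lia)) as [H1 H2]. split; auto.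
      intros j Hj. apply (H2 (S j)). lia.
Qed.
Lemma descb_spec k h : descb k h = true <-> odom (harrison k) h.
Proof.
  cbn [odom harrison pow2]. rewrite desc_nth. unfold descb. rewrite ball_true, clen_list_of.
  split; intros H i Hi; specialize (H i Hi).
  - rewrite andb_true_iff, ball_true in H. destruct H as [H1 H2]. cbn [odom olt kb_order].
    rewrite <- cnth_list_of. split.
    + unfold tr. now rewrite tuple_code_list_of.
    + intros j Hj. rewrite <- cnth_list_of. apply kbb_spec. auto.
  - destruct H as [H1 H2]. rewrite andb_true_iff, ball_true. cbn [odom olt kb_order] in *.
    rewrite <- cnth_list_of in *. unfold tr in H1. rewrite tuple_code_list_of in H1. split; auto.
    intros j Hj. apply kbb_spec. specialize (H2 j Hj). now rewrite <- cnth_list_of in H2.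
Qed.
Definition hltb (x y : nat) : bool := fdb kbb x y.
Lemma hltb_spec k x y : hltb x y = true <-> olt (harrison k) x y.
Proof. apply (fdb_spec kbb (fun a b => kb (list_of a) (list_of b))). apply kbb_spec. Qed.

Lemma cfb_hltb K F G : cf K F -> cf K G -> cfb K (fun X n => hltb (F X n) (G X n)).
Proof. intros. unfold hltb, kbb, fdb. csolve. Qed.
Lemma cfb_descb K F G : cf K F -> cf K G -> cfb K (fun X n => descb (F X n) (G X n)).
Proof.
  intros. unfold descb, kbb, fdb, trb, edge_cert, state_at, choice_at, sys, sys_init. csolve.
Qed.

Lemma phi_decides X e n b P : phi X e n (Nat.b2n b) -> (b = true <-> P) -> decides X e n P.
Proof.
  destruct (encode_surj e) as [c <-]. rewrite phi_encode. apply bool_decides.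
Qed.

(** Uniformity in [k] matters: these indices are later fed to the algorithm of Scott completeness
    for all states at once. *)
Lemma harrison_index : exists ix, cf all_oracles (fun _ => ix) /\
  forall k, is_order_index (ix k) (harrison k).
Proof.
  destruct (smn all_oracles (fun _ z => Nat.b2n (descb (pi1 z) (pi2 z)))) as (u & Cu & Hu).
  { apply cfb_descb; csolve. }
  destruct (smn all_oracles (fun _ z => Nat.b2n (hltb (pi1 (pi2 z)) (pi2 (pi2 z))))) as (r & Cr & Hr).
  { apply cfb_hltb; csolve. }
  exists (fun k => npair (u k) (r k)). split; [csolve|]. intros k. exists (u k), (r k).
  split; auto. split.
  - intros x. specialize (Hu no_oracle I k x). rewrite pi1_pair, pi2_pair in Hu.
    eapply phi_decides; [exact Hu|apply descb_spec].
  - intros x y _ _. specialize (Hr no_oracle I k (npair x y)). pis in Hr.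
    eapply phi_decides; [exact Hr|apply hltb_spec].
Qed.
Lemma harrison_below_index k a : exists e, is_order_index e (below (harrison k) a).
Proof.
  assert (C : cfb all_oracles (fun _ x => descb k x && hltb x a)).
  { apply cfb_and; [apply cfb_descb|apply cfb_hltb]; csolve. }
  assert (C' : cfb all_oracles (fun _ z => hltb (pi1 z) (pi2 z))) by (apply cfb_hltb; csolve).
  destruct C as [u Hu], C' as [r Hr]. exists (npair (encode u) (encode r)), (encode u), (encode r).
  split; auto. split.
  - intros x. eapply bool_decides; [now apply Hu|]. rewrite andb_true_iff, descb_spec.
    now rewrite (hltb_spec k).
  - intros x y _ _. specialize (Hr no_oracle I (npair x y)). pis in Hr.
    eapply bool_decides; [exact Hr|]. apply (hltb_spec k).
Qed.

Lemma harrison_linear k : linear (harrison k).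
Proof. apply pow2_linear, kb_order_linear. Qed.

Theorem harrison_harrison k : harrison_order (harrison k).
Proof.
  destruct harrison_index as (ix & _ & Hix).
  apply (pow2_harrison _ (kb_order_linear k) (ix k)); auto.
  - apply harrison_below_index.
  - apply kb_nonstd.
  - intros P CP WP (h & H1 & H2). apply (no_embedding k P CP WP).
    exists (fun x => h (tuple_code x)).
    assert (S : forall x, tr k x -> Acc (kbrel k) x -> std (kb_order k) (tuple_code x)).
    { intros x Tx Ax. split; [|apply kb_acc]; cbn; now rewrite list_of_tuple_code. }
    split; [auto|]. intros x y Tx Ax Ty Ay H. apply H2; auto.
    cbn. now rewrite !list_of_tuple_code.
Qed.

(** The power of 2 with exponent [head_node]; the same number for all [k]. *)
Definition test_point : nat := tuple_code [tuple_code head_node].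

Lemma test_point_odom k : odom (harrison k) test_point.
Proof.
  cbn [odom harrison pow2]. unfold test_point. rewrite list_of_tuple_code. cbn [desc odom kb_order].
  rewrite list_of_tuple_code. split; [apply head_tr|auto].
Qed.
Lemma nil_least k : is_least (harrison k) 0.
Proof.
  split; [exact I|]. intros y Hy. destruct (list_of y) as [|a l] eqn:E.
  - left. now rewrite <- (tuple_code_list_of y), E.
  - right. cbn. rewrite E. constructor.
Qed.
Lemma not_least k x y : odom (harrison k) x -> odom (harrison k) y -> olt (harrison k) y x ->
  ~ is_least (harrison k) x.
Proof.
  intros Hx Hy H [_ L]. destruct (harrison_linear k) as (I & T & _).
  destruct (L y Hy) as [->|H']; [now apply (I x)|]. apply (I x); auto. now apply (T x y x).
Qed.
Lemma low_acc_harrison k h : low (kb_order k) (list_of h) -> Acc (Lrel (harrison k)) h.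
Proof.
  intros Hh. pose proof (low_order_wf (kb_order k) h) as A.
  revert Hh. induction A as [h _ IH]. intros Hh. constructor. intros g (Hg & _ & H).
  assert (Lg : low (kb_order k) (list_of g)) by (eapply low_below; eauto).
  apply IH; auto.
Qed.
Lemma test_point_acc k : (~ exists f, irun (pi1 k) (pi2 k) f) -> Acc (Lrel (harrison k)) test_point.
Proof.
  intros N. apply low_acc_harrison. split; [apply test_point_odom|].
  unfold test_point. rewrite list_of_tuple_code. constructor; auto. split; [|apply kb_acc];
    cbn [odom kb_order]; rewrite list_of_tuple_code; [apply head_tr|now apply head_acc].
Qed.
Lemma test_point_ill_founded k : (exists f, irun (pi1 k) (pi2 k) f) ->
  ~ wf_order (below (harrison k) test_point).
Proof.
  intros R WF. set (L := kb_order k).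
  set (A := {x | nonstd L x}).
  assert (S : forall (n : nat) (x : A), exists y : A, olt L (proj1_sig y) (proj1_sig x)).
  { intros _ [x Hx]. destruct (nonstd_below L x Hx) as (y & Hy & H). now exists (exist _ y Hy). }
  assert (H0 : nonstd L (tuple_code head_node)).
  { unfold L; split; [|rewrite kb_acc]; cbn [odom kb_order]; rewrite list_of_tuple_code; [apply head_tr|now apply head_not_acc]. }
  destruct (dependent_choice (exist _ _ H0 : A) S) as (f & F0 & F).
  (* The shift by one makes every term lie strictly below the test point. *)
  set (s := fun n => tuple_code [proj1_sig (f (Datatypes.S n))]).
  assert (Ds : forall n, odom (harrison k) (s n)).
  { intros n. cbn [odom harrison pow2]. unfold s. rewrite list_of_tuple_code. split; [|split; [constructor|exact I]].
    exact (proj1 (proj2_sig (f (Datatypes.S n)))). }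
  assert (Tr : forall n, olt L (proj1_sig (f (Datatypes.S n))) (tuple_code head_node)).
  { induction n as [|n IH]; [specialize (F 0); now rewrite F0 in F|].
    destruct (kb_order_linear k) as (_ & T & _).
    apply (T _ (proj1_sig (f (Datatypes.S n))) _); auto; try apply (proj1 (proj2_sig (f _))). apply H0. }
  assert (Bs : forall n, odom (below (harrison k) test_point) (s n)).
  { intros n. split; auto. cbn [olt harrison pow2]. unfold s, test_point. rewrite !list_of_tuple_code.
    apply lex_lt. apply Tr. }
  apply (acc_no_sequence _ _ (WF (s 0)) s); auto. intros n. split; auto. split; auto.
  cbn [olt below harrison pow2]. unfold s. rewrite !list_of_tuple_code. apply lex_lt. apply F.
Qed.

(** * Back-and-forth relations yield runs *)

(** Values are found by searching for certificates. The oracle [O] is separate from [Y] because both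
    [Y] itself and the empty oracle occur. *)
Lemma rc_univ Y O ix ar v : rcb Y O -> rc Y ix -> rc Y ar ->
  (forall n, phi O (ix n) (ar n) (v n)) -> rc Y v.
Proof.
  intros HO Hi Ha H.
  assert (E : forall n, exists w, certo O (ix n) (ar n) (pi1 w) (pi2 w) = true).
  { intros n. destruct (proj1 (certo_phi _ _ _ _) (H n)) as [t Ht]. exists (npair (v n) t).
    now rewrite pi1_pair, pi2_pair. }
  assert (L : forall n, exists w, certo O (ix n) (ar n) (pi1 w) (pi2 w) = true /\
     forall j, j < w -> certo O (ix n) (ar n) (pi1 j) (pi2 j) = false).
  { intros n. apply least_exists, E. }
  apply choice in L as [w Hw].
  assert (Cw : rc Y w).
  { apply (cf_min (eq Y) (fun _ n w => certo O (ix n) (ar n) (pi1 w) (pi2 w))); [|auto].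
    apply (cfb_certo (eq Y) (fun _ => O)); [exact HO| | | |]; unfold rc in *; csolve. }
  unfold rc in *. eapply cf_ext; [|exact (cf_pi1 _ _ Cw)]. intros X n _. cbn beta.
  destruct (Hw n) as [Q _]. apply (phi_functional O (ix n) (ar n)); auto. apply certo_phi. eauto.
Qed.

Lemma rc_iterate Y c w : (forall n, eval Y c (npair 0 (npair n (w n))) (w (S n))) -> rc Y w.
Proof.
  intros H. exists (Comp (Rec (const_code (w 0)) c) (Pair Zero id_code)). intros X <- n.
  exists (npair 0 n). split; [exists 0, n; repeat split; apply eval_id|].
  cbn [eval]. change (fst (Cantor.of_nat ?z)) with (pi1 z). change (snd (Cantor.of_nat ?z)) with (pi2 z).
  rewrite pi1_pair, pi2_pair. induction n as [|n IH]; cbn [rec_graph]; [apply eval_const|eauto].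
Qed.

(** The invariant may be undecidable: it guarantees that every search along the sequence ends, while
    the computation just iterates the search for a least witness. *)
Lemma iterate_search Y (B : nat -> nat -> bool) (G : nat -> nat -> nat) (Inv : nat -> nat -> Prop) a :
  cfb (eq Y) (fun _ z => B (pi1 z) (pi2 z)) -> cf (eq Y) (fun _ z => G (pi1 z) (pi2 z)) ->
  Inv 0 a -> (forall n w, Inv n w -> exists m, B (npair n w) m = true) ->
  (forall n w m, Inv n w -> B (npair n w) m = true -> Inv (S n) (G (npair n w) m)) ->
  exists w, rc Y w /\ w 0 = a /\ forall n, Inv n (w n) /\
    exists m, B (npair n (w n)) m = true /\ w (S n) = G (npair n (w n)) m.
Proof.
  intros HB HG I0 HE HI.
  assert (St : forall n w, exists w', Inv n w -> Inv (S n) w' /\ exists m, B (npair n w) m = true /\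
     (forall j, j < m -> B (npair n w) j = false) /\ w' = G (npair n w) m).
  { intros n w. destruct (classic (Inv n w)) as [H|]; [|exists 0; tauto].
    destruct (least_exists _ (HE n w H)) as (m & Hm & Lm). exists (G (npair n w) m).
    intros _. split; auto. eauto. }
  destruct (dependent_choice a St) as (w & W0 & W).
  assert (Iw : forall n, Inv n (w n)).
  { induction n as [|n IH]; [now rewrite W0|]. now apply W. }
  exists w. split; [|split; auto].
  - apply cfb_neg in HB. destruct HB as [cb Hb], HG as [cg Hg].
    apply (rc_iterate Y (Comp cg (Comp (Pair id_code (Min cb)) Snd))). intros n.
    destruct (W n (Iw n)) as (_ & m & Hm & Lm & ->). set (z := npair n (w n)) in *.
    exists (npair z m). split.
    + exists z. split; [change (z = pi2 (npair 0 z)); now rewrite pi2_pair|].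
      exists z, m. split; [apply eval_id|]. split; auto. split.
      * specialize (Hb Y eq_refl (npair z m)). now rewrite pi1_pair, pi2_pair, Hm in Hb.
      * intros i Hi. specialize (Hb Y eq_refl (npair z i)).
        rewrite pi1_pair, pi2_pair, Lm in Hb by auto. exists 0. exact Hb.
    + specialize (Hg Y eq_refl (npair z m)). now rewrite pi1_pair, pi2_pair in Hg.
  - intros n. split; auto. destruct (W n (Iw n)) as (_ & m & Hm & _ & E). eauto.
Qed.

Section Automorphism.
Context {L : language} (A : structure L) (F : nat -> nat).
Hypothesis HF : is_isomorphism L A A F.

Lemma term_val_map n t v : wf_term L n t -> n <= length v -> Forall (dom A) v ->
  term_val A (map F v) t = F (term_val A v t).
Proof.
  destruct HF as (Fd & _ & _ & _ & Ff). intros W Hn Hv. revert W.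
  induction t as [i|f ts IH] using term_nested_ind; intros W; simpl in *.
  - rewrite (nth_indep _ 0 (F 0)) by (rewrite length_map; lia). apply map_nth.
  - destruct W as [E W]. apply wf_term_args in W. rewrite Ff.
    + f_equal. rewrite map_map. apply map_ext_in. intros t Ht.
      rewrite Forall_forall in IH, W. auto.
    + now rewrite length_map.
    + apply Forall_map. rewrite Forall_forall in *. intros t Ht.
      apply (term_val_dom A n); auto. now apply Forall_forall.
Qed.
Lemma qf_sat_map n p v : wf_qf L n p -> n <= length v -> Forall (dom A) v ->
  (qf_sat A (map F v) p <-> qf_sat A v p).
Proof.
  intros W Hn Hv. induction p as [|s t|r ts|p IH|p IHp q IHq|p IHp q IHq]; simpl in *; try tauto.
  - destruct W as [W1 W2]. rewrite !(term_val_map n) by auto. split; [|congruence].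
    destruct HF as (_ & Fi & _). intros E. apply Fi; auto; apply (term_val_dom A n); auto.
  - destruct W as [E W]. destruct HF as (_ & _ & _ & Fr & _).
    assert (Em : map (term_val A (map F v)) ts = map F (map (term_val A v) ts)).
    { rewrite map_map. apply map_ext_in. intros t Ht. rewrite Forall_forall in W.
      apply (term_val_map n); auto. }
    rewrite Em. symmetry. apply Fr; [now rewrite length_map|].
    apply Forall_map. rewrite Forall_forall in *. intros t Ht.
    apply (term_val_dom A n); auto. now apply Forall_forall.
Qed.

Hypothesis Finv : forall x, F (F x) = x.
Lemma map_F_F l : map F (map F l) = l.
Proof. rewrite map_map. rewrite <- (map_id l) at 2. apply map_ext. auto. Qed.
Lemma map_F_dom l : Forall (dom A) l -> Forall (dom A) (map F l).
Proof.
  intros H. apply Forall_map. eapply Forall_impl; [|exact H]. apply HF.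
Qed.

(** A challenge [d] is answered by its image under the involution, which again gives a tuple and its
    image. Accessibility is essential, as on the inaccessible part the clauses also admit the empty
    relation. *)
Lemma back_and_forth_automorphism H b : back_and_forth A H b ->
  forall x, Acc (Lrel H) x -> odom H x -> forall a, Forall (dom A) a -> b a (map F a) x = true.
Proof.
  intros [B1 B2] x Ax. induction Ax as [x _ IH]. intros Hx a Ha.
  destruct (classic (is_least H x)) as [Hl|Hl].
  - apply B1; auto using map_F_dom. intros p W (E & c & Ec & Dc & S). split; [now rewrite length_map in E|].
    exists (map F c). split; [now rewrite length_map|]. split; [now apply map_F_dom|].
    apply (qf_sat_map (arity p + bound p)) in S; auto.
    + now rewrite map_app, map_F_F in S.
    + rewrite length_app. lia.
    + apply Forall_app. auto using map_F_dom.
  - apply B2; auto using map_F_dom. intros d y Hd Hy Hyx. exists (map F d).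
    split; [now apply map_F_dom|].
    replace (a ++ map F d) with (map F (map F a ++ d)) by (now rewrite map_app, map_F_F).
    apply IH; auto; [repeat split; auto|]. apply Forall_app. auto using map_F_dom.
Qed.
End Automorphism.

Lemma back_and_forth_least_length L (A : structure L) H b x a1 a2 : back_and_forth A H b ->
  is_least H x -> Forall (dom A) a1 -> Forall (dom A) a2 -> b a1 a2 x = true ->
  length a1 = length a2 /\
  forall p, wf_qf L (length a1) p -> qf_sat A a2 p -> qf_sat A a1 p.
Proof.
  intros [B1 _] Hx D1 D2 Hb. pose proof (proj1 (B1 a1 a2 x D1 D2 Hx) Hb) as T.
  assert (E : length a1 = length a2).
  { destruct (T {| arity := length a2; bound := 0; matrix := Not Bot |}) as [E _]; [exact I| |exact E].
    split; [reflexivity|]. exists []. split; [reflexivity|split; [constructor|simpl; tauto]]. }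
  split; auto. intros p W S.
  destruct (T {| arity := length a2; bound := 0; matrix := p |}) as (_ & c & Ec & _ & S').
  - unfold wf_sigma1. simpl. now rewrite Nat.add_0_r, <- E.
  - split; auto. exists []. simpl. rewrite app_nil_r. auto.
  - simpl in Ec, S'. destruct c; [|discriminate]. now rewrite app_nil_r in S'.
Qed.

Section Runs.
Variables e q0 k : nat.
Let A := G e q0 (npair 0 2).
Let H := harrison k.
Variable b : list nat -> list nat -> nat -> bool.
Hypothesis HB : back_and_forth A H b.

Lemma A_automorphism p : path e q0 p -> is_isomorphism GL A A (shift p).
Proof.
  intros P. destruct (shift_iso e q0 p (npair 0 2) P) as (I1 & I2 & I3 & I4 & I5).
  split; [exact I1|]. split; [exact I2|]. split; [exact I3|]. split; [|exact I5].
  (* Bit mask 2 is the set of the node with code 1, which has length 1 and is not at level 0. So no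
     element is marked. *)
  assert (N : forall x, dom A x -> x <> npair 0 2).
  { intros x Hx ->. cbn in Hx. rewrite gdom_spec in Hx. specialize (Hx 1 eq_refl). discriminate. }
  intros i [|x l] E D; [discriminate|]. inversion D; subst. destruct i as [|m].
  - cbn. pose proof (N x ltac:(assumption)). pose proof (N (shift p x) ltac:(apply (shift_dom e q0 p x P); assumption)).
    tauto.
  - exact (I4 (S m) (x :: l) E D).
Qed.

Lemma above_least x y : odom H x -> odom H y -> olt H y x -> olt H 0 x.
Proof.
  intros Hx Hy L. destruct (nil_least k) as [_ N]. destruct (N x Hx) as [->|]; auto.
  exfalso. apply (not_least k 0 y); auto using nil_least.
Qed.

Lemma bf_next x y a1 a2 d : odom H x -> odom H y -> olt H y x ->
  Forall (dom A) a1 -> Forall (dom A) a2 -> Forall (dom A) d -> b a1 a2 x = true ->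
  exists c, Forall (dom A) c /\ b (a2 ++ d) (a1 ++ c) y = true.
Proof.
  intros Hx Hy L D1 D2 Dd Hb. destruct HB as [_ B2].
  apply (proj1 (B2 a1 a2 x D1 D2 Hx (not_least k x y Hx Hy L)) Hb); auto.
Qed.

(** The tuples witnessing clause (2) may have any length, but a tuple that is too
    short could be continued by an element of a wrong level. *)
Lemma bf_length x y z a1 a2 : odom H x -> odom H y -> odom H z -> olt H y x -> olt H z y ->
  Forall (dom A) a1 -> Forall (dom A) a2 -> b a1 a2 x = true -> length a1 <= length a2.
Proof.
  intros Hx Hy Hz L1 L2 D1 D2 Hb. apply Nat.nlt_ge. intros N.
  (* The level of the first entry of [a1] without a partner. Putting an element of level [S r] in
     that place of [a2] leads to [r = S r]. *)
  set (r := pi1 (nth (length a2) a1 0)).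
  assert (De : Forall (dom A) [npair (S r) 0]) by (constructor; [apply gdom_0|constructor]).
  destruct (bf_next x y a1 a2 _ Hx Hy L1 D1 D2 De Hb) as (f & Df & Hf).
  assert (D3 : Forall (dom A) (a2 ++ [npair (S r) 0])) by now apply Forall_app.
  assert (D4 : Forall (dom A) (a1 ++ f)) by now apply Forall_app.
  pose proof (above_least y z Hy Hz L2) as L0. pose proof (nil_least k) as H0.
  destruct (bf_next y 0 _ _ [] Hy (proj1 H0) L0 D3 D4 (Forall_nil _) Hf) as (g & Dg & Hg).
  rewrite app_nil_r in Hg.
  assert (D5 : Forall (dom A) ((a2 ++ [npair (S r) 0]) ++ g)) by now apply Forall_app.
  destruct (back_and_forth_least_length GL A H b 0 _ _ HB H0 D4 D5 Hg) as [E Sat].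
  specialize (Sat (Rel (S (S r)) [Var (length a2)])). cbn in Sat.
  assert (E1 : nth (length a2) ((a2 ++ [npair (S r) 0]) ++ g) 0 = npair (S r) 0).
  { rewrite <- app_assoc. apply nth_middle. }
  rewrite E1, pi1_pair, app_nth1 in Sat by auto.
  assert (Q : r = S r); [|lia]. apply Sat; auto. split; auto. constructor; auto.
  cbn [wf_term]. rewrite length_app. lia.
Qed.

(** One step down to the least point exchanges the sides, after which quantifier-free formulas pass
    from [a1] to [a2]. Levels and parenthood are such formulas. *)
Lemma bf_transfer x y a1 a2 : odom H x -> odom H y -> olt H y x ->
  Forall (dom A) a1 -> Forall (dom A) a2 -> length a1 <= length a2 -> b a1 a2 x = true ->
  (forall i, i < length a1 -> pi1 (nth i a2 0) = pi1 (nth i a1 0)) /\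
  (forall i j, i < length a1 -> j < length a1 -> parent (nth i a1 0) = nth j a1 0 ->
     parent (nth i a2 0) = nth j a2 0).
Proof.
  intros Hx Hy L D1 D2 Ll Hb.
  pose proof (above_least x y Hx Hy L) as L0. pose proof (nil_least k) as H0.
  destruct (bf_next x 0 _ _ [] Hx (proj1 H0) L0 D1 D2 (Forall_nil _) Hb) as (g & Dg & Hg).
  rewrite app_nil_r in Hg.
  assert (D5 : Forall (dom A) (a1 ++ g)) by now apply Forall_app.
  destruct (back_and_forth_least_length GL A H b 0 _ _ HB H0 D2 D5 Hg) as [E Sat].
  split.
  - intros i Hi. specialize (Sat (Rel (S (pi1 (nth i a1 0))) [Var i])). cbn in Sat.
    rewrite app_nth1 in Sat by auto. apply Sat; auto. split; auto. constructor; auto. cbn [wf_term]. lia.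
  - intros i j Hi Hj Hp. specialize (Sat (Eq (App 0 [Var i]) (Var j))). cbn in Sat.
    rewrite !app_nth1 in Sat by auto. apply Sat; auto. repeat split; auto; lia.
Qed.

(** The universe is decidable, so codes of tuples can be repaired. Then every argument passed to [b]
    is legal, and the tests used in the search are total. *)
Definition proj (x : nat) : nat := if gdom e q0 x then x else npair 0 0.
Definition san (l : nat) : nat := cmk (clen l) (fun i => proj (cnth i l)).
Lemma proj_dom x : dom A (proj x).
Proof. unfold proj. destruct (gdom e q0 x) eqn:E; auto. apply gdom_0. Qed.
Lemma proj_id x : dom A x -> proj x = x.
Proof. cbn. unfold proj. now intros ->. Qed.
Lemma san_code l : san (tuple_code l) = tuple_code (map proj l).
Proof.
  unfold san. rewrite cmk_code, clen_code. f_equal. apply nth_ext with (d := 0) (d' := 0).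
  - now rewrite !length_map, length_seq.
  - intros i Hi. rewrite length_map, length_seq in Hi. rewrite nth_map_seq, cnth_code by auto.
    rewrite (nth_indep (map proj l) 0 (proj 0)) by now rewrite length_map. now rewrite map_nth.
Qed.
Lemma san_id l : Forall (dom A) l -> san (tuple_code l) = tuple_code l.
Proof.
  intros D. rewrite san_code. f_equal. rewrite <- (map_id l) at 2. apply map_ext_in.
  intros x Hx. apply proj_id. rewrite Forall_forall in D. auto.
Qed.
Lemma san_dom l : exists l', san l = tuple_code l' /\ Forall (dom A) l'.
Proof.
  destruct (tuple_code_surj l) as [m <-]. exists (map proj m). split; [apply san_code|].
  apply Forall_map, Forall_forall. intros x _. apply proj_dom.
Qed.

Lemma cf_san K F : cf K F -> cf K (fun X n => san (F X n)).
Proof. intros HF. unfold san, proj, gdom, inL, gnode, top, edge_cert. csolve. Qed.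

(** [U] contains the empty set of level [n], and its partner in [V] is taken as [o n]. Each stage
    descends twice: with the empty challenge, which exchanges the sides, and then with the empty set
    of level [S n]. Partners have the same level and respect projection, so the sets [o n] project
    onto each other. *)
Lemma bf_run Y s x0 : odom H x0 -> olt H (s 0) x0 -> descending_sequence H s -> rc Y s ->
  (exists i, forall a1 a2 x, Forall (dom A) a1 -> Forall (dom A) a2 -> odom H x ->
     phi Y i (npair (tuple_code a1) (npair (tuple_code a2) x)) (Nat.b2n (b a1 a2 x))) ->
  b [npair 0 0] [npair 0 1] x0 = true -> gdom e q0 (npair 0 1) = true ->
  exists f, irun e q0 f /\ rc Y f.
Proof.
  intros Hx0 Hs0 Hs Cs [ib Hib] Hb0 D01.
  set (x := fun n => match n with 0 => x0 | S n => s n end).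
  assert (Hx : forall n, odom H (x n)) by (intros [|n]; [auto|apply Hs]).
  assert (Hl : forall n, olt H (x (S n)) (x n)) by (intros [|n]; [auto|apply Hs]).
  assert (Cx : rc Y x).
  { unfold rc in *. eapply cf_ext; [|apply (cf_if (eq Y) (fun _ n => n =? 0) (fun _ _ => x0) (fun _ n => s (pred n))); csolve].
    intros X [|n] _; reflexivity. }
  set (bS := fun z => b (list_of (san (pi1 z))) (list_of (san (pi1 (pi2 z)))) (x (pi2 (pi2 z)))).
  assert (CbS : cfb (eq Y) (fun _ z => bS z)).
  { cut (rc Y (fun z => Nat.b2n (bS z))); [auto|].
    apply (rc_univ Y Y (fun _ => ib) (fun z => npair (san (pi1 z)) (npair (san (pi1 (pi2 z))) (x (pi2 (pi2 z)))))).
    - unfold rcb. eapply cfb_ext; [|apply (cfb_orc (eq Y) (fun _ n => n)); csolve]. now intros X n <-.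
    - unfold rc. csolve.
    - unfold rc in *. apply cf_pair; [apply cf_san; csolve|]. apply cf_pair; [apply cf_san; csolve|csolve].
    - intros z. unfold bS. destruct (san_dom (pi1 z)) as (l1 & -> & D1).
      destruct (san_dom (pi1 (pi2 z))) as (l2 & -> & D2). rewrite !list_of_tuple_code. auto. }
  assert (BS : forall l1 l2 n, Forall (dom A) l1 -> Forall (dom A) l2 ->
     bS (npair (tuple_code l1) (npair (tuple_code l2) n)) = b l1 l2 (x n)).
  { intros l1 l2 n D1 D2. unfold bS. pis.
    now rewrite !san_id, !list_of_tuple_code. }
  set (U' := fun z m => capp (capp (pi1 (pi2 z)) (san (pi1 m))) (ccons (npair (S (pi1 z)) 0) 0)).
  set (V' := fun z m => capp (pi1 (pi2 (pi2 z))) (san (pi2 m))).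
  set (B := fun z m =>
    bS (npair (pi1 (pi2 (pi2 z))) (npair (capp (pi1 (pi2 z)) (san (pi1 m))) (S (2 * pi1 z)))) &&
    bS (npair (U' z m) (npair (V' z m) (S (S (2 * pi1 z)))))).
  set (Nx := fun z m => npair (U' z m) (npair (V' z m) (clen (capp (pi1 (pi2 z)) (san (pi1 m)))))).
  (* [i] is the position of the empty set of level [n], and the inequality of lengths ensures that
     it has a partner. *)
  set (Inv := fun n w => exists U V i, w = npair (tuple_code U) (npair (tuple_code V) i) /\
    Forall (dom A) U /\ Forall (dom A) V /\ b U V (x (2 * n)) = true /\ length U <= length V /\
    i < length U /\ nth i U 0 = npair n 0).
  assert (Spec : forall n U V i m, Forall (dom A) U -> Forall (dom A) V ->
    let z := npair n (npair (tuple_code U) (npair (tuple_code V) i)) in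
    exists C C', san (pi1 m) = tuple_code C /\ san (pi2 m) = tuple_code C' /\
      Forall (dom A) C /\ Forall (dom A) C' /\
      Nx z m = npair (tuple_code ((U ++ C) ++ [npair (S n) 0]))
        (npair (tuple_code (V ++ C')) (length (U ++ C))) /\
      B z m = b V (U ++ C) (x (S (2 * n))) &&
        b ((U ++ C) ++ [npair (S n) 0]) (V ++ C') (x (S (S (2 * n))))).
  { intros n U V i m DU DV z. destruct (san_dom (pi1 m)) as (C & EC & DC).
    destruct (san_dom (pi2 m)) as (C' & EC' & DC').
    exists C, C'. split; auto. split; auto. split; auto. split; auto.
    assert (EU : U' z m = tuple_code ((U ++ C) ++ [npair (S n) 0])).
    { unfold U', z. pis. rewrite EC, capp_code.
      rewrite <- tuple_code_one. apply capp_code. }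
    assert (EV : V' z m = tuple_code (V ++ C')).
    { unfold V', z. pis. rewrite EC', capp_code. reflexivity. }
    unfold Nx, B. rewrite EU, EV. unfold z. pis. rewrite EC, capp_code, clen_code.
    split; auto. rewrite !BS; auto; rewrite ?Forall_app; auto.
    repeat split; auto. constructor; auto. apply gdom_0. }
  assert (D0 : forall n, Forall (dom A) [npair n 0]).
  { intros n. constructor; [apply gdom_0|constructor]. }
  destruct (iterate_search Y B Nx Inv (npair (tuple_code [npair 0 0]) (npair (tuple_code [npair 0 1]) 0)))
    as (w & Cw & W0 & W).
  - assert (C1 : cf (eq Y) (fun _ z => san (pi1 (pi2 z)))) by (apply cf_san; csolve).
    assert (C2 : cf (eq Y) (fun _ z => san (pi2 (pi2 z)))) by (apply cf_san; csolve).
    unfold B, U', V'. csolve.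
  - assert (C1 : cf (eq Y) (fun _ z => san (pi1 (pi2 z)))) by (apply cf_san; csolve).
    assert (C2 : cf (eq Y) (fun _ z => san (pi2 (pi2 z)))) by (apply cf_san; csolve).
    unfold Nx, U', V'. csolve.
  - exists [npair 0 0], [npair 0 1], 0. split; auto. split; auto.
    split; [constructor; auto|]. cbn [length nth]. auto.
  - intros n w (U & V & i & -> & DU & DV & Hb & Ll & Hi & Ei).
    destruct (bf_next (x (2 * n)) (x (S (2 * n))) U V []) as (c & Dc & Hc); auto.
    rewrite app_nil_r in Hc.
    destruct (bf_next (x (S (2 * n))) (x (S (S (2 * n)))) V (U ++ c) [npair (S n) 0]) as (c' & Dc' & Hc'); auto.
    { now apply Forall_app. }
    exists (npair (tuple_code c) (tuple_code c')).
    destruct (Spec n U V i (npair (tuple_code c) (tuple_code c')) DU DV) as (C & C' & E1 & E2 & _ & _ & _ & ->).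
    rewrite pi1_pair, san_id in E1 by auto. rewrite pi2_pair, san_id in E2 by auto.
    apply tuple_code_inj in E1, E2. subst C C'. now rewrite Hc, Hc'.
  - intros n w m (U & V & i & -> & DU & DV & Hb & Ll & Hi & Ei) HBm.
    destruct (Spec n U V i m DU DV) as (C & C' & _ & _ & DC & DC' & EN & EB).
    rewrite EB in HBm. apply andb_true_iff in HBm as [_ HBm]. rewrite EN.
    exists ((U ++ C) ++ [npair (S n) 0]), (V ++ C'), (length (U ++ C)).
    assert (D1 : Forall (dom A) ((U ++ C) ++ [npair (S n) 0])).
    { rewrite !Forall_app. auto. }
    assert (D2 : Forall (dom A) (V ++ C')) by now apply Forall_app.
    replace (2 * S n) with (S (S (2 * n))) by lia.
    split; auto. split; auto. split; auto. split; auto. split; [|split].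
    (* The length bound uses two more points further down, which the descending sequence always
       supplies. *)
    + now apply (bf_length (x (S (S (2 * n)))) (x (S (S (S (2 * n))))) (x (S (S (S (S (2 * n))))))).
    + rewrite !length_app. simpl. lia.
    + apply nth_middle.
  - set (o := fun n => pi2 (cnth (pi2 (pi2 (w n))) (pi1 (pi2 (w n))))).
    apply (vectors_run e q0 Y o).
    + unfold o, rc in *. csolve.
    + unfold o. rewrite W0, ?pi1_pair, ?pi2_pair, ?pi1_pair, cnth_code. apply pi2_pair.
    + intros n. destruct (W n) as [(U & V & i & Ew & DU & DV & Hb & Ll & Hi & Ei) (m & HBm & Em)].
      assert (On : nth i V 0 = npair n (o n)).
      { destruct (bf_transfer (x (2 * n)) (x (S (2 * n))) U V) as [T _]; auto.
        specialize (T i Hi). rewrite Ei, pi1_pair in T. unfold o.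
        rewrite Ew, ?pi1_pair, ?pi2_pair, ?pi1_pair, cnth_code. rewrite <- T at 1. now rewrite pair_pi. }
      split.
      * rewrite <- On. rewrite Forall_forall in DV. apply DV, nth_In. lia.
      * rewrite Ew in Em, HBm. destruct (Spec n U V i m DU DV) as (C & C' & _ & _ & DC & DC' & EN & EB).
        rewrite EB in HBm. apply andb_true_iff in HBm as [_ HBm]. rewrite EN in Em.
        set (U2 := (U ++ C) ++ [npair (S n) 0]) in *. set (V2 := V ++ C') in *. set (j := length (U ++ C)) in *.
        assert (D1 : Forall (dom A) U2) by (unfold U2; rewrite !Forall_app; auto).
        assert (D2 : Forall (dom A) V2) by now apply Forall_app.
        assert (L2 : length U2 <= length V2).
        { now apply (bf_length (x (S (S (2 * n)))) (x (S (S (S (2 * n))))) (x (S (S (S (S (2 * n))))))). }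
        assert (Hj : j < length U2) by (unfold U2, j; rewrite (length_app (U ++ C)); simpl; lia).
        assert (Hi2 : i < length U2) by (unfold U2; rewrite !length_app; lia).
        assert (Ej : nth j U2 0 = npair (S n) 0) by apply nth_middle.
        assert (Ei2 : nth i U2 0 = npair n 0).
        { unfold U2. rewrite <- app_assoc, app_nth1; auto. }
        destruct (bf_transfer (x (S (S (2 * n)))) (x (S (S (S (2 * n))))) U2 V2) as [T1 T2]; auto.
        specialize (T1 j Hj). specialize (T2 j i Hj Hi2). rewrite Ej, pi1_pair in T1.
        rewrite Ej, Ei2 in T2. unfold parent at 1 in T2. rewrite pi1_pair, pi2_pair in T2.
        specialize (T2 eq_refl). unfold V2 in T2 at 2. rewrite app_nth1, On in T2 by lia.
        unfold parent in T2. apply npair_inj in T2 as [_ T2]. rewrite <- T2. f_equal.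
        unfold o. now rewrite Em, ?pi1_pair, ?pi2_pair, ?pi1_pair, cnth_code.
Qed.
End Runs.

Theorem descending_scott_paths d :
  high_for_descending_sequences d -> scott_complete d -> high_for_paths d.
Proof.
  intros Hdes (Y & HY & g & Hg) e q0 (f & Hf).
  cut (exists f', irun e q0 f' /\ rc Y f').
  { intros (f' & H1 & H2). exists f'. split; auto. now apply (rc_degree d Y). }
  set (A := G e q0 (npair 0 2)). destruct (G_index e q0 (npair 0 2)) as [eA HA].
  destruct harrison_index as (ix & Cix & Hix).
  set (k := fun q => npair e q).
  assert (Sc : forall q, exists i b, phi no_oracle g (npair eA (ix (k q))) i /\
    back_and_forth A (harrison (k q)) b /\
    forall a1 a2 x, Forall (dom A) a1 -> Forall (dom A) a2 -> odom (harrison (k q)) x ->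
      phi Y i (npair (tuple_code a1) (npair (tuple_code a2) x)) (Nat.b2n (b a1 a2 x))).
  { intros q. apply (Hg eA (ix (k q)) GL A (harrison (k q))); auto. apply harrison_harrison. }
  apply choice in Sc as [i Sc]. apply choice in Sc as [b Sc].
  destruct (run_path e q0 f Hf) as [p P].
  assert (Ep : shift p (npair 0 0) = npair 0 1).
  { unfold shift. rewrite pi1_pair, pi2_pair. destruct P as [-> _]. reflexivity. }
  assert (D00 : gdom e q0 (npair 0 0) = true) by apply gdom_0.
  assert (D01 : gdom e q0 (npair 0 1) = true) by (rewrite <- Ep; now apply shift_dom).
  set (z := fun q => b q [npair 0 0] [npair 0 1] test_point).
  (* Without a run from [q] the test point is standard, and there the translation along the path
     [p], which comes from the run from [q0], relates a tuple to its image. *)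
  assert (Z : forall q, (~ exists f, irun e q f) -> z q = true).
  { intros q N. unfold z. rewrite <- Ep. destruct (Sc q) as (_ & HB & _).
    apply (back_and_forth_automorphism A (shift p) (A_automorphism e q0 p P) (shift_invol p)
      (harrison (k q)) (b q) HB test_point) with (a := [npair 0 0]).
    - apply test_point_acc. unfold k. now rewrite pi1_pair, pi2_pair.
    - apply test_point_odom.
    - constructor; auto. }
  (* In the first case one fixed [q] suffices: its order supplies the descending sequence, while the
     run that is computed starts from [q0]. *)
  destruct (classic (exists q, (exists f, irun e q f) /\ z q = true)) as [(q & Rq & Zq)|N].
  - destruct (Sc q) as (_ & HB & Hphi).
    destruct (Hdes (below (harrison (k q)) test_point)) as (s & Hs & Cs).
    + split; [|apply harrison_below_index]. destruct (harrison_linear (k q)) as (L1 & L2 & L3).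
      split; [|split]; cbn [odom olt below].
      * intros x [Hx _]. now apply L1.
      * intros x y w [Hx _] [Hy _] [Hw _]. now apply L2.
      * intros x y [Hx _] [Hy _]. now apply L3.
    + apply test_point_ill_founded. unfold k. now rewrite pi1_pair, pi2_pair.
    + apply (bf_run e q0 (k q) (b q) HB Y s test_point); auto.
      * apply test_point_odom.
      * apply Hs.
      * intros n. destruct (Hs n) as [[H1 _] H2]. auto.
      * now apply (degree_rc d).
      * eauto.
  (* Now [z] is false exactly at the states with runs, and it is computable from [Y]; moving only to
     such states never gets stuck. *)
  - assert (Zr : forall q, z q = false <-> exists f, irun e q f).
    { intros q. split.
      - intros E. apply NNPP. intros R. rewrite (Z q R) in E. discriminate.
      - intros R. apply not_true_iff_false. intros E. apply N. eauto. }
    assert (Cz : rcb Y z).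
    { cut (rc Y (fun q => Nat.b2n (z q))); [auto|].
      assert (Ci : rc Y i).
      { apply (rc_univ Y no_oracle (fun _ => g) (fun q => npair eA (ix (k q)))).
        - exact (cfb_const (eq Y) false).
        - unfold rc. csolve.
        - apply (cf_weaken all_oracles); [intros; exact I|]. unfold k. csolve.
        - intros q. apply Sc. }
      apply (rc_univ Y Y i (fun _ => npair (tuple_code [npair 0 0]) (npair (tuple_code [npair 0 1]) test_point))); auto.
      - unfold rcb. eapply cfb_ext; [|apply (cfb_orc (eq Y) (fun _ n => n)); csolve]. now intros X n <-.
      - unfold rc. apply cf_const.
      - intros q. apply Sc; [constructor; auto|constructor; auto|apply test_point_odom]. }
    destruct (iterate_search Y (fun w m => edge_cert e (pi2 w) (pi1 m) (pi2 m) && negb (z (pi1 m)))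
      (fun _ m => pi1 m) (fun _ q => exists f, irun e q f) q0) as (w & Cw & W0 & W).
    + unfold edge_cert. csolve.
    + csolve.
    + eauto.
    + intros n q (f' & F0 & F). destruct (proj1 (edge_cert_spec _ _ _) (F 0)) as [t Ht].
      exists (npair (f' 1) t). rewrite pi1_pair, !pi2_pair, <- F0, Ht. apply negb_true_iff, Zr.
      exists (fun n => f' (S n)). split; auto.
    + intros n q m _ E. apply andb_true_iff in E as [_ E]. apply negb_true_iff, Zr in E. exact E.
    + exists w. split; auto. split; auto. intros n. destruct (W n) as (_ & m & E & ->).
      apply andb_true_iff in E as [E _]. rewrite pi2_pair in E. apply edge_cert_spec. eauto.
Qed.

Theorem mainTheorem17 :
  forall d : turing_degree,
    high_for_isomorphism d <->
    (high_for_descending_sequences d /\ scott_complete d).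
Proof.
  intros d. split.
  - intros H. apply high_for_isomorphism_paths in H. split.
    + now apply high_for_paths_descending.
    + now apply high_for_paths_scott_complete.
  - intros [H1 H2]. apply high_for_paths_isomorphism. now apply descending_scott_paths.
Qed.
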